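(* Let $X,Y$ be discrete random variables with finite entropy. Then $$C_{GK}(X,Y)=\sup_{R':\,S^+(R')=-1}C(X,Y;R'),$$ and if there exists no $R'$ for which $S^+(R')=-1$, then $C_{GK}(X,Y)=0$. Similarly, $$C_W(X,Y)=\inf_{R'':\,T^+(R'')=1}K(X,Y;R''),$$ and if there exists no $R''$ for which $T^+(R'')=1$, then $C_W(X,Y)=H(X,Y)$.
   Context: $A\leftrightarrow B\leftrightarrow C$ means that $A,B,C$ form a Markov chain in that order. Wyner's common information: $C_W(X,Y)=\inf I(X,Y;U)$ over all $U$ with $X\leftrightarrow U\leftrightarrow Y$. Gács-Körner common information: $C_{GK}(X,Y)=\sup I(X,Y;U)$ over all $U$ with $Y\leftrightarrow X\leftrightarrow U$ and $X\leftrightarrow Y\leftrightarrow U$ (for finite alphabets this equals the original Gács-Körner quantity, by Ahlswede and Körner). In terms of the region $\mathcal R_{GW}$ below, $C_W(X,Y)$ is the infimum of all $R_0$ such that for each $\epsilon>0$ some $(R_0,R_1,R_2)\in\mathcal R_{GW}$ has $R_0+R_1+R_2\le H(X,Y)+\epsilon$, and $C_{GK}(X,Y)$ is the supremum of all $R_0$ such that for each $\epsilon>0$ some $(R_0,R_1,R_2)\in\mathcal R_{GW}$ has $R_0+R_1\le H(X)+\epsilon$, $R_0+R_2\le H(Y)+\epsilon$. The lossless Gray-Wyner region $\mathcal R_{GW}$ is the convex closure of the set of all $(R_0,R_1,R_2)$ for which there is a random variable $U$ jointly distributed with $(X,Y)$ with $R_0\ge I(X,Y;U)$, $R_1\ge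 H(X|U)$, $R_2\ge H(Y|U)$. For $R'\in[0,I(X;Y)]$: $C(X,Y;R')=\inf\{R_0:(R_0,R_1,R_2)\in\mathcal R_{GW},\ R_0+R_1+R_2=H(X,Y)+R'\}$. For $R''\in[0,H(X,Y)-I(X;Y)]$: $K(X,Y;R'')=\sup\{R_0:(R_0,R_1,R_2)\in\mathcal R_{GW},\ 2R_0+R_1+R_2=H(X)+H(Y)+R''\}$. $S^+(R')$ denotes the right derivative of the (convex) function $R'\mapsto C(X,Y;R')$ at $R'$, and $T^+(R'')$ the right derivative of the (concave) function $R''\mapsto K(X,Y;R'')$ at $R''$; these are considered at points $R'<I(X;Y)$ and $R''<H(X,Y)-I(X;Y)$. *)

(* Defs.v *)
(* MathComp / MathComp-Analysis *)
From HB Require Import structures.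
From mathcomp Require Import all_boot all_order all_algebra.
From mathcomp Require Import all_classical all_reals all_analysis.

Set Implicit Arguments.
Unset Strict Implicit.
Unset Printing Implicit Defensive.

Import Order.TTheory GRing.Theory Num.Theory.
Import numFieldNormedType.Exports.

Local Open Scope classical_set_scope.
Local Open Scope ring_scope.
Local Open Scope ereal_scope.

Section information.
Context {R : realType} {d} {W : measurableType d} (P : probability W R).

(* [ln 0 = 0] gives the convention 0 ln 0 = 0. Entropies are in nats. *)
Definition negxlnx (p : R) : \bar R := (- (p * ln p))%:E.

(* Only meaningful when [X] has a countable range and the fibers of [X] are
   measurable; the value +oo is possible. *)
Definition entropy {T : choiceType} (X : W -> T) : \bar R :=
  \esum_(x in range X) negxlnx (fine (P (X @^-1` [set x]))).

(* v |-> P(E | U = v), i.e., a [0, 1]-valued version of the Radon-Nikodym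
   derivative of A |-> P(E, U \in A) with respect to the law of U. For E
   measurable it exists and is unique up to a null set of the law of U, so that
   nothing below depends on the version selected by [get]. *)
Definition cond_prob {dV} {V : measurableType dV} (E : set W)
    (U : {RV P >-> V}) : V -> R :=
  get [set g : V -> R | [/\ measurable_fun [set: V] g,
    (forall v, 0 <= g v <= 1)%R &
    forall A, measurable A ->
      P (E `&` U @^-1` A) = \int[distribution P U]_(v in A) (g v)%:E]].

(* H(X | U) = E[H(X | U = .)]; X takes countably many values, U is arbitrary. *)
Definition cond_entropy {T : choiceType} {dV} {V : measurableType dV} (X : W -> T)
    (U : {RV P >-> V}) : \bar R :=
  \int[distribution P U]_v
    \esum_(x in range X) negxlnx (cond_prob (X @^-1` [set x]) U v).

(* Only used for X with a finite entropy. *)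
Definition mutual_info {T : choiceType} {dV} {V : measurableType dV} (X : W -> T)
    (U : {RV P >-> V}) : \bar R :=
  entropy X - cond_entropy X U.

(* A <-> B <-> C : A and C are conditionally independent given B. *)
Definition markov_chain {dA dB dC} {TA : measurableType dA}
    {TB : measurableType dB} {TC : measurableType dC}
    (A : {RV P >-> TA}) (B : {RV P >-> TB}) (C : {RV P >-> TC}) : Prop :=
  forall (E : set TA) (F : set TC), measurable E -> measurable F ->
    {ae distribution P B, forall b,
      cond_prob (A @^-1` E `&` C @^-1` F) B b =
      (cond_prob (A @^-1` E) B b * cond_prob (C @^-1` F) B b)%R}.

End information.
Arguments entropy {R d W} P {T} X.
Arguments cond_prob {R d W} P {dV V} E U v.
Arguments cond_entropy {R d W} P {T dV V} X U.
Arguments mutual_info {R d W} P {T dV V} X U.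
Arguments markov_chain {R d W} P {dA dB dC TA TB TC} A B C.

Definition pair_rv {W T1 T2 : Type} (X : W -> T1) (Y : W -> T2) (w : W) :
  T1 * T2 := (X w, Y w).

Section common_information.
Context {R : realType} {d d1 d2} {W : measurableType d}
  {T1 : measurableType d1} {T2 : measurableType d2} (P : probability W R).
Variables (X : {dRV P >-> T1}) (Y : {dRV P >-> T2}).

(* A random variable U jointly distributed with (X, Y). The sample space W may
   be too small to carry U, hence the copy (X', Y') of (X, Y) with the same
   joint law, on a space where U lives. The space of values of U is arbitrary. *)
Record jointly_distributed : Type := JointlyDistributed {
  jd_dW : measure_display;
  jd_W : measurableType jd_dW;
  jd_P : probability jd_W R;
  jd_X : {dRV jd_P >-> T1};
  jd_Y : {dRV jd_P >-> T2};
  jd_law : forall A : set (T1 * T2), measurable A ->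
    jd_P (pair_rv jd_X jd_Y @^-1` A) = P (pair_rv X Y @^-1` A);
  jd_dV : measure_display;
  jd_V : measurableType jd_dV;
  jd_U : {RV jd_P >-> jd_V} }.

Definition jd_info (u : jointly_distributed) : \bar R :=
  mutual_info (jd_P u) (pair_rv (jd_X u) (jd_Y u)) (jd_U u).

Definition wyner : \bar R :=
  ereal_inf [set i | exists u : jointly_distributed,
    markov_chain (jd_P u) (jd_X u) (jd_U u) (jd_Y u) /\ i = jd_info u].

Definition gacs_korner : \bar R :=
  ereal_sup [set i | exists u : jointly_distributed,
    [/\ markov_chain (jd_P u) (jd_Y u) (jd_X u) (jd_U u),
        markov_chain (jd_P u) (jd_X u) (jd_Y u) (jd_U u) & i = jd_info u]].

Definition rate_triples : set (R^o * R^o * R^o) :=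
  [set r | exists u : jointly_distributed,
    [/\ jd_info u <= (r.1.1)%:E,
        cond_entropy (jd_P u) (jd_X u) (jd_U u) <= (r.1.2)%:E &
        cond_entropy (jd_P u) (jd_Y u) (jd_U u) <= (r.2)%:E]].

(* The smallest closed convex superset, i.e., the closed convex hull. *)
Definition gray_wyner : set (R^o * R^o * R^o) :=
  smallest [set D : set (R^o * R^o * R^o) | closed D /\ convex_set D]
    rate_triples.

Definition HXY : \bar R := entropy P (pair_rv X Y).

Definition IXY : \bar R := mutual_info P X Y.

Definition C_fun (r' : R) : \bar R :=
  ereal_inf [set r0%:E | r0 in [set r0 : R | exists r1 r2 : R,
    gray_wyner (r0, r1, r2) /\ (r0 + r1 + r2)%:E = HXY + r'%:E]].

Definition K_fun (r'' : R) : \bar R :=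
  ereal_sup [set r0%:E | r0 in [set r0 : R | exists r1 r2 : R,
    gray_wyner (r0, r1, r2) /\
    (2 * r0 + r1 + r2)%:E = entropy P X + entropy P Y + r''%:E]].

End common_information.
Arguments jointly_distributed {R d d1 d2 W T1 T2} P X Y.
Arguments wyner {R d d1 d2 W T1 T2} P X Y.
Arguments gacs_korner {R d d1 d2 W T1 T2} P X Y.
Arguments rate_triples {R d d1 d2 W T1 T2} P X Y _.
Arguments gray_wyner {R d d1 d2 W T1 T2} P X Y _.
Arguments HXY {R d d1 d2 W T1 T2} P X Y.
Arguments IXY {R d d1 d2 W T1 T2} P X Y.
Arguments C_fun {R d d1 d2 W T1 T2} P X Y r'.
Arguments K_fun {R d d1 d2 W T1 T2} P X Y r''.

Definition is_right_derivative {R : realType} (f : R -> \bar R) (x l : R) :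
  Prop := (f (x + h)%R - f x) * (h^-1)%:E @[h --> 0%R^'+] --> l%:E.

(* The last point of the domain of C (resp. K) is excluded below, since there is
   no right derivative there. *)
Section slopes.
Context {R : realType} {d d1 d2} {W : measurableType d}
  {T1 : measurableType d1} {T2 : measurableType d2} (P : probability W R).
Variables (X : {dRV P >-> T1}) (Y : {dRV P >-> T2}).

Definition C_slopeN1 : set R :=
  [set r' : R | [/\ (0 <= r')%R, r'%:E < IXY P X Y &
    is_right_derivative (C_fun P X Y) r' (-1)]].

Definition K_slope1 : set R :=
  [set r'' : R | [/\ (0 <= r'')%R, r''%:E < HXY P X Y - IXY P X Y &
    is_right_derivative (K_fun P X Y) r'' 1]].

End slopes.
Arguments C_slopeN1 {R d d1 d2 W T1 T2} P X Y _.
Arguments K_slope1 {R d d1 d2 W T1 T2} P X Y _.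

(* Main.v *)
(* The triple (R0, R1, R2) = (0, H(X), H(Y)) lies in the region (take U constant)
   and R0 + R1 >= H(X), R0 + R2 >= H(Y) hold on it, so C(R') >= I(X;Y) - R',
   and a chord from any point of the graph of C to that triple shows that the
   right derivative -1 at R' is equivalent to C(R') = I(X;Y) - R', i.e., to a
   point of the region with R0 + R1 = H(X) and R0 + R2 = H(Y). Symmetrically,
   with (H(X,Y), 0, 0) (take U = (X,Y)), K(R'') <= I(X;Y) + R'' and slope 1 at R''
   means that the region has a point with R0 + R1 + R2 = H(X,Y).
   It remains to turn such points of a closed convex hull into a single U. The
   faces in question are exposed, so a penalization yields U_n for which the
   conditional mutual informations that must vanish do so at the limit. The joint
   laws of the posterior probabilities P(X = i, Y = j | U_n), i.e., probabilities
   on [0, 1]^N, converge along an ultrafilter; the limit law is realized by some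
   U, and H(X|U), H(Y|U) and H(X,Y|U) are continuous because the terms of their
   series are dominated by those of H(X), H(Y) and H(X,Y). Finally the Markov
   conditions are the equality cases of Gibbs' inequality. *)
Require Import Defs.
From HB Require Import structures.
From mathcomp Require Import all_boot all_order all_algebra.
From mathcomp Require Import all_classical all_reals all_analysis.
From mathcomp Require Import measurable_realfun ring lra.

Set Implicit Arguments.
Unset Strict Implicit.
Unset Printing Implicit Defensive.

Import Order.TTheory GRing.Theory Num.Theory.
Import numFieldNormedType.Exports.

Local Open Scope classical_set_scope.
Local Open Scope ring_scope.
Local Open Scope ereal_scope.

(** Entropies may be infinite while they are being compared, so information inequalities are written
    with nonnegative terms and no subtraction; Gibbs' inequality takes the form
    [- a ln a + a <= - a ln b + b]. A point of the closed convex hull has no U of its own: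
    membership only yields the linear inequalities that hold on all rate triples, hence the
    penalization, whose weight K tends to infinity against errors of size K^-2. The U_n live on
    unrelated spaces, but the region sees them only through their posteriors, countably many
    functions into [0, 1] over fixed masses. The limit law is built by hand: posteriors are written
    in binary, the probability of each finite word of bits converges along the ultrafilter, and
    [0, 1] with the uniform law is cut into intervals of these lengths. An infinite sum of
    posteriors is not continuous on the cube, so the limit first gives an inequality; equality
    returns because the total masses agree. The domination of the entropy series is Jensen's
    inequality, itself a case of Gibbs' inequality. *)

(** * Equality almost everywhere from equality of integrals *)

Section ae_comparison.
Context {R : realType} {d} {V : measurableType d}.
Variable Q : {measure set V -> \bar R}.

(** The inequality holds over each [E] and over its complement in [D], so the reversed one over [D]
    forces equality over every [E]. Arguing with sets avoids the difference [g - f], which is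
    delicate at infinite values. *)
Lemma ge0_le_integral_eq_ae (D : set V) (f g : V -> \bar R) :
  measurable D -> measurable_fun D f -> measurable_fun D g ->
  (forall v, D v -> 0 <= f v) -> (forall v, D v -> 0 <= g v) ->
  {ae Q, forall v, D v -> f v <= g v} ->
  \int[Q]_(v in D) g v <= \int[Q]_(v in D) f v ->
  \int[Q]_(v in D) f v < +oo ->
  ae_eq Q D f g.
Proof.
move=> mD mf mg f0 g0 fg gf ltoo.
have leE E : E `<=` D -> measurable E ->
    \int[Q]_(v in E) f v <= \int[Q]_(v in E) g v.
  move=> ED mE; apply: ae_ge0_le_integral => //.
  - by move=> v /ED; exact: f0.
  - exact: measurable_funS mf.
  - by move=> v /ED; exact: g0.
  - exact: measurable_funS mg.
  - by apply: filterS fg => v /= h /ED.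
apply: integral_ae_eq => //.
  apply/integrableP; split => //.
  by rewrite (eq_integral f)// => v /set_mem Dv; rewrite gee0_abs ?f0.
move=> E ED mE; apply/eqP; rewrite eq_le leE//=.
have mDE : measurable (D `\` E) by exact: measurableD.
have split h : measurable_fun D h -> (forall v, D v -> 0 <= h v) ->
    \int[Q]_(v in D) h v = \int[Q]_(v in E) h v + \int[Q]_(v in D `\` E) h v.
  move=> mh h0; rewrite -ge0_integral_setU//; first by rewrite setDUK.
  - by rewrite setDUK.
  - by rewrite setDUK.
  - by rewrite disj_set2E setDIK.
have int0 h B : (forall v, D v -> 0 <= h v) -> B `<=` D -> 0 <= \int[Q]_(v in B) h v.
  by move=> h0 BD; apply: integral_ge0 => v /BD; exact: h0.
move: gf; rewrite (split f)// (split g)//.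
have DEfin : \int[Q]_(v in D `\` E) f v \is a fin_num.
  rewrite ge0_fin_numE ?int0//; apply: le_lt_trans ltoo; rewrite (split f)//.
  by rewrite leeDr// int0.
move=> h; rewrite -(leeD2rE _ _ DEfin); apply: le_trans h.
by rewrite leeD2l// leE.
Qed.

End ae_comparison.

(** * Conditional probabilities as Radon-Nikodym derivatives *)

Section conditional_probability.
Context {R : realType} {d} {W : measurableType d} (P : probability W R).
Context {dV} {V : measurableType dV} (U : {RV P >-> V}).

Let Q := distribution P U.

Let mU A : measurable A -> measurable (U @^-1` A).
Proof. by move=> mA; rewrite -[_ @^-1` _]setTI; exact: measurable_funPT. Qed.

(** The proof of [measurable E] is an argument so that [slice mE] can carry the structure of a
    finite measure. *)
Definition slice (E : set W) & measurable E : set V -> \bar R :=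
  fun A => P (E `&` U @^-1` A).

Section slice_measure.
Variables (E : set W) (mE : measurable E).

Let slice0 : slice mE set0 = 0.
Proof. by rewrite /slice preimage_set0 setI0 measure0. Qed.

Let slice_ge0 A : 0 <= slice mE A. Proof. exact: measure_ge0. Qed.

Let slice_sigma_additive : semi_sigma_additive (slice mE).
Proof.
move=> F mF tF mUF; rewrite /slice preimage_bigcup setI_bigcupr.
apply: measure_semi_sigma_additive.
- by move=> n; apply: measurableI => //; exact: mU.
- apply/trivIset_setIl/trivIsetP => i j _ _ ij; rewrite -preimage_setI.
  by move/trivIsetP : tF => /(_ i j I I ij) ->; rewrite preimage_set0.
- by rewrite -setI_bigcupr -preimage_bigcup; apply: measurableI => //; exact: mU.
Qed.

HB.instance Definition _ := isMeasure.Build _ _ _ (slice mE)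
  slice0 slice_ge0 slice_sigma_additive.

Let slice_fin : fin_num_fun (slice mE).
Proof.
move=> A mA; rewrite fin_num_measure//; apply: measurableI => //; exact: mU.
Qed.

HB.instance Definition _ := Measure_isFinite.Build _ _ _ (slice mE) slice_fin.

End slice_measure.

(** The measure A |-> P(E, U in A) is dominated by the law of U; its density is at most 1 almost
    everywhere, and truncating it gives a version with values in [0, 1]. *)
Lemma cond_prob_exists (E : set W) : measurable E ->
  exists g : V -> R, [/\ measurable_fun [set: V] g,
    (forall v, 0 <= g v <= 1)%R &
    forall A, measurable A ->
      P (E `&` U @^-1` A) = \int[Q]_(v in A) (g v)%:E].
Proof.
move=> mE; pose nuF : {finite_measure set V -> \bar R} := slice mE.
have nuE A : nuF A = P (E `&` U @^-1` A) by [].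
have nuQ : nuF `<< Q.
  apply/null_content_dominatesP => A mA QA0; apply/eqP; rewrite /= eq_le measure_ge0 andbT.
  rewrite -QA0 [leLHS]nuE; apply: le_measure; rewrite ?inE//.
  - by apply: measurableI => //; exact: mU.
  - exact: mU.
have [f [f0 fi nuf']] := radon_nikodym_finite nuQ.
have mf : measurable_fun [set: V] f by exact: measurable_int fi.
pose B := [set v | 1 < f v].
have mB : measurable B.
  rewrite /B -[X in measurable X]setTI; exact: measurable_lte.
have QB0 : Q B = 0.
  (* Over [B], where [f > 1], the integral of [f] is P(E, U in B), at most Q(B), which is the
     integral of 1. Hence [f = 1] almost everywhere on [B], and [B] is null. *)
  have [] : ae_eq Q B (cst 1) f.
    apply: ge0_le_integral_eq_ae => //.
    - exact: measurable_funS mf.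
    - by apply: aeW => v; exact: ltW.
    - rewrite -nuf'// integral_cst// mul1e /= [leLHS]nuE.
      by apply: le_measure; rewrite ?inE//; [apply: measurableI => //|]; exact: mU.
    - by rewrite integral_cst// mul1e ltey_eq fin_num_measure.
  move=> N [mN N0 BN]; apply/eqP; rewrite eq_le measure_ge0 andbT -N0.
  apply: le_measure; rewrite ?inE// => v Bv; apply: BN => /= /(_ Bv) h.
  by move: Bv; rewrite /B /= -h ltxx.
exists (fun v => Num.min (fine (f v)) 1%R); split.
- by apply: measurable_minr => //; exact: measurableT_comp.
- by move=> v; rewrite le_min ge_min lexx ler01 orbT andbT fine_ge0.
move=> A mA; rewrite -nuE nuf'//; apply: ge0_ae_eq_integral => //.
- exact: measurable_funS mf.
- apply/measurable_EFinP; apply: measurable_funTS.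
  by apply: measurable_minr => //; exact: measurableT_comp.
- by move=> v _; rewrite lee_fin le_min ler01 fine_ge0.
exists B; split => // v /= /not_implyP[Av fv]; rewrite /B/= ltNge; apply/negP => f1.
apply: fv; have ffin : f v \is a fin_num.
  by rewrite ge0_fin_numE// (le_lt_trans f1)// ltry.
by rewrite min_l ?fineK// -lee_fin fineK.
Qed.

Lemma cond_probP (E : set W) : measurable E ->
  [/\ measurable_fun [set: V] (cond_prob P E U),
    (forall v, 0 <= cond_prob P E U v <= 1)%R &
    forall A, measurable A ->
      P (E `&` U @^-1` A) = \int[Q]_(v in A) (cond_prob P E U v)%:E].
Proof. by move=> /cond_prob_exists[g gP]; rewrite /cond_prob; case: xgetP => [h _|/(_ g)]. Qed.

Lemma cond_prob_unique (E : set W) (g : V -> R) :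
  measurable E -> measurable_fun [set: V] g -> (forall v, 0 <= g v)%R ->
  (forall A, measurable A ->
    P (E `&` U @^-1` A) = \int[Q]_(v in A) (g v)%:E) ->
  {ae Q, forall v, cond_prob P E U v = g v}.
Proof.
move=> mE mg g0 gE; have [mc c01 cE] := cond_probP mE.
have : ae_eq Q setT (EFin \o cond_prob P E U) (EFin \o g).
  apply: integral_ae_eq => //.
  - apply/integrableP; split; first exact/measurable_EFinP.
    rewrite (eq_integral (EFin \o cond_prob P E U)); last first.
      by move=> v _; rewrite /= ger0_norm//; case/andP: (c01 v).
    by rewrite -cE// ltey_eq fin_num_measure// preimage_setT setIT.
  - exact/measurable_EFinP.
  - by move=> A _ mA; rewrite -cE// gE.
by apply: filterS => v /(_ I)[].
Qed.

End conditional_probability.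

(** * Termwise equality in nonnegative series *)

Section nonneg_series.
Context {R : realType}.
Implicit Types f h : nat -> \bar R.

Lemma nneseries_term_le f i : (forall k, 0 <= f k) -> f i <= \sum_(k <oo) f k.
Proof.
move=> f0; rewrite (nneseriesD1 (n := i))//.
by rewrite leeDl// nneseries_ge0.
Qed.

(** Counterpart of [ge0_le_integral_eq_ae] for series: once term [i] is split off, the remaining
    sums are ordered like the terms, so they cancel from the reversed inequality. *)
Lemma nneseries_le_eq f h : (forall i, 0 <= f i) -> (forall i, f i <= h i) ->
  \sum_(i <oo) h i <= \sum_(i <oo) f i -> \sum_(i <oo) f i < +oo ->
  forall i, f i = h i.
Proof.
move=> f0 fh hf ltoo i; have h0 k : 0 <= h k := le_trans (f0 k) (fh k).
apply/eqP; rewrite eq_le fh/=.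
move: hf ltoo; rewrite (nneseriesD1 (n := i))// (nneseriesD1 (f := f) (n := i))//.
set A := \sum_(_ <oo | _) h _; set B := \sum_(_ <oo | _) f _.
have BA : B <= A by apply: lee_nneseries.
have B0 : 0 <= B by exact: nneseries_ge0.
move=> hAfB ltoo.
have Bfin : B \is a fin_num.
  by rewrite ge0_fin_numE// (le_lt_trans _ ltoo)// leeDr.
by rewrite -(leeD2rE _ _ Bfin); apply: le_trans hAfB; rewrite leeD2l.
Qed.

End nonneg_series.

(** * Gibbs' inequality, pointwise and integrated *)

Section gibbs.
Context {R : realType}.

Lemma negxlnx_ge0 (p : R) : (0 <= p <= 1)%R -> 0 <= negxlnx p.
Proof.
by case/andP => p0 p1; rewrite lee_fin oppr_ge0 mulr_ge0_le0// ln_le0.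
Qed.

Lemma negxlnx0 : negxlnx (0 : R) = 0.
Proof. by rewrite /negxlnx mul0r oppr0. Qed.

Lemma negxlnx1 : negxlnx (1 : R) = 0.
Proof. by rewrite /negxlnx ln1 mulr0 oppr0. Qed.

(** This is [1 + t <= expR t] at [t = ln b - ln a], multiplied by [a]. The summands [a] and [b] make
    it hold pointwise, without normalization, and for values in [0, 1] every term is nonnegative, so
    it can be integrated and summed freely. Since [ln 0 = 0], the case [b = 0 < a] has to be
    excluded. *)
Lemma gibbs (a b : R) : (0 <= a -> 0 <= b -> (0 < a -> 0 < b) ->
  - (a * ln a) + a <= a * - ln b + b)%R.
Proof.
move=> a0 b0 ab; move: a0; rewrite le_eqVlt => /predU1P[<-|a0].
  by rewrite !mul0r oppr0 !add0r.
have {}b0 := ab a0.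
have := expR_ge1Dx (ln b - ln a)%R.
rewrite expRD expRN !lnK ?posrE// -(ler_pM2l a0).
have -> : (a * (b / a) = b)%R by field; rewrite gt_eqF.
by lra.
Qed.

(** The exponential inequality is strict away from 0. *)
Lemma gibbs_eq (a b : R) : (0 <= a -> 0 <= b -> (0 < a -> 0 < b) ->
  - (a * ln a) + a = a * - ln b + b -> a = b)%R.
Proof.
move=> a0 b0 ab; move: a0; rewrite le_eqVlt => /predU1P[<-|a0].
  by rewrite !mul0r oppr0 !add0r.
have {}b0 := ab a0.
have [lnab _|] := eqVneq (ln a) (ln b).
  by apply: ln_inj; rewrite ?posrE.
move=> lnab; have : (ln b - ln a)%R != 0%R by rewrite subr_eq0 eq_sym.
move/expR_gt1Dx.
rewrite expRD expRN !lnK ?posrE// -(ltr_pM2l a0).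
have -> : (a * (b / a) = b)%R by field; rewrite gt_eqF.
by lra.
Qed.

End gibbs.

Lemma integral_cst_probability {R : realType} {d} {V : measurableType d}
  (Q : probability V R) (c : R) : \int[Q]_v c%:E = c%:E.
Proof.
rewrite integral_cst// -[RHS]mule1; congr (_ * _); exact: probability_setT.
Qed.

Section integral_gibbs.
Context {R : realType} {d} {V : measurableType d} (Q : probability V R).
Variables a b1 b2 : V -> R.
Hypotheses (ma : measurable_fun [set: V] a) (mb1 : measurable_fun [set: V] b1)
  (mb2 : measurable_fun [set: V] b2).
Hypotheses (a01 : forall v, (0 <= a v <= 1)%R)
  (b101 : forall v, (0 <= b1 v <= 1)%R) (b201 : forall v, (0 <= b2 v <= 1)%R).
Hypothesis ab : {ae Q, forall v, (0 < a v -> 0 < b1 v /\ 0 < b2 v)%R}.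

Let a0 v : (0 <= a v)%R. Proof. by case/andP: (a01 v). Qed.
Let b10 v : (0 <= b1 v)%R. Proof. by case/andP: (b101 v). Qed.
Let b20 v : (0 <= b2 v)%R. Proof. by case/andP: (b201 v). Qed.
Let nln0 (b : V -> R) v : (forall v, (0 <= b v <= 1)%R) -> (0 <= a v * - ln (b v))%R.
Proof. by move=> /(_ v)/andP[_ ?]; rewrite mulr_ge0// oppr_ge0 ln_le0. Qed.

Lemma measurable_negxlnx : measurable_fun [set: V] (fun v => negxlnx (a v)).
Proof.
apply/measurable_EFinP; apply: measurableT_comp => //.
apply: measurable_funM => //; exact: measurableT_comp (@measurable_ln R) ma.
Qed.

Let mln b : measurable_fun [set: V] b ->
  measurable_fun [set: V] (fun v => (a v * - ln (b v))%:E).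
Proof.
move=> mb; apply/measurable_EFinP; apply: measurable_funM => //.
by apply: measurableT_comp => //; exact: measurableT_comp (@measurable_ln R) mb.
Qed.

Let mEa : measurable_fun [set: V] (EFin \o a). Proof. exact/measurable_EFinP. Qed.
Let mEb : measurable_fun [set: V] (fun v => (b1 v * b2 v)%:E).
Proof. by apply/measurable_EFinP; exact: measurable_funM. Qed.

Let lhsE : \int[Q]_v negxlnx (a v) + \int[Q]_v (a v)%:E =
  \int[Q]_v (negxlnx (a v) + (a v)%:E).
Proof.
rewrite ge0_integralD//; first by move=> v _; exact: negxlnx_ge0.
  exact: measurable_negxlnx.
by move=> v _; rewrite lee_fin.
Qed.

Let rhsE : \int[Q]_v (a v * - ln (b1 v))%:E + \int[Q]_v (a v * - ln (b2 v))%:E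
  + \int[Q]_v (b1 v * b2 v)%:E =
  \int[Q]_v ((a v * - ln (b1 v))%:E + (a v * - ln (b2 v))%:E + (b1 v * b2 v)%:E).
Proof.
rewrite ge0_integralD//.
- rewrite ge0_integralD//.
  + by move=> v _; rewrite lee_fin nln0.
  + exact: mln.
  + by move=> v _; rewrite lee_fin nln0.
  + exact: mln.
- by move=> v _; rewrite adde_ge0// lee_fin nln0.
- by apply: emeasurable_funD; exact: mln.
- by move=> v _; rewrite lee_fin mulr_ge0.
Qed.

(** Where [a v = 0] both sides vanish; elsewhere both factors are positive and the logarithm of
    their product splits. *)
Let key v : (0 < a v -> 0 < b1 v /\ 0 < b2 v)%R ->
  (0 < a v -> 0 < b1 v * b2 v)%R /\
  (a v * - ln (b1 v) + a v * - ln (b2 v) = a v * - ln (b1 v * b2 v))%R.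
Proof.
move=> h; split; first by move=> /h[? ?]; rewrite mulr_gt0.
have := a0 v; rewrite le_eqVlt => /predU1P[<-|/h[? ?]]; first by rewrite !mul0r addr0.
by rewrite lnM ?posrE//; ring.
Qed.

Let fle : {ae Q, forall v, [set: V] v -> negxlnx (a v) + (a v)%:E <=
  (a v * - ln (b1 v))%:E + (a v * - ln (b2 v))%:E + (b1 v * b2 v)%:E}.
Proof.
apply: filterS ab => v /key[h1 h2] _; rewrite -!EFinD lee_fin h2.
by apply: gibbs => //; exact: mulr_ge0.
Qed.

Let f0 v : 0 <= negxlnx (a v) + (a v)%:E.
Proof. by rewrite adde_ge0 ?negxlnx_ge0// lee_fin. Qed.
Let h0 v : 0 <= (a v * - ln (b1 v))%:E + (a v * - ln (b2 v))%:E + (b1 v * b2 v)%:E.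
Proof. by rewrite !adde_ge0// lee_fin ?nln0// mulr_ge0. Qed.
Let mf : measurable_fun [set: V] (fun v => negxlnx (a v) + (a v)%:E).
Proof. by apply: emeasurable_funD => //; exact: measurable_negxlnx. Qed.
Let mh : measurable_fun [set: V] (fun v =>
  (a v * - ln (b1 v))%:E + (a v * - ln (b2 v))%:E + (b1 v * b2 v)%:E).
Proof. by apply: emeasurable_funD => //; apply: emeasurable_funD; exact: mln. Qed.

(** The comparison is with the product [b1 * b2]; its cross term is split because the two parts are
    later summed over different indices. *)
Lemma integral_gibbs : \int[Q]_v negxlnx (a v) + \int[Q]_v (a v)%:E <=
  \int[Q]_v (a v * - ln (b1 v))%:E + \int[Q]_v (a v * - ln (b2 v))%:E
  + \int[Q]_v (b1 v * b2 v)%:E.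
Proof. by rewrite lhsE rhsE; exact: ae_ge0_le_integral. Qed.

Lemma integral_gibbs_eq :
  \int[Q]_v negxlnx (a v) + \int[Q]_v (a v)%:E < +oo ->
  \int[Q]_v negxlnx (a v) + \int[Q]_v (a v)%:E =
  \int[Q]_v (a v * - ln (b1 v))%:E + \int[Q]_v (a v * - ln (b2 v))%:E
  + \int[Q]_v (b1 v * b2 v)%:E ->
  {ae Q, forall v, a v = (b1 v * b2 v)%R}.
Proof.
rewrite lhsE rhsE => ltoo fh.
have := ge0_le_integral_eq_ae measurableT mf mh
  (fun v _ => f0 v) (fun v _ => h0 v) fle.
rewrite -fh => /(_ (lexx _) ltoo);
apply: filterS2 ab => v /key[h1 h2] /(_ I); rewrite -!EFinD => -[].
by rewrite h2; apply: gibbs_eq => //; exact: mulr_ge0.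
Qed.

Lemma integral_gibbs_prod : {ae Q, forall v, a v = (b1 v * b2 v)%R} ->
  \int[Q]_v negxlnx (a v) =
  \int[Q]_v (a v * - ln (b1 v))%:E + \int[Q]_v (a v * - ln (b2 v))%:E.
Proof.
move=> aE; rewrite -ge0_integralD//; last 4 first.
- by move=> v _; rewrite lee_fin nln0.
- exact: mln.
- by move=> v _; rewrite lee_fin nln0.
- exact: mln.
apply: ge0_ae_eq_integral => //.
- exact: measurable_negxlnx.
- by apply: emeasurable_funD; exact: mln.
- by move=> v _; exact: negxlnx_ge0.
- by move=> v _; rewrite adde_ge0// lee_fin nln0.
- apply: filterS2 ab aE => v /key[h1 h2] aE _; rewrite -EFinD h2 -aE.
  by rewrite /negxlnx mulrN.
Qed.

End integral_gibbs.

(** Jensen's inequality for [- x ln x], read off Gibbs' inequality with the constants [b1 = p] and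
    [b2 = 1]: the terms [p] on the two sides cancel. *)
Lemma integral_negxlnx_le {R : realType} {d} {V : measurableType d}
    (Q : probability V R) (a : V -> R) (p : R) :
  measurable_fun [set: V] a -> (forall v, (0 <= a v <= 1)%R) ->
  \int[Q]_v (a v)%:E = p%:E -> (0 <= p <= 1)%R /\
  \int[Q]_v negxlnx (a v) <= negxlnx p.
Proof.
move=> ma a01 ap.
have mEa : measurable_fun [set: V] (EFin \o a) by exact/measurable_EFinP.
have a0 v : (0 <= a v)%R by case/andP: (a01 v).
have p0 : (0 <= p)%R.
  by rewrite -lee_fin -ap; apply: integral_ge0 => v _; rewrite lee_fin.
have p1 : (p <= 1)%R.
  rewrite -lee_fin -ap; apply: (@le_trans _ _ (\int[Q]_v cst 1%E v)).
    by apply: ge0_le_integral => // v _; rewrite lee_fin //; case/andP: (a01 v).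
  by rewrite integral_cst_probability.
split; first by rewrite p0 p1.
have p01 : (0 <= p <= 1)%R by rewrite p0 p1.
(* If [p = 0] then [a] vanishes almost everywhere, and the positivity condition holds vacuously. *)
have pa : {ae Q, forall v, (0 < a v -> 0 < p /\ 0 < 1 :> R)%R}.
  move: p0; rewrite le_eqVlt => /predU1P[p0|p0]; last by apply: aeW.
  have : ae_eq Q setT (cst 0) (EFin \o a).
    apply: ge0_le_integral_eq_ae => //.
    - by move=> v _; rewrite lee_fin.
    - by apply: aeW => v _; rewrite lee_fin.
    - by rewrite integral0 ap -p0.
    - by rewrite integral0 ltry.
  by apply: filterS => v /(_ I) [] <-; rewrite ltxx.
have := integral_gibbs (b1 := cst p) (b2 := cst 1%R) ma
  (@measurable_cst _ _ _ _ _ _) (@measurable_cst _ _ _ _ _ _) a01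
  (fun=> p01) (fun=> introT andP (conj ler01 (lexx 1%R))) pa.
under [X in _ <= X + _ + _]eq_integral do rewrite mulrC EFinM.
rewrite /= ge0_integralZl//; last 2 first.
- by move=> v _; rewrite lee_fin.
- by rewrite lee_fin oppr_ge0 ln_le0.
under [X in _ <= _ + X + _]eq_integral do rewrite ln1 oppr0 mulr0.
rewrite integral0 adde0 ap mulr1 integral_cst_probability leeD2rE//.
by rewrite /negxlnx -EFinM mulNr mulrC.
Qed.

(* The conditional laws given a variable with law [Q] of a pair of nat-valued
   variables: [g i j v] stands for P(X = i, Y = j | U = v), with marginals
   [gx], [gy]; the unconditional masses are [p], [px], [py]. *)
Record posteriors {R : realType} {d} {V : measurableType d}
    (Q : probability V R) (p : nat -> nat -> R) (px py : nat -> R)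
    (g : nat -> nat -> V -> R) (gx gy : nat -> V -> R) : Prop := Posteriors {
  post_m : forall i j, measurable_fun [set: V] (g i j);
  post_mx : forall i, measurable_fun [set: V] (gx i);
  post_my : forall j, measurable_fun [set: V] (gy j);
  post01 : forall i j v, (0 <= g i j v <= 1)%R;
  postx01 : forall i v, (0 <= gx i v <= 1)%R;
  posty01 : forall j v, (0 <= gy j v <= 1)%R;
  post_row : forall i, {ae Q, forall v, \sum_(j <oo) (g i j v)%:E = (gx i v)%:E};
  post_col : forall j, {ae Q, forall v, \sum_(i <oo) (g i j v)%:E = (gy j v)%:E};
  postx1 : {ae Q, forall v, \sum_(i <oo) (gx i v)%:E = 1};
  posty1 : {ae Q, forall v, \sum_(j <oo) (gy j v)%:E = 1};
  post_int : forall i j, \int[Q]_v (g i j v)%:E = (p i j)%:E;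
  postx_int : forall i, \int[Q]_v (gx i v)%:E = (px i)%:E;
  posty_int : forall j, \int[Q]_v (gy j v)%:E = (py j)%:E }.

Lemma measurable_nneseries_EFin {R : realType} {d} {V : measurableType d}
    (f : nat -> V -> R) : (forall k v, (0 <= f k v)%R) ->
  (forall k, measurable_fun [set: V] (f k)) ->
  measurable_fun [set: V] (fun v => \sum_(k <oo) (f k v)%:E).
Proof.
move=> f0 mf; apply: (ge0_emeasurable_sum (P := xpredT)) => [k v _ _|k _].
  by rewrite lee_fin.
exact/measurable_EFinP.
Qed.

(** The record is symmetric, so results on rows and on X also serve for columns and Y. *)
Lemma posteriors_swap {R : realType} {d} {V : measurableType d}
    (Q : probability V R) p px py g gx gy :
  posteriors Q p px py g gx gy ->
  posteriors Q (fun j i => p i j) py px (fun j i => g i j) gy gx.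
Proof. by case=> *; split. Qed.

(** * Conditional entropies as functions of the posteriors *)

Section posterior_entropy.
Context {R : realType}.

(** H(X | U) with sum and expectation exchanged, so that each term involves a single posterior;
    [ent2] is H(X,Y | U), and [H1], [H2] are the unconditional entropies. *)
Definition ent1 {d} {V : measurableType d} (Q : probability V R)
  (gx : nat -> V -> R) : \bar R := \sum_(i <oo) \int[Q]_v negxlnx (gx i v).

Definition ent2 {d} {V : measurableType d} (Q : probability V R)
    (g : nat -> nat -> V -> R) : \bar R :=
  \sum_(i <oo) \sum_(j <oo) \int[Q]_v negxlnx (g i j v).

Definition H1 (px : nat -> R) : \bar R := \sum_(i <oo) negxlnx (px i).
Definition H2 (p : nat -> nat -> R) : \bar R :=
  \sum_(i <oo) \sum_(j <oo) negxlnx (p i j).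

Context {d} {V : measurableType d} (Q : probability V R).
Variables (p : nat -> nat -> R) (px py : nat -> R)
  (g : nat -> nat -> V -> R) (gx gy : nat -> V -> R).
Hypothesis post : posteriors Q p px py g gx gy.

Let g0 i j v : (0 <= g i j v)%R. Proof. by case/andP: (post01 post i j v). Qed.
Let gx0 i v : (0 <= gx i v)%R. Proof. by case/andP: (postx01 post i v). Qed.

Lemma int_negxlnx_ge0 (a : V -> R) : (forall v, (0 <= a v <= 1)%R) ->
  0 <= \int[Q]_v negxlnx (a v).
Proof. by move=> a01; apply: integral_ge0 => v _; exact: negxlnx_ge0. Qed.

Lemma ent1_le : ent1 Q gx <= H1 px.
Proof.
apply: lee_nneseries => i *; first exact: (int_negxlnx_ge0 (postx01 post i)).
by have [] := integral_negxlnx_le (post_mx post i) (postx01 post i) (postx_int post i).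
Qed.

Lemma ent2_le : ent2 Q g <= H2 p.
Proof.
apply: lee_nneseries => i *.
  by apply: nneseries_ge0 => j *; exact: (int_negxlnx_ge0 (post01 post i j)).
apply: lee_nneseries => j *; first exact: (int_negxlnx_ge0 (post01 post i j)).
by have [] := integral_negxlnx_le (post_m post i j) (post01 post i j) (post_int post i j).
Qed.

Lemma post_p01 i j : (0 <= p i j <= 1)%R.
Proof. by have [] := integral_negxlnx_le (post_m post i j) (post01 post i j) (post_int post i j). Qed.

Lemma post_px01 i : (0 <= px i <= 1)%R.
Proof. by have [] := integral_negxlnx_le (post_mx post i) (postx01 post i) (postx_int post i). Qed.

Lemma post_px i : \sum_(j <oo) (p i j)%:E = (px i)%:E.
Proof.
under eq_eseriesr do rewrite -(post_int post).
rewrite -integral_nneseries//.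
- rewrite -(postx_int post); apply: ge0_ae_eq_integral => //.
  + by apply: measurable_nneseries_EFin => // j; exact: (post_m post).
  + exact/measurable_EFinP/(post_mx post).
  + by move=> v _; apply: nneseries_ge0 => j *; rewrite lee_fin.
  + by move=> v _; rewrite lee_fin.
  + by apply: filterS (post_row post i).
- by move=> j; exact/measurable_EFinP/(post_m post).
- by move=> j v _; rewrite lee_fin.
Qed.

Lemma post_px1 : \sum_(i <oo) (px i)%:E = 1.
Proof.
under eq_eseriesr do rewrite -(postx_int post).
rewrite -integral_nneseries//.
- rewrite -[RHS](integral_cst_probability Q 1%R); apply: ge0_ae_eq_integral => //.
  + by apply: measurable_nneseries_EFin => // i; exact: (post_mx post).
  + by move=> v _; apply: nneseries_ge0 => i *; rewrite lee_fin.
  + by apply: filterS (postx1 post).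
- by move=> i; exact/measurable_EFinP/(post_mx post).
- by move=> i v _; rewrite lee_fin.
Qed.

(** Sums the column index out of a cross term; [c] will be minus the logarithm of a marginal
    posterior. *)
Lemma post_row_weight (c : V -> R) i : measurable_fun [set: V] c ->
  (forall v, (0 <= c v)%R) ->
  \sum_(j <oo) \int[Q]_v (g i j v * c v)%:E = \int[Q]_v (gx i v * c v)%:E.
Proof.
move=> mc c0.
have mgc j : measurable_fun [set: V] (fun v => (g i j v * c v)%:E).
  by apply/measurable_EFinP/measurable_funM => //; exact: (post_m post).
rewrite -integral_nneseries//; last by move=> j v _; rewrite lee_fin mulr_ge0.
apply: ge0_ae_eq_integral => //.
- apply: measurable_nneseries_EFin => j; first by move=> v; rewrite mulr_ge0.
  by apply: measurable_funM => //; exact: (post_m post).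
- by apply/measurable_EFinP/measurable_funM => //; exact: (post_mx post).
- by move=> v _; apply: nneseries_ge0 => j *; rewrite lee_fin mulr_ge0.
- by move=> v _; rewrite lee_fin mulr_ge0.
apply: filterS (post_row post i) => v rowE _.
under eq_eseriesr do rewrite mulrC EFinM.
rewrite nneseriesZl; last by move=> j _; rewrite lee_fin.
by rewrite rowE -EFinM mulrC.
Qed.

Lemma post_pos_row i : {ae Q, forall v, forall j, (0 < g i j v -> 0 < gx i v)%R}.
Proof.
apply: filterS (post_row post i) => v rowE j gj; rewrite -lte_fin -rowE.
apply: lt_le_trans (nneseries_term_le j _); first by rewrite lte_fin.
by move=> k; rewrite lee_fin.
Qed.

Section second_factor.
Variables (b : nat -> nat -> V -> R).
Hypotheses (mb : forall i j, measurable_fun [set: V] (b i j))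
  (b01 : forall i j v, (0 <= b i j v <= 1)%R)
  (gb : forall i j, {ae Q, forall v, (0 < g i j v -> 0 < b i j v)%R})
  (sum_b : \sum_(i <oo) \sum_(j <oo) \int[Q]_v (gx i v * b i j v)%:E <= 1).

(** Here [b i j] is a candidate for the conditional law of Y given X and U. Two choices matter: the
    posterior of Y, for which equality means that X and Y are independent given U, and the
    transition probability from X to Y, for which it means that Y and U are independent given X. *)
Definition cross := \sum_(i <oo) \sum_(j <oo) \int[Q]_v (g i j v * - ln (b i j v))%:E.

Let A i j := \int[Q]_v negxlnx (g i j v).
Let K i j := \int[Q]_v (g i j v * - ln (b i j v))%:E.
Let M i j := \int[Q]_v (g i j v * - ln (gx i v))%:E.
Let B i j := \int[Q]_v (gx i v * b i j v)%:E.

Let b0 i j v : (0 <= b i j v)%R. Proof. by case/andP: (b01 i j v). Qed.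
Let A0 i j : 0 <= A i j. Proof. exact: (int_negxlnx_ge0 (post01 post i j)). Qed.
Let B0 i j : 0 <= B i j.
Proof. by apply: integral_ge0 => v _; rewrite lee_fin mulr_ge0. Qed.
Let K0 i j : 0 <= K i j.
Proof.
apply: integral_ge0 => v _; rewrite lee_fin mulr_ge0// oppr_ge0 ln_le0//.
by case/andP: (b01 i j v).
Qed.
Let lngx0 i v : (0 <= - ln (gx i v))%R.
Proof. by rewrite oppr_ge0 ln_le0//; case/andP: (postx01 post i v). Qed.
Let M0 i j : 0 <= M i j.
Proof. by apply: integral_ge0 => v _; rewrite lee_fin mulr_ge0. Qed.
Let p0 i j : 0 <= (p i j)%:E.
Proof. by rewrite lee_fin; case/andP: (post_p01 i j). Qed.

Let gpos i j : {ae Q, forall v, (0 < g i j v -> 0 < gx i v /\ 0 < b i j v)%R}.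
Proof. by apply: filterS2 (post_pos_row i) (gb i j) => v h1 h2 h; split; [exact: h1 h|exact: h2]. Qed.

Let le_ij i j : A i j + (p i j)%:E <= M i j + K i j + B i j.
Proof.
rewrite -(post_int post); apply: integral_gibbs => //.
- exact: (post_m post).
- exact: (post_mx post).
- exact: (post01 post).
- exact: (postx01 post).
Qed.

Let sumM : \sum_(i <oo) \sum_(j <oo) M i j = ent1 Q gx.
Proof.
apply: eq_eseriesr => i _; rewrite /M post_row_weight//.
  by apply: eq_integral => v _; rewrite /negxlnx mulrN.
apply: measurableT_comp => //; apply: measurableT_comp (@measurable_ln R) _.
exact: (post_mx post).
Qed.

Let sum2D (f h : nat -> nat -> \bar R) : (forall i j, 0 <= f i j) ->
  (forall i j, 0 <= h i j) -> \sum_(i <oo) \sum_(j <oo) (f i j + h i j) =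
  \sum_(i <oo) \sum_(j <oo) f i j + \sum_(i <oo) \sum_(j <oo) h i j.
Proof.
move=> f0 h0; rewrite -nneseriesD//; last 2 first.
- by move=> i _ _; exact: nneseries_ge0.
- by move=> i _ _; exact: nneseries_ge0.
by apply: eq_eseriesr => i _; rewrite nneseriesD.
Qed.

Let sum_p : \sum_(i <oo) \sum_(j <oo) (p i j)%:E = 1.
Proof. by rewrite -post_px1; apply: eq_eseriesr => i _; exact: post_px. Qed.

Let sumAp : \sum_(i <oo) \sum_(j <oo) (A i j + (p i j)%:E) = ent2 Q g + 1.
Proof. by rewrite (@sum2D A (fun i j => (p i j)%:E))// sum_p. Qed.

Let sumMKB : \sum_(i <oo) \sum_(j <oo) (M i j + K i j + B i j) =
  ent1 Q gx + cross + \sum_(i <oo) \sum_(j <oo) B i j.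
Proof.
rewrite (@sum2D (fun i j => M i j + K i j) B)//; last by move=> i j; exact: adde_ge0.
rewrite (@sum2D M K M0 K0); congr (_ + _ + _); exact: sumM.
Qed.

(** Gibbs' inequality for [g i j] against [gx i * b i j], summed: the masses add up to 1 on the left
    and to at most 1 on the right, and cancel. *)
Lemma ent2_le_cross : ent2 Q g <= ent1 Q gx + cross.
Proof.
rewrite -(leeD2rE _ _ (isT : (1 : \bar R) \is a fin_num)) -sumAp.
apply: (@le_trans _ _ (ent1 Q gx + cross + \sum_(i <oo) \sum_(j <oo) B i j)).
  rewrite -sumMKB; apply: lee_nneseries => i *.
    by apply: nneseries_ge0 => j *; exact: adde_ge0.
  by apply: lee_nneseries => j *; [exact: adde_ge0|exact: le_ij].
by rewrite leeD2l.
Qed.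

(** Finiteness lets equality of the double sums descend to the rows and then to single terms, where
    the equality case of Gibbs' inequality applies. *)
Lemma ent2_eq_cross : ent2 Q g < +oo -> (ent2 Q g = ent1 Q gx + cross <->
  forall i j, {ae Q, forall v, g i j v = (gx i v * b i j v)%R}).
Proof.
move=> ltoo; split=> [eq i j|eq]; last first.
  rewrite -sumM -(@sum2D M K)//; apply: eq_eseriesr => i _; apply: eq_eseriesr => j _.
  apply: integral_gibbs_prod => //.
  - exact: (post_m post).
  - exact: (post_mx post).
  - exact: (post01 post).
  - exact: (postx01 post).
have Ap0 k l : 0 <= A k l + (p k l)%:E by exact: adde_ge0.
have soo : \sum_(i <oo) \sum_(j <oo) (A i j + (p i j)%:E) < +oo.
  by rewrite sumAp lte_add_pinfty// ltry.
have rows : forall i, \sum_(j <oo) (A i j + (p i j)%:E) =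
    \sum_(j <oo) (M i j + K i j + B i j).
  apply: nneseries_le_eq => //.
  - by move=> k; exact: nneseries_ge0.
  - by move=> k; exact: lee_nneseries.
  - by rewrite sumAp sumMKB eq leeD2l.
have rowoo k : \sum_(j <oo) (A k j + (p k j)%:E) < +oo.
  apply: le_lt_trans soo.
  apply: (nneseries_term_le (f := fun i => \sum_(j <oo) (A i j + (p i j)%:E)) k).
  by move=> l; exact: nneseries_ge0.
have eq_le_rows k : \sum_(j <oo) (M k j + K k j + B k j) <=
    \sum_(j <oo) (A k j + (p k j)%:E) by rewrite rows.
have term := nneseries_le_eq (Ap0 i) (le_ij i) (eq_le_rows i) (rowoo i) j.
apply: integral_gibbs_eq => //.
- exact: (post_m post).
- exact: (post_mx post).
- exact: (post01 post).
- exact: (postx01 post).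
- rewrite (post_int post); apply: le_lt_trans (rowoo i).
  exact: (nneseries_term_le (f := fun j => A i j + (p i j)%:E) j).
- by rewrite (post_int post).
Qed.

End second_factor.
End posterior_entropy.

(** * Conditional independence as equality of entropies *)

Section markov_entropy.
Context {R : realType} {d} {V : measurableType d} (Q : probability V R).
Variables (p : nat -> nat -> R) (px py : nat -> R)
  (g : nat -> nat -> V -> R) (gx gy : nat -> V -> R).
Hypothesis post : posteriors Q p px py g gx gy.

Let p0 i j : (0 <= p i j)%R. Proof. by case/andP: (post_p01 post i j). Qed.
Let px0 i : (0 <= px i)%R. Proof. by case/andP: (post_px01 post i). Qed.
Let gx0 i v : (0 <= gx i v)%R. Proof. by case/andP: (postx01 post i v). Qed.
Let gy0 i v : (0 <= gy i v)%R. Proof. by case/andP: (posty01 post i v). Qed.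
Let g0 i j v : (0 <= g i j v)%R. Proof. by case/andP: (post01 post i j v). Qed.

Let pos_col i j : {ae Q, forall v, (0 < g i j v -> 0 < gy j v)%R}.
Proof. by apply: filterS (post_pos_row (posteriors_swap post) j) => v; exact. Qed.

Let sum_prod : \sum_(i <oo) \sum_(j <oo) \int[Q]_v (gx i v * gy j v)%:E = 1.
Proof.
rewrite -(post_px1 post); apply: eq_eseriesr => i _.
have mgg j : measurable_fun [set: V] (fun v => (gx i v * gy j v)%R).
  by apply: measurable_funM; [exact: (post_mx post)|exact: (post_my post)].
rewrite -(postx_int post) -integral_nneseries//; last 2 first.
- by move=> j; exact/measurable_EFinP.
- by move=> j v _; rewrite lee_fin mulr_ge0.
apply: ge0_ae_eq_integral => //.
- by apply: measurable_nneseries_EFin => // j v; exact: mulr_ge0.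
- exact/measurable_EFinP/(post_mx post).
- by move=> v _; apply: nneseries_ge0 => j *; rewrite lee_fin mulr_ge0.
- by move=> v _; rewrite lee_fin.
apply: filterS (posty1 post) => v y1 _.
under eq_eseriesr do rewrite EFinM.
by rewrite nneseriesZl ?y1 ?mule1// => j _; rewrite lee_fin.
Qed.

Let cross_col : cross Q g (fun i j => gy j) = ent1 Q gy.
Proof.
rewrite /cross nneseries_interchange; last first.
  move=> i j; apply: integral_ge0 => v _; rewrite lee_fin mulr_ge0// oppr_ge0 ln_le0//.
  by case/andP: (posty01 post j v).
apply: eq_eseriesr => j _.
rewrite (post_row_weight (posteriors_swap post)).
- by apply: eq_integral => v _; rewrite /negxlnx mulrN.
- apply: measurableT_comp => //; apply: measurableT_comp (@measurable_ln R) _.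
  exact: (post_my post).
- by move=> v; rewrite oppr_ge0 ln_le0//; case/andP: (posty01 post j v).
Qed.

(** I(X;Y | U) >= 0: the choice [b i j = gy j], for which the cross term sums to H(Y | U). *)
Lemma ent2_subadditive : ent2 Q g <= ent1 Q gx + ent1 Q gy.
Proof.
rewrite -cross_col; apply: (ent2_le_cross post) => //.
- by move=> i j; exact: (post_my post).
- by move=> i j; exact: (posty01 post).
- by rewrite sum_prod.
Qed.

Lemma ent2_eq_additive : ent2 Q g < +oo ->
  (ent2 Q g = ent1 Q gx + ent1 Q gy <->
   forall i j, {ae Q, forall v, g i j v = (gx i v * gy j v)%R}).
Proof.
move=> oo; rewrite -cross_col; apply: (ent2_eq_cross post) => //.
- by move=> i j; exact: (post_my post).
- by move=> i j; exact: (posty01 post).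
- by rewrite sum_prod.
Qed.

(** The transition probability P(Y = j | X = i), constant in [v]. Division by zero makes it 0 when
    [px i = 0], in which case [g i j] vanishes almost everywhere too. *)
Let b i j (v : V) := (p i j / px i)%R.

Let ppx i j : (p i j <= px i)%R.
Proof.
rewrite -lee_fin -(post_px post); apply: (nneseries_term_le (f := fun j => (p i j)%:E)).
by move=> k; rewrite lee_fin.
Qed.

Let b01 i j v : (0 <= b i j v <= 1)%R.
Proof.
rewrite /b divr_ge0//=; have := px0 i; rewrite le_eqVlt => /predU1P[<-|h].
  by rewrite invr0 mulr0.
by rewrite ler_pdivrMr// mul1r.
Qed.

Let gb i j : {ae Q, forall v, (0 < g i j v -> 0 < b i j v)%R}.
Proof.
have [p_gt0|] := ltP 0%R (p i j).
  by apply: aeW => v _; rewrite divr_gt0// (lt_le_trans p_gt0).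
move=> ple; have pE : p i j = 0%R by apply/eqP; rewrite eq_le ple p0.
have : ae_eq Q setT (cst 0) (EFin \o g i j).
  apply: ge0_le_integral_eq_ae => //.
  - exact/measurable_EFinP/(post_m post).
  - by move=> v _; rewrite lee_fin.
  - by apply: aeW => v _; rewrite lee_fin.
  - by rewrite integral0 (post_int post) pE.
  - by rewrite integral0 ltry.
by apply: filterS => v /(_ I)[<-]; rewrite ltxx.
Qed.

Let sum_b : \sum_(i <oo) \sum_(j <oo) \int[Q]_v (gx i v * b i j v)%:E <= 1.
Proof.
rewrite -(post_px1 post); apply: lee_nneseries => i *.
  apply: nneseries_ge0 => j *; apply: integral_ge0 => v _.
  by rewrite lee_fin mulr_ge0//; case/andP: (b01 i j v).
rewrite -(post_px post); apply: lee_nneseries => j *.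
  apply: integral_ge0 => v _.
  by rewrite lee_fin mulr_ge0//; case/andP: (b01 i j v).
under eq_integral do rewrite /b mulrC EFinM.
rewrite ge0_integralZl//; last 3 first.
- exact/measurable_EFinP/(post_mx post).
- by move=> v _; rewrite lee_fin.
- by rewrite lee_fin divr_ge0.
rewrite (postx_int post) -EFinM lee_fin.
have := px0 i; rewrite le_eqVlt => /predU1P[h|h].
  by rewrite -h mulr0.
by rewrite divfK ?gt_eqF.
Qed.

(** As [b] does not depend on [v], the cross term averages over U to H(Y | X). *)
Lemma H2_chain : H2 p = H1 px + cross Q g b.
Proof.
have lnpx i : (0 <= - ln (px i))%R.
  by rewrite oppr_ge0 ln_le0//; case/andP: (post_px01 post i).
have lnb i j v : (0 <= - ln (b i j v))%R.
  by rewrite oppr_ge0 ln_le0//; case/andP: (b01 i j v).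
have KE i j : \int[Q]_v (g i j v * - ln (b i j v))%:E =
    (p i j * - ln (p i j / px i))%:E.
  under eq_integral do rewrite /b mulrC EFinM.
  rewrite ge0_integralZl// ?(post_int post).
  - by rewrite -EFinM mulrC.
  - exact/measurable_EFinP/(post_m post).
  - by move=> v _; rewrite lee_fin.
  - exact: (lnb i j point).
have pxE i : negxlnx (px i) = \sum_(j <oo) (p i j * - ln (px i))%:E.
  under eq_eseriesr do rewrite mulrC EFinM.
  rewrite nneseriesZl; last by move=> j _; rewrite lee_fin.
  by rewrite (post_px post) -EFinM mulNr mulrC.
rewrite /H1 (eq_eseriesr (fun i _ => pxE i)) /cross -nneseriesD; last 2 first.
- by move=> i *; apply: nneseries_ge0 => j *; rewrite lee_fin mulr_ge0.
- move=> i *; apply: nneseries_ge0 => j *; apply: integral_ge0 => v _.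
  by rewrite lee_fin mulr_ge0.
apply: eq_eseriesr => i _; rewrite -nneseriesD; last 2 first.
- by move=> j *; rewrite lee_fin mulr_ge0.
- by move=> j *; apply: integral_ge0 => v _; rewrite lee_fin mulr_ge0.
apply: eq_eseriesr => j _; rewrite KE -EFinD /negxlnx; congr EFin.
have := p0 i j; rewrite le_eqVlt => /predU1P[<-|h]; first by rewrite !mul0r addr0 oppr0.
have h' := lt_le_trans h (ppx i j).
by rewrite ln_div ?posrE//; ring.
Qed.

Let cross_ge0 : 0 <= cross Q g b.
Proof.
apply: nneseries_ge0 => i *; apply: nneseries_ge0 => j *; apply: integral_ge0 => v _.
by rewrite lee_fin mulr_ge0// oppr_ge0 ln_le0//; case/andP: (b01 i j v).
Qed.

Lemma H1_le_H2 : H1 px <= H2 p.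
Proof. by rewrite H2_chain leeDl. Qed.

Hypothesis H2oo : H2 p < +oo.

Let H1fin : H1 px \is a fin_num.
Proof.
rewrite ge0_fin_numE; first exact: le_lt_trans H1_le_H2 H2oo.
by apply: nneseries_ge0 => i *; exact/negxlnx_ge0/(post_px01 post).
Qed.

Let ent2oo : ent2 Q g < +oo.
Proof. exact: le_lt_trans (ent2_le post) H2oo. Qed.

(** I(Y;U | X) >= 0: inserting the chain rule for [H2 p] leaves [ent2_le_cross] for the transition
    probability. *)
Lemma ent_cond_le : H1 px + ent2 Q g <= H2 p + ent1 Q gx.
Proof.
rewrite H2_chain -addeA leeD2lE// addeC; apply: (ent2_le_cross post) => //.
by move=> i j; exact: measurable_cst.
Qed.

Lemma ent_cond_eq : H1 px + ent2 Q g = H2 p + ent1 Q gx <->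
  forall i j, {ae Q, forall v, g i j v = (gx i v * (p i j / px i))%R}.
Proof.
have h := @ent2_eq_cross _ _ _ _ _ _ _ _ _ _ post b
  (fun i j => @measurable_cst _ _ _ _ _ _) b01 gb sum_b ent2oo.
rewrite -h H2_chain -addeA [X in _ = _ + X]addeC; split => [/eqP|->//].
by rewrite eq_le !leeD2lE// -eq_le => /eqP.
Qed.

End markov_entropy.

(** * Sums over values turned into sums over indices *)

(** The range of a variable changes from one copy to another, an index set does not. Points of [A]
    in no [D k], and indices whose [D k] misses [A], carry the value 0, so both sums reduce to the
    matching part. *)
Lemma esum_atoms {R : realType} {T : choiceType} {K : pointedType} (A : set T)
    (a : T -> \bar R) (D : K -> set T) (a' : K -> \bar R) :
  (forall k x y, D k x -> D k y -> x = y) ->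
  (forall k l x, D k x -> D l x -> k = l) ->
  (forall k z, A z -> D k z -> a' k = a z) ->
  (forall k, (forall z, A z -> ~ D k z) -> a' k = 0) ->
  (forall z, A z -> (exists k, D k z) \/ a z = 0) ->
  \esum_(z in A) a z = \esum_(k in [set: K]) a' k.
Proof.
move=> Dsub Ddisj aD a0 Aa.
pose B := [set z | A z /\ exists k, D k z].
pose C := [set k | exists z, A z /\ D k z].
transitivity (\esum_(z in B) a z).
  rewrite [LHS]esum_mkcond [RHS]esum_mkcond; apply: eq_esum => z _.
  have [zA|zA] := boolP (z \in A); have [zB|zB] := boolP (z \in B) => //.
    have [Dz|//] := Aa _ (set_mem zA); exfalso; move/negP : zB; apply.
    by apply/mem_set; split => //; exact: set_mem zA.
  by have [Az _] := set_mem zB; move/negP : zA; case; exact: mem_set.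
transitivity (\esum_(k in C) a' k); last first.
  rewrite [LHS]esum_mkcond; apply: eq_esum => k _; case: ifPn => // kC.
  by rewrite a0// => z Az Dz; move/negP : kC; apply; apply/mem_set; exists z.
pose e z := get [set k | D k z].
have eP z : (exists k, D k z) -> D (e z) z by move=> [k Dkz]; apply: (@getI _ [set k | D k z] k).
rewrite (reindex_esum B C e)//.
  by apply: eq_esum => z [Az /eP Dz]; rewrite (aD _ z).
split.
- by move=> z [Az /eP Dz]; exists z.
- move=> x y /set_mem[Ax /eP Dx] /set_mem[Ay /eP Dy] exy.
  by apply: Dsub Dx _; rewrite exy.
- move=> k [z [Az Dz]]; exists z; first by split => //; exists k.
  by apply: (Ddisj _ _ z) => //; apply: eP; exists k.
Qed.

Lemma esum_pair {R : realType} (a : nat -> nat -> \bar R) :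
  (forall i j, 0 <= a i j) ->
  \esum_(k in [set: nat * nat]) a k.1 k.2 = \sum_(i <oo) \sum_(j <oo) a i j.
Proof.
move=> a0; rewrite nneseries_esumT; last by move=> i; exact: nneseries_ge0.
rewrite (eq_esum (b := fun i => \esum_(j in [set: nat]) a i j)); last first.
  by move=> i _; rewrite nneseries_esumT.
rewrite esum_esum//; congr esum.
by apply/seteqP; split => -[].
Qed.

(** * Conditional probabilities along a partition *)

Section conditional_probability_sums.
Context {R : realType} {d} {W : measurableType d} (P : probability W R).
Context {dV} {V : measurableType dV} (U : {RV P >-> V}).

Let Q := distribution P U.

Let mU A : measurable A -> measurable (U @^-1` A).
Proof. by move=> mA; rewrite -[_ @^-1` _]setTI; exact: measurable_funPT. Qed.

Lemma probability_full_setI (B C : set W) : measurable B -> measurable C ->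
  P C = 1 -> P (B `&` C) = P B.
Proof.
move=> mB mC PC; have PC0 : P (~` C) = 0 by rewrite probability_setC// PC subee.
rewrite [RHS](measureDI P mB mC) [X in X + _](_ : _ = 0) ?add0e//.
apply/eqP; rewrite eq_le measure_ge0 andbT -PC0; apply: le_measure; rewrite ?inE.
- exact: measurableD.
- exact: measurableC.
- by move=> w [].
Qed.

(** Both sides integrate to P(E, U in A) over every measurable [A], the part of [E] outside the
    [C i] being null. *)
Lemma cond_prob_sum (C : nat -> set W) (E : set W) :
  (forall i, measurable (C i)) -> trivIset [set: nat] C ->
  P (\bigcup_i C i) = 1 -> measurable E ->
  {ae Q, forall v, \sum_(i <oo) (cond_prob P (E `&` C i) U v)%:E =
    (cond_prob P E U v)%:E}.
Proof.
move=> mC tC PC mE.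
have mEC i : measurable (E `&` C i) by exact: measurableI.
have c01 E' (mE' : measurable E') := cond_probP U mE'.
have mcE E' : measurable E' -> measurable_fun [set: V] (EFin \o cond_prob P E' U).
  by move=> /c01[mc _ _]; exact/measurable_EFinP.
have c0 E' v : measurable E' -> (0 <= cond_prob P E' U v)%R.
  by move=> /c01[_ /(_ v)/andP[]].
have : ae_eq Q setT (EFin \o cond_prob P E U)
    (fun v => \sum_(i <oo) (cond_prob P (E `&` C i) U v)%:E).
  apply: integral_ae_eq => //.
  - apply/integrableP; split; first exact: mcE.
    rewrite (eq_integral (EFin \o cond_prob P E U)); last first.
      by move=> v _; rewrite /= ger0_norm// c0.
    have [_ _ <-//] := c01 _ mE.
    by rewrite ltey_eq fin_num_measure// preimage_setT setIT.
  - apply: measurable_nneseries_EFin => i; first by move=> v; exact: c0.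
    by have [] := c01 _ (mEC i).
  - move=> A _ mA; have [_ _ <-//] := c01 _ mE.
    rewrite integral_nneseries//; last 2 first.
    + by move=> i; apply: measurable_funTS; exact: mcE.
    + by move=> i v _; rewrite lee_fin c0.
    rewrite -(probability_full_setI (C := \bigcup_i C i))//; last 2 first.
    + by apply: measurableI => //; exact: mU.
    + exact: bigcup_measurable.
    rewrite setI_bigcupr measure_bigcup//; last 2 first.
    + by move=> i _; apply: measurableI => //; apply: measurableI => //; exact: mU.
    + exact: trivIset_setIl.
    rewrite (eq_eseriesl (Q := xpredT)); last by move=> i; rewrite in_setT.
    apply: eq_eseriesr => i _; have [_ _ <-//] := c01 _ (mEC i).
    by rewrite setIAC.
by apply: filterS => v /(_ I).
Qed.

Lemma cond_prob_null (E : set W) : measurable E -> P E = 0 ->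
  {ae Q, forall v, cond_prob P E U v = 0%R}.
Proof.
move=> mE PE; apply: (cond_prob_unique (g := cst 0%R)) => // A mA.
rewrite integral0; apply/eqP; rewrite eq_le measure_ge0 andbT -PE.
by apply: le_measure; rewrite ?inE//; apply: measurableI => //; exact: mU.
Qed.

Lemma cond_prob_preimage (B : set V) : measurable B ->
  {ae Q, forall v, cond_prob P (U @^-1` B) U v = \1_B v}.
Proof.
move=> mB; apply: cond_prob_unique => //.
  exact: mU.
by move=> A mA; rewrite integral_indic// -preimage_setI.
Qed.

Lemma cond_prob_setT : {ae Q, forall v, cond_prob P [set: W] U v = 1%R}.
Proof.
have := cond_prob_preimage measurableT; rewrite preimage_setT.
by apply: filterS => v ->; rewrite indicT.
Qed.

End conditional_probability_sums.

Lemma countable_enum {T : Type} (A : set T) : countable A ->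
  exists f : T -> nat, forall x y, A x -> A y -> f x = f y -> x = y.
Proof.
by move=> /countable_injP[f fi]; exists f => x y /mem_set Ax /mem_set Ay; exact: fi.
Qed.

Lemma ae_countable {R : realType} {d} {V : measurableType d}
    (Q : {measure set V -> \bar R}) {T : Type} (A : set T) (F : T -> V -> Prop) :
  countable A -> (forall z, A z -> {ae Q, forall v, F z v}) ->
  {ae Q, forall v, forall z, A z -> F z v}.
Proof.
move=> /countable_enum[f finj] AF.
have : {ae Q, forall v, forall n, forall z, A z -> f z = n -> F z v}.
  apply: ae_foralln => n.
  have [[z [Az fz]]|nz] := pselect (exists z, A z /\ f z = n).
    apply: filterS (AF z Az) => v Fz y Ay fy; suff -> : y = z by [].
    by apply: finj => //; rewrite fz.
  by apply: aeW => v z Az fz; exfalso; apply: nz; exists z.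
by apply: filterS => v h z Az; exact: h Az erefl.
Qed.

(** The sum is carried over to [nat] along an injection of [A]; indices without a preimage get 0. *)
Lemma measurable_esum_countable {R : realType} {d} {V : measurableType d}
    {T : choiceType} (A : set T) (f : T -> V -> \bar R) :
  countable A -> (forall z, A z -> measurable_fun [set: V] (f z)) ->
  (forall z v, A z -> 0 <= f z v) ->
  measurable_fun [set: V] (fun v => \esum_(z in A) f z v).
Proof.
move=> /countable_enum[e einj] mf f0.
pose D k := [set z | A z /\ e z = k].
pose a' k v := if pselect (exists z, D k z) is left h then f (sval (cid h)) v else 0.
have a'0 k v : 0 <= a' k v.
  by rewrite /a'; case: pselect => // h; case: cid => z /= [Az _]; exact: f0.
rewrite (_ : (fun v => _) = (fun v => \sum_(k <oo) a' k v)); last first.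
  apply/funext => v; rewrite nneseries_esumT//; apply: (esum_atoms (D := D)).
  - by move=> k x y [Ax <-] [Ay] /esym; exact: einj.
  - by move=> k l x [_ <-] [].
  - move=> k z Az Dz; rewrite /a'; case: pselect => [h|[]]; last by exists z.
    case: Dz => _ ez; congr (f _ v); case: cid => y /= [Ay ey].
    by apply: einj => //; rewrite ey.
  - move=> k nD; rewrite /a'; case: pselect => // h; exfalso.
    by case: h => z [Az ez]; case: (nD z Az (conj Az ez)).
  - by move=> z Az; left; exists (e z).
apply: (ge0_emeasurable_sum (P := xpredT)) => // k _.
rewrite /a'; case: pselect => [h|_]; last exact: measurable_cst.
by apply: mf; case: cid => z /= [].
Qed.

(* [D] enumerates the values of [X] up to a null set; [D i] may be empty. *)
Record atoms {R : realType} {d d'} {W : measurableType d} {T : measurableType d'}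
    (P : probability W R) (X : W -> T) (D : nat -> set T) : Prop := Atoms {
  atom_m : forall i, measurable (D i);
  atom_sub : forall i x y, D i x -> D i y -> x = y;
  atom_disj : forall i j x, D i x -> D j x -> i = j;
  atom_cover : P (X @^-1` (\bigcup_i D i)) = 1 }.

(** * Enumerating the values of a discrete variable *)

Section atoms.
Context {R : realType} {d d'} {W : measurableType d} {T : measurableType d'}.

Lemma exists_atoms (P : probability W R) (X : {dRV P >-> T}) :
  (forall x : T, measurable [set x]) -> exists D, atoms P X D.
Proof.
move=> mT; have /countable_enum[f finj] := @countable_range _ _ _ _ X.
exists (fun i => [set x | range X x /\ f x = i]); split.
- move=> i; have [[x [Xx fx]]|nx] := pselect (exists x, range X x /\ f x = i).
    rewrite (_ : [set _ | _] = [set x])//; apply/seteqP; split => y /=.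
      by move=> [Xy fy]; apply: finj => //; rewrite fx.
    by move=> ->.
  rewrite (_ : [set _ | _] = set0)//; apply/seteqP; split => y //= -[Xy fy].
  by apply: nx; exists y.
- by move=> i x y [Xx <-] [Xy] /esym; exact: finj.
- by move=> i j x [_ <-] [].
- rewrite (_ : X @^-1` _ = setT) ?probability_setT//.
  by apply/seteqP; split => w // _; exists (f (X w)) => //=; split => //; exists w.
Qed.

(** One enumeration serves all copies of a variable, although their ranges may differ on a null
    set. *)
Lemma atoms_transfer {dW'} {W' : measurableType dW'} (P : probability W R)
    (P' : probability W' R) (X : W -> T) (X' : W' -> T) D :
  (forall A, measurable A -> P' (X' @^-1` A) = P (X @^-1` A)) ->
  atoms P X D -> atoms P' X' D.
Proof.
move=> PP' [mD sD dD cD]; split => //; rewrite PP'//.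
exact: bigcup_measurable.
Qed.

End atoms.

(** * Entropies computed over atoms *)

Section entropy_atoms.
Context {R : realType} {d} {W : measurableType d} (P : probability W R).
Context {dV} {V : measurableType dV} (U : {RV P >-> V}).
Context {T : choiceType} {K : pointedType} (Z : W -> T) (D : K -> set T).
Hypotheses (cZ : countable (range Z))
  (mZ : forall z, range Z z -> measurable (Z @^-1` [set z]))
  (mD : forall k, measurable (Z @^-1` D k))
  (Dsub : forall k x y, D k x -> D k y -> x = y)
  (Ddisj : forall k l x, D k x -> D l x -> k = l)
  (mcover : measurable (Z @^-1` \bigcup_k D k))
  (cover : P (Z @^-1` \bigcup_k D k) = 1).

Let null z : range Z z -> ~ (exists k, D k z) -> P (Z @^-1` [set z]) = 0.
Proof.
move=> Zz nD; rewrite -(probability_full_setI _ mcover cover); last exact: mZ.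
rewrite (_ : _ `&` _ = set0) ?measure0//.
by apply/seteqP; split => w //= [Zw [k _ Dk]]; apply: nD; exists k; rewrite -Zw.
Qed.

Let preim k z : D k z -> Z @^-1` D k = Z @^-1` [set z].
Proof.
move=> Dz; apply/seteqP; split => w /=; last by move=> ->.
by move=> Dw; exact: Dsub Dw Dz.
Qed.

Let preim0 k : (forall z, range Z z -> ~ D k z) -> Z @^-1` D k = set0.
Proof. by move=> h; apply/seteqP; split => w //= /h; apply; exists w. Qed.

Lemma entropy_atoms :
  entropy P Z = \esum_(k in [set: K]) negxlnx (fine (P (Z @^-1` D k))).
Proof.
apply: (esum_atoms (D := D)) => //.
- by move=> k z _ Dz /=; rewrite (preim Dz).
- move=> k nD /=; rewrite (preim0 nD) measure0; exact: negxlnx0.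
- move=> z Zz; have [h|nh] := pselect (exists k, D k z); first by left.
  by right; rewrite null//; exact: negxlnx0.
Qed.

Hypothesis mesum : measurable_fun [set: V]
  (fun v => \esum_(k in [set: K]) negxlnx (cond_prob P (Z @^-1` D k) U v)).

(** [cond_prob] depends on the event as a set, so an atom and its value select the same version. A
    value outside all atoms has probability zero, and the countably many exceptional null sets are
    merged into one. *)
Lemma cond_entropy_atoms : cond_entropy P Z U = \int[distribution P U]_v
  \esum_(k in [set: K]) negxlnx (cond_prob P (Z @^-1` D k) U v).
Proof.
have c01 E v (mE : measurable E) : (0 <= cond_prob P E U v <= 1)%R.
  by have [_ /(_ v)] := cond_probP U mE.
have mc E : measurable E -> measurable_fun [set: V] (cond_prob P E U).
  by move=> mE; have [] := cond_probP U mE.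
apply: ge0_ae_eq_integral => //.
- apply: measurable_esum_countable => //.
    by move=> z /mZ /mc; exact: measurable_negxlnx.
  by move=> z v /mZ mz; exact/negxlnx_ge0/c01.
- by move=> v _; apply: esum_ge0 => z /mZ mz; exact/negxlnx_ge0/c01.
- by move=> v _; apply: esum_ge0 => k _; exact/negxlnx_ge0/c01.
have c0 := cond_prob_null U measurable0 (measure0 P).
have : {ae distribution P U, forall v, forall z, range Z z ->
    ~ (exists k, D k z) -> cond_prob P (Z @^-1` [set z]) U v = 0%R}.
  apply: ae_countable => // z Zz.
  have [h|nh] := pselect (exists k, D k z); first by apply: aeW => v /(_ h).
  by apply: filterS (cond_prob_null U (mZ Zz) (null Zz nh)).
apply: filterS2 c0 => v c0 cz _; apply: (esum_atoms (D := D)) => //.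
- by move=> k z _ Dz /=; rewrite (preim Dz).
- move=> k nD /=; rewrite (preim0 nD) c0; exact: negxlnx0.
- move=> z Zz; have [h|nh] := pselect (exists k, D k z); first by left.
  by right; rewrite cz//; exact: negxlnx0.
Qed.

End entropy_atoms.

Lemma fine_prob01 {R : realType} {d} {W : measurableType d} (P : probability W R)
  (E : set W) : measurable E -> (0 <= fine (P E) <= 1)%R.
Proof.
move=> mE; rewrite fine_ge0//= -lee_fin fineK ?fin_num_measure//.
exact: probability_le1.
Qed.

(** * Masses and posteriors of a pair of discrete variables *)

Section joint_atoms.
Context {R : realType} {d d1 d2} {W : measurableType d}
  {T1 : measurableType d1} {T2 : measurableType d2} (P : probability W R).
Variables (X : {dRV P >-> T1}) (Y : {dRV P >-> T2}).
Hypotheses (mT1 : forall x : T1, measurable [set x])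
  (mT2 : forall y : T2, measurable [set y]).
Variables (D1 : nat -> set T1) (D2 : nat -> set T2).
Hypotheses (atX : atoms P X D1) (atY : atoms P Y D2).

Definition atom_x i := X @^-1` D1 i.
Definition atom_y j := Y @^-1` D2 j.
Definition pmfx i : R := fine (P (atom_x i)).
Definition pmfy j : R := fine (P (atom_y j)).
Definition pmf2 i j : R := fine (P (atom_x i `&` atom_y j)).

Let mX A : measurable A -> measurable (X @^-1` A).
Proof. by move=> mA; rewrite -[_ @^-1` _]setTI; exact: measurable_funPT. Qed.
Let mY A : measurable A -> measurable (Y @^-1` A).
Proof. by move=> mA; rewrite -[_ @^-1` _]setTI; exact: measurable_funPT. Qed.

Lemma measurable_atom_x i : measurable (atom_x i).
Proof. exact/mX/(atom_m atX). Qed.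
Lemma measurable_atom_y j : measurable (atom_y j).
Proof. exact/mY/(atom_m atY). Qed.
Lemma measurable_atom_xy i j : measurable (atom_x i `&` atom_y j).
Proof. by apply: measurableI; [exact: measurable_atom_x|exact: measurable_atom_y]. Qed.

Hint Resolve measurable_atom_x measurable_atom_y measurable_atom_xy : core.

Lemma triv_atom_x : trivIset [set: nat] atom_x.
Proof. by move=> i j _ _ [w [/= h1 h2]]; exact: (atom_disj atX h1 h2). Qed.
Lemma triv_atom_y : trivIset [set: nat] atom_y.
Proof. by move=> i j _ _ [w [/= h1 h2]]; exact: (atom_disj atY h1 h2). Qed.

Lemma cover_atom_x : P (\bigcup_i atom_x i) = 1.
Proof. by rewrite /atom_x -preimage_bigcup; exact: (atom_cover atX). Qed.
Lemma cover_atom_y : P (\bigcup_i atom_y i) = 1.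
Proof. by rewrite /atom_y -preimage_bigcup; exact: (atom_cover atY). Qed.

Section given.
Context {dV} {V : measurableType dV} (U : {RV P >-> V}).

Definition gpx i := cond_prob P (atom_x i) U.
Definition gpy j := cond_prob P (atom_y j) U.
Definition gp2 i j := cond_prob P (atom_x i `&` atom_y j) U.

Let c01 E : measurable E -> forall v, (0 <= cond_prob P E U v <= 1)%R.
Proof. by move=> mE v; have [_ /(_ v)] := cond_probP U mE. Qed.
Let mc E : measurable E -> measurable_fun [set: V] (cond_prob P E U).
Proof. by move=> mE; have [] := cond_probP U mE. Qed.
Let cint E : measurable E ->
  \int[distribution P U]_v (cond_prob P E U v)%:E = (fine (P E))%:E.
Proof.
move=> mE; have [_ _ <-//] := cond_probP U mE.
by rewrite preimage_setT setIT fineK// fin_num_measure.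
Qed.

Lemma posteriors_RV : posteriors (distribution P U : probability V R)
  pmf2 pmfx pmfy gp2 gpx gpy.
Proof.
split.
- by move=> i j; exact: mc.
- by move=> i; exact: mc.
- by move=> j; exact: mc.
- by move=> i j; exact: c01.
- by move=> i; exact: c01.
- by move=> j; exact: c01.
- move=> i; apply: (@cond_prob_sum _ _ _ P _ _ U _ (atom_x i)) => //.
    exact: triv_atom_y.
  exact: cover_atom_y.
- move=> j; rewrite /gp2; under eq_near do under eq_eseriesr do rewrite setIC.
  apply: (@cond_prob_sum _ _ _ P _ _ U _ (atom_y j)) => //.
    exact: triv_atom_x.
  exact: cover_atom_x.
- have := @cond_prob_sum _ _ _ P _ _ U _ setT measurable_atom_x triv_atom_x
    cover_atom_x measurableT.
  apply: filterS2 (cond_prob_setT U) => v -> <-.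
  by apply: eq_eseriesr => i _; rewrite setTI.
- have := @cond_prob_sum _ _ _ P _ _ U _ setT measurable_atom_y triv_atom_y
    cover_atom_y measurableT.
  apply: filterS2 (cond_prob_setT U) => v -> <-.
  by apply: eq_eseriesr => i _; rewrite setTI.
- by move=> i j; exact: cint.
- by move=> i; exact: cint.
- by move=> j; exact: cint.
Qed.

Lemma cond_entropy_ent1x : cond_entropy P X U = ent1 (distribution P U) gpx.
Proof.
rewrite (cond_entropy_atoms (D := D1)).
- rewrite /ent1 -integral_nneseries//.
  + apply: eq_integral => v _; rewrite nneseries_esumT// => i.
    exact/negxlnx_ge0/c01.
  + by move=> i; apply: measurable_negxlnx; exact: mc.
  + by move=> i v _; exact/negxlnx_ge0/c01.
- exact: countable_range.
- by move=> z _; exact: mX.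
- by move=> k; exact: measurable_atom_x.
- exact: (atom_sub atX).
- exact: (atom_disj atX).
- apply: mX; apply: bigcup_measurable => i _; exact: (atom_m atX).
- exact: (atom_cover atX).
- apply: measurable_esum_countable; first exact: (@countableP nat).
    by move=> i _; apply: measurable_negxlnx; exact: (mc (measurable_atom_x i)).
  by move=> i v _; exact/negxlnx_ge0/(c01 (measurable_atom_x i)).
Qed.

Lemma cond_entropy_ent1y : cond_entropy P Y U = ent1 (distribution P U) gpy.
Proof.
rewrite (cond_entropy_atoms (D := D2)).
- rewrite /ent1 -integral_nneseries//.
  + apply: eq_integral => v _; rewrite nneseries_esumT// => i.
    exact/negxlnx_ge0/c01.
  + by move=> i; apply: measurable_negxlnx; exact: mc.
  + by move=> i v _; exact/negxlnx_ge0/c01.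
- exact: countable_range.
- by move=> z _; exact: mY.
- by move=> k; exact: measurable_atom_y.
- exact: (atom_sub atY).
- exact: (atom_disj atY).
- apply: mY; apply: bigcup_measurable => i _; exact: (atom_m atY).
- exact: (atom_cover atY).
- apply: measurable_esum_countable; first exact: (@countableP nat).
    by move=> i _; apply: measurable_negxlnx; exact: (mc (measurable_atom_y i)).
  by move=> i v _; exact/negxlnx_ge0/(c01 (measurable_atom_y i)).
Qed.

End given.

Let D12 (k : nat * nat) : set (T1 * T2) := D1 k.1 `*` D2 k.2.

Let mXY z : measurable (pair_rv X Y @^-1` [set z]).
Proof.
rewrite (_ : _ @^-1` _ = X @^-1` [set z.1] `&` Y @^-1` [set z.2]).
  by apply: measurableI; [exact: mX|exact: mY].
by apply/seteqP; split => w /=; case: z => a b; rewrite /pair_rv => -[-> ->].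
Qed.

Let preimD12 k : pair_rv X Y @^-1` D12 k = atom_x k.1 `&` atom_y k.2.
Proof. by []. Qed.

Let D12sub k x y : D12 k x -> D12 k y -> x = y.
Proof.
case: x y => [x1 x2] [y1 y2] [/= h1 h2] [/= h3 h4].
by rewrite (atom_sub atX h1 h3) (atom_sub atY h2 h4).
Qed.

Let D12disj k l x : D12 k x -> D12 l x -> k = l.
Proof.
case: k l x => [i j] [i' j'] [x1 x2] [/= h1 h2] [/= h3 h4].
by rewrite (atom_disj atX h1 h3) (atom_disj atY h2 h4).
Qed.

Let D12E : pair_rv X Y @^-1` (\bigcup_k D12 k) =
  (\bigcup_i atom_x i) `&` (\bigcup_j atom_y j).
Proof.
apply/seteqP; split => w /=.
  by move=> [[i j] _ [/= h1 h2]]; split; [exists i|exists j].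
by move=> [[i _ h1] [j _ h2]]; exists (i, j).
Qed.

Let mD12 : measurable (pair_rv X Y @^-1` (\bigcup_k D12 k)).
Proof. by rewrite D12E; apply: measurableI; apply: bigcup_measurable. Qed.

Let D12cover : P (pair_rv X Y @^-1` (\bigcup_k D12 k)) = 1.
Proof.
rewrite D12E probability_full_setI ?cover_atom_x ?cover_atom_y//; exact: bigcup_measurable.
Qed.

Let cXY : countable (range (pair_rv X Y)).
Proof.
apply: (@sub_countable _ _ _ (range X `*` range Y)).
  by apply: subset_card_le => z [w _ <-]; split; exists w.
by apply: countableX; exact: countable_range.
Qed.

Lemma cond_entropy_ent2 {dV} {V : measurableType dV} (U : {RV P >-> V}) :
  cond_entropy P (pair_rv X Y) U = ent2 (distribution P U) (gp2 U).
Proof.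
have c01 i j v : (0 <= gp2 U i j v <= 1)%R.
  by have [_ /(_ v)] := cond_probP U (measurable_atom_xy i j).
have mc i j : measurable_fun [set: V] (fun v => negxlnx (gp2 U i j v)).
  by apply: measurable_negxlnx; have [] := cond_probP U (measurable_atom_xy i j).
have n0 i j v : 0 <= negxlnx (gp2 U i j v) by exact/negxlnx_ge0/c01.
rewrite (cond_entropy_atoms (D := D12))//.
- transitivity (\int[distribution P U]_v \sum_(i <oo) \sum_(j <oo) negxlnx (gp2 U i j v)).
    apply: eq_integral => v _.
    exact: (esum_pair (a := fun i j => negxlnx (gp2 U i j v))).
  rewrite integral_nneseries//.
  + apply: eq_eseriesr => i _; rewrite integral_nneseries//.
  + by move=> i; apply: (ge0_emeasurable_sum (P := xpredT)).
  + by move=> i v _; exact: nneseries_ge0.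
- by move=> k; rewrite preimD12.
- apply: measurable_esum_countable; first exact: (@countableP (nat * nat)%type).
  + by move=> k _; exact: mc.
  + by move=> k v _; exact: n0.
Qed.

Lemma entropy_H2 : entropy P (pair_rv X Y) = H2 pmf2.
Proof.
rewrite (entropy_atoms (D := D12))//.
apply: (esum_pair (a := fun i j => negxlnx (pmf2 i j))) => i j.
apply/negxlnx_ge0/fine_prob01; exact: measurable_atom_xy.
Qed.

Lemma entropy_H1x : entropy P X = H1 pmfx.
Proof.
rewrite (entropy_atoms (D := D1)).
- rewrite /H1 nneseries_esumT// => i.
  apply/negxlnx_ge0/fine_prob01; exact: measurable_atom_x.
- by move=> z _; exact: mX.
- exact: (atom_sub atX).
- exact: (atom_disj atX).
- apply: mX; apply: bigcup_measurable => i _; exact: (atom_m atX).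
- exact: (atom_cover atX).
Qed.

Lemma entropy_H1y : entropy P Y = H1 pmfy.
Proof.
rewrite (entropy_atoms (D := D2)).
- rewrite /H1 nneseries_esumT// => i.
  apply/negxlnx_ge0/fine_prob01; exact: measurable_atom_y.
- by move=> z _; exact: mY.
- exact: (atom_sub atY).
- exact: (atom_disj atY).
- apply: mY; apply: bigcup_measurable => i _; exact: (atom_m atY).
- exact: (atom_cover atY).
Qed.

End joint_atoms.

Lemma fine_probK {R : realType} {d} {W : measurableType d} (P : probability W R)
  (E : set W) : measurable E -> (fine (P E))%:E = P E.
Proof. by move=> mE; rewrite fineK// fin_num_measure. Qed.

(** * Conditioning on a discrete variable *)

Section discrete_conditioning.
Context {R : realType} {d d1} {W : measurableType d} {T1 : measurableType d1}.
Context (P : probability W R) (X : {dRV P >-> T1}) (D1 : nat -> set T1).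
Hypothesis atX : atoms P X D1.

Let mAx i : measurable (atom_x X D1 i). Proof. exact: measurable_atom_x. Qed.
Hint Resolve mAx : core.

(** A function is constant on an atom, so integrating the density over [D1 i] gives the elementary
    ratio; the product form covers null atoms as well. *)
Lemma cond_prob_atom (E : set W) i x : measurable E -> D1 i x ->
  (cond_prob P E X x * pmfx X D1 i = fine (P (E `&` atom_x X D1 i)))%R.
Proof.
move=> mE Dx; have [mc _ cE] := @cond_probP _ _ _ P _ _ X _ mE.
have mD := atom_m atX i.
apply: EFin_inj; rewrite EFinM /pmfx !fine_probK//; last exact: measurableI.
rewrite cE// (eq_integral (fun=> (cond_prob P E X x)%:E)) ?integral_cst//.
by move=> y /set_mem Dy; rewrite (atom_sub atX Dy Dx).
Qed.

(** The law of X lives on the atoms of positive mass, since the countably many null atoms have a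
    null union. *)
Lemma ae_atoms (F : T1 -> Prop) : {ae distribution P X, forall x, F x} <->
  forall i x, D1 i x -> (0 < pmfx X D1 i)%R -> F x.
Proof.
split=> [[N [mN N0 FN]] i x Dx pi|h].
  apply: contrapT => nF; have Nx : N x by exact: FN.
  have : P (atom_x X D1 i) <= distribution P X N.
    apply: le_measure; rewrite ?inE//.
      by rewrite -[_ @^-1` _]setTI; exact: measurable_funPT.
    by move=> w Dw; rewrite /= (atom_sub atX Dw Dx).
  rewrite N0 => h; have : P (atom_x X D1 i) = 0 by apply/eqP; rewrite eq_le h measure_ge0.
  by move=> P0; move: pi; rewrite /pmfx P0 ltxx.
pose K := \bigcup_(i in [set i | (0 < pmfx X D1 i)%R]) D1 i.
have mK : measurable K by apply: bigcup_measurable => i _; exact: (atom_m atX).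
exists (~` K); split; first exact: measurableC.
  pose N := \bigcup_(i in [set i | pmfx X D1 i = 0%R]) atom_x X D1 i.
  have mN : measurable N by exact: bigcup_measurable.
  have PN : P N = 0.
    rewrite measure_bigcup//; last first.
      by apply: sub_trivIset (triv_atom_x atX).
    rewrite eseries0// => i _ /set_mem pi.
    by rewrite -[LHS](fine_probK P (mAx i)); move: pi; rewrite /= /pmfx => ->.
  have mC : measurable (\bigcup_i atom_x X D1 i) by exact: bigcup_measurable.
  have mXK : measurable (X @^-1` ~` K).
    by rewrite -[_ @^-1` _]setTI; apply: measurable_funPT => //; exact: measurableC.
  rewrite -[LHS](probability_full_setI _ mC (cover_atom_x atX))//.
  apply/eqP; rewrite eq_le measure_ge0 andbT -PN; apply: le_measure; rewrite ?inE//.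
    exact: measurableI.
  move=> w [/= nK [i _ Dw]]; exists i => //=.
  apply/eqP/negPn/negP => pi; apply: nK; exists i => //=.
  by rewrite lt_neqAle eq_sym pi fine_ge0.
move=> x /= nF [i /= pi Dx]; exact/nF/(h i).
Qed.

End discrete_conditioning.

(** * Markov chains in terms of posteriors *)

Section markov_links.
Context {R : realType} {d d1 d2} {W : measurableType d}
  {T1 : measurableType d1} {T2 : measurableType d2} (P : probability W R).
Variables (X : {dRV P >-> T1}) (Y : {dRV P >-> T2}).
Variables (D1 : nat -> set T1) (D2 : nat -> set T2).
Hypotheses (atX : atoms P X D1) (atY : atoms P Y D2).
Context {dV} {V : measurableType dV} (U : {RV P >-> V}).

Let mulr_sqACA (a b c : R) : (a * b * c * c = (a * c) * (b * c))%R.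
Proof. ring. Qed.
Let Ax := atom_x X D1.
Let Ay := atom_y Y D2.
Let mAx i : measurable (Ax i). Proof. exact: measurable_atom_x. Qed.
Let mAy j : measurable (Ay j). Proof. exact: measurable_atom_y. Qed.
Let mAxy i j : measurable (Ax i `&` Ay j). Proof. exact: measurableI. Qed.
Hint Resolve mAx mAy mAxy : core.
Let mX A : measurable A -> measurable (X @^-1` A).
Proof. by move=> mA; rewrite -[_ @^-1` _]setTI; exact: measurable_funPT. Qed.
Let mY A : measurable A -> measurable (Y @^-1` A).
Proof. by move=> mA; rewrite -[_ @^-1` _]setTI; exact: measurable_funPT. Qed.
Let mU A : measurable A -> measurable (U @^-1` A).
Proof. by move=> mA; rewrite -[_ @^-1` _]setTI; exact: measurable_funPT. Qed.

(** Up to a null set, every event about a discrete variable is thus a union of atoms, which reduces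
    arbitrary events to atoms. *)
Let sub_or_disj {T} (D E : set T) : (forall x y, D x -> D y -> x = y) ->
  {b : bool | E `&` D = if b then D else set0}.
Proof.
move=> Dsub; have [DE|DE] := pselect (D `<=` E).
  by exists true; exact: setIidr.
exists false; apply/seteqP; split => x //= [Ex Dx]; apply: DE => y Dy.
by rewrite (Dsub _ _ Dy Dx).
Qed.

(** Atoms are particular events; conversely, events are split along the atoms and the conditional
    probabilities summed over both indices. *)
Lemma markov_XUY : markov_chain P X U Y <-> forall i j,
  {ae distribution P U, forall v, gp2 X Y D1 D2 U i j v = (gpx X D1 U i v * gpy Y D2 U j v)%R}.
Proof.
split=> [mk i j|gE E F mE mF].
  exact: (mk (D1 i) (D2 j) (atom_m atX i) (atom_m atY j)).
pose e i := sval (sub_or_disj E (@atom_sub _ _ _ _ _ _ _ _ atX i)).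
pose f j := sval (sub_or_disj F (@atom_sub _ _ _ _ _ _ _ _ atY j)).
have eP i : X @^-1` E `&` Ax i = if e i then Ax i else set0.
  rewrite /e; case: sub_or_disj => b /= /(congr1 (fun B => X @^-1` B)).
  by rewrite preimage_setI => ->; case: b.
have fP j : Y @^-1` F `&` Ay j = if f j then Ay j else set0.
  rewrite /f; case: sub_or_disj => b /= /(congr1 (fun B => Y @^-1` B)).
  by rewrite preimage_setI => ->; case: b.
have c0 E' v : measurable E' -> (0 <= cond_prob P E' U v)%R.
  by move=> mE'; have [_ /(_ v)/andP[]] := cond_probP U mE'.
have null := cond_prob_null U measurable0 (measure0 P).
have sX := cond_prob_sum U mAx (triv_atom_x atX) (cover_atom_x atX) (mX mE).
have sY := cond_prob_sum U mAy (triv_atom_y atY) (cover_atom_y atY) (mY mF).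
have mEF : measurable (X @^-1` E `&` Y @^-1` F) by exact: measurableI (mX mE) (mY mF).
have sXY1 := cond_prob_sum U mAx (triv_atom_x atX) (cover_atom_x atX) mEF.
have sXY2 : {ae distribution P U, forall v, forall i,
    \sum_(j <oo) (cond_prob P (X @^-1` E `&` Y @^-1` F `&` Ax i `&` Ay j) U v)%:E =
    (cond_prob P (X @^-1` E `&` Y @^-1` F `&` Ax i) U v)%:E}.
  apply: ae_foralln => i; apply: cond_prob_sum => //.
  - exact: triv_atom_y.
  - exact: cover_atom_y.
  - exact: measurableI.
have gE' : {ae distribution P U, forall v, forall i j, gp2 X Y D1 D2 U i j v =
    (gpx X D1 U i v * gpy Y D2 U j v)%R}.
  by apply: ae_foralln => i; apply: ae_foralln => j; exact: gE.
apply: filterS2 (filterI null gE') (filterI (filterI sX sY) (filterI sXY1 sXY2)).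
move=> v [n0 gv] [[sXv sYv] [s1 s2]]; apply: EFin_inj; rewrite EFinM -sXv -sYv -s1.
have eq_ij i j : cond_prob P (X @^-1` E `&` Y @^-1` F `&` Ax i `&` Ay j) U v =
    (cond_prob P (X @^-1` E `&` Ax i) U v * cond_prob P (Y @^-1` F `&` Ay j) U v)%R.
  rewrite (_ : _ `&` Ay j = (X @^-1` E `&` Ax i) `&` (Y @^-1` F `&` Ay j)); last first.
    by rewrite setIACA -!setIA.
  rewrite eP fP; case: (e i); last by rewrite set0I n0 mul0r.
  by case: (f j); [exact: gv|rewrite setI0 n0 mulr0].
have cX0 i : (0 <= cond_prob P (X @^-1` E `&` Ax i) U v)%R by apply/c0/measurableI => //; exact: mX.
have cY0 j : (0 <= cond_prob P (Y @^-1` F `&` Ay j) U v)%R by apply/c0/measurableI => //; exact: mY.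
rewrite sYv muleC -nneseriesZl; last by move=> i _; rewrite lee_fin.
apply: eq_eseriesr => i _; rewrite -s2 muleC -sYv -nneseriesZl; last first.
  by move=> j _; rewrite lee_fin.
by apply: eq_eseriesr => j _; rewrite eq_ij EFinM.
Qed.

(** The chain conditions on X whereas posteriors condition on U. Bayes' rule passes from one to the
    other: both sides are expressed by the joint probabilities P(X = i, Y = j, U in A). *)
Lemma markov_YXU : markov_chain P Y X U <-> forall i j,
  {ae distribution P U, forall v, gp2 X Y D1 D2 U i j v =
    (gpx X D1 U i v * (pmf2 X Y D1 D2 i j / pmfx X D1 i))%R}.
Proof.
have p0 i : pmfx X D1 i = 0%R -> forall B, measurable B -> P (B `&` Ax i) = 0.
  move=> pi B mB; apply/eqP; rewrite eq_le measure_ge0 andbT.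
  rewrite -[leRHS]/(0%R%:E) -pi.
  by rewrite /pmfx fine_probK//; apply: le_measure; rewrite ?inE//; exact: measurableI.
split=> [mk i j|gE E F mE mF].
  apply: cond_prob_unique => //.
  - apply: measurable_funM => //.
    by have [] := cond_probP U (mAx i).
  - move=> v; rewrite mulr_ge0 ?divr_ge0 ?fine_ge0//.
    by have [_ /(_ v)/andP[]] := cond_probP U (mAx i).
  move=> A mA; have [mc c01 cE] := cond_probP U (mAx i).
  under eq_integral do rewrite mulrC EFinM.
  rewrite ge0_integralZl//; last 3 first.
  - by apply/measurable_EFinP; apply: measurable_funTS.
  - by move=> v _; rewrite lee_fin; case/andP: (c01 v).
  - by rewrite lee_fin divr_ge0 ?fine_ge0.
  rewrite -cE//; have [pi|pi] := eqVneq (pmfx X D1 i) 0%R.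
    rewrite pi invr0 mulr0 mul0e -setIA setIC; apply: (p0 i pi).
    by apply: measurableI => //; exact: mU.
  have pi0 : (0 < pmfx X D1 i)%R by rewrite lt_neqAle eq_sym pi fine_ge0.
  have [[x Dx]|nD] := pselect (exists x, D1 i x); last first.
    move: pi; rewrite /pmfx (_ : atom_x X D1 i = set0) ?measure0 ?eqxx//.
    by apply/seteqP; split => w //= Dw; apply: nD; exists (X w).
  have := mk (D2 j) A (atom_m atY j) mA; move/(ae_atoms atX) => /(_ i x Dx pi0).
  (* Each of the two conditional probabilities on the right absorbs one factor [pmfx X D1 i] and
     becomes a joint probability. *)
  move=> /(congr1 (fun r => r * pmfx X D1 i * pmfx X D1 i)%R).
  cbv beta; rewrite -/(Ay j) mulr_sqACA.
  rewrite !(cond_prob_atom atX)//; last 2 first.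
  - exact: mAy.
  - by apply: measurableI; [exact: mAy|exact: mU].
  move=> h; rewrite -[LHS]fine_probK; last by apply: measurableI => //; exact: mU.
  rewrite -[X in _ * X]fine_probK; last by apply: measurableI => //; exact: mU.
  rewrite -EFinM; congr EFin; apply: (mulIf pi); rewrite mulrAC divfK//.
  rewrite /pmf2 -/(Ax i) -/(Ay j) [Ax i `&` Ay j]setIC [Ax i `&` U @^-1` A]setIC.
  by rewrite setIAC; exact: h.
  exact: mU.
apply/(ae_atoms atX) => i x Dx pi0; have pi : pmfx X D1 i != 0%R by rewrite gt_eqF.
apply: (mulIf pi); apply: (mulIf pi); rewrite mulr_sqACA.
have mEF : measurable (Y @^-1` E `&` U @^-1` F).
  by apply: measurableI; [exact: mY|exact: mU].
rewrite !(cond_prob_atom atX)//; last 2 first.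
- exact: mU.
- exact: mY.
pose e j := sval (sub_or_disj E (@atom_sub _ _ _ _ _ _ _ _ atY j)).
have eP j : Y @^-1` E `&` Ay j = if e j then Ay j else set0.
  rewrite /e; case: sub_or_disj => b /= /(congr1 (fun B => Y @^-1` B)).
  by rewrite preimage_setI => ->; case: b.
(* Splits the event Y in E along the atoms of Y; an atom lies inside [E] or drops out. *)
have total B : measurable B -> P (Y @^-1` E `&` B) =
    \sum_(j <oo) P (if e j then Ay j `&` B else set0).
  move=> mB; have mEB : measurable (Y @^-1` E `&` B) by apply: measurableI => //; exact: mY.
  rewrite -(probability_full_setI mEB (bigcup_measurable (fun j _ => mAy j)) (cover_atom_y atY)).
  rewrite setI_bigcupr measure_bigcup//; last 2 first.
  - by move=> j _; exact: measurableI.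
  - exact/trivIset_setIl/(triv_atom_y atY).
  rewrite (eq_eseriesl (Q := xpredT)); last by move=> j; rewrite in_setT.
  by apply: eq_eseriesr => j _; rewrite setIAC eP; case: (e j) => //; rewrite set0I.
have [_ c01 cE] := cond_probP U (mAx i).
(* The factorization of the posterior, integrated over [F]. *)
have gij j : P (Ay j `&` (U @^-1` F `&` Ax i)) =
    (fine (P (U @^-1` F `&` Ax i)) / pmfx X D1 i)%:E * P (Ay j `&` Ax i).
  have -> : Ay j `&` (U @^-1` F `&` Ax i) = Ax i `&` Ay j `&` U @^-1` F.
    by rewrite setICA setIC [Ay j `&` _]setIC.
  rewrite [Ay j `&` Ax i]setIC.
  have [_ _ ->//] := cond_probP U (mAxy i j).
  rewrite (ge0_ae_eq_integral (g := fun v => ((pmf2 X Y D1 D2 i j / pmfx X D1 i)%:E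
     * (cond_prob P (Ax i) U v)%:E)))//; last 5 first.
  - have [mc _ _] := cond_probP U (mAxy i j).
    by apply/measurable_EFinP; apply: measurable_funTS.
  - have [mc _ _] := cond_probP U (mAx i).
    by apply: measurable_funeM; apply/measurable_EFinP; apply: measurable_funTS.
  - by move=> v _; have [_ /(_ v)/andP[? _] _] := cond_probP U (mAxy i j); rewrite lee_fin.
  - move=> v _; rewrite -EFinM lee_fin mulr_ge0 ?divr_ge0 ?fine_ge0//.
    by case/andP: (c01 v).
  - by apply: filterS (gE i j) => v + _; rewrite -EFinM mulrC => <-.
  rewrite ge0_integralZl//; last 3 first.
  - have [mc _ _] := cond_probP U (mAx i).
    by apply/measurable_EFinP; apply: measurable_funTS.
  - by move=> v _; rewrite lee_fin; case/andP: (c01 v).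
  - by rewrite lee_fin divr_ge0 ?fine_ge0.
  rewrite -cE// setIC -[X in _ * X]fine_probK; last first.
    by apply: measurableI => //; exact: mU.
  rewrite -[X in _ = _ * X]fine_probK// -!EFinM; congr EFin.
  by rewrite /pmf2 -/(Ax i) -/(Ay j); ring.
apply: EFin_inj; rewrite -setIA !EFinM /pmfx !fine_probK//; last 3 first.
- by apply: measurableI => //; exact: mU.
- by apply: measurableI => //; exact: mY.
- by apply: measurableI; [exact: mY|apply: measurableI => //; exact: mU].
rewrite !total//; last by apply: measurableI => //; exact: mU.
set c := (fine (P (U @^-1` F `&` Ax i)) / pmfx X D1 i)%R.
have c0 : (0 <= c)%R by rewrite divr_ge0// fine_ge0.
rewrite (eq_eseriesr (g := fun j => c%:E * P (if e j then Ay j `&` Ax i else set0))); last first.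
  by move=> j _; case: (e j); [exact: gij|rewrite measure0 mule0].
rewrite nneseriesZl// muleAC -[X in _ * X * _](fine_probK P (mAx i)) -EFinM muleC.
congr (_ * _).
rewrite divfK// fine_probK//.
by apply: measurableI => //; exact: mU.
Qed.

End markov_links.

(** * A probability space with prescribed posteriors *)

Section labelled_space.
Context {R : realType} {dV} {V : measurableType dV} (Q : probability V R).
Variables (p : nat -> nat -> R) (px py : nat -> R)
  (g : nat -> nat -> V -> R) (gx gy : nat -> V -> R).
Hypothesis post : posteriors Q p px py g gx gy.

Let g0 i j v : (0 <= g i j v)%R. Proof. by case/andP: (post01 post i j v). Qed.
Let mg i j A : measurable_fun A (fun v => (g i j v)%:E).
Proof. by apply/measurable_EFinP; apply: measurable_funTS; exact: (post_m post). Qed.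

(* The law of (U, i, j) on V * nat * nat with the given posteriors. *)
Definition labelled_mass & posteriors Q p px py g gx gy :
    set (V * (nat * nat)) -> \bar R :=
  fun A => \sum_(i <oo) \sum_(j <oo) \int[Q]_(v in ysection A (i, j)) (g i j v)%:E.

Let mass0 : labelled_mass post set0 = 0.
Proof.
rewrite /labelled_mass eseries0// => i _ _; rewrite eseries0// => j _ _.
by rewrite ysection0 integral_set0.
Qed.

Let int0 i j A : 0 <= \int[Q]_(v in A) (g i j v)%:E.
Proof. by apply: integral_ge0 => v _; rewrite lee_fin. Qed.

Let mass_ge0 A : 0 <= labelled_mass post A.
Proof. by apply: nneseries_ge0 => i *; apply: nneseries_ge0 => j *. Qed.

Let mass_sigma_additive : semi_sigma_additive (labelled_mass post).
Proof.
move=> A mA tA mUA; apply: cvg_toP.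
  by apply: is_cvg_nneseries => n _ _.
pose B n i j := \int[Q]_(v in ysection (A n) (i, j)) (g i j v)%:E.
have B0 n i j : 0 <= B n i j by exact: int0.
transitivity (\sum_(n <oo) \sum_(i <oo) \sum_(j <oo) B n i j); first by [].
rewrite (@nneseries_interchange _ (fun n i => \sum_(j <oo) B n i j) xpredT xpredT); last first.
  by move=> n i; apply: nneseries_ge0 => j *; exact: B0.
apply: eq_eseriesr => i _.
rewrite (@nneseries_interchange _ (fun n j => B n i j) xpredT xpredT)//.
apply: eq_eseriesr => j _.
rewrite ysection_bigcup ge0_integral_bigcup//.
- by move=> n; exact: measurable_ysection.
- by move=> v _; rewrite lee_fin.
- apply/trivIsetP => m n _ _ mn; rewrite -ysectionI.
  by move/trivIsetP : tA => /(_ m n I I mn) ->; rewrite ysection0.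
Qed.

HB.instance Definition _ := isMeasure.Build _ _ _ (labelled_mass post)
  mass0 mass_ge0 mass_sigma_additive.

Let mass_setT : labelled_mass post setT = 1.
Proof.
rewrite -(post_px1 post); apply: eq_eseriesr => i _.
rewrite -(post_px post); apply: eq_eseriesr => j _.
rewrite (_ : ysection _ _ = setT) ?(post_int post)//.
by apply/seteqP; split => v // _; rewrite /ysection /= inE.
Qed.

HB.instance Definition _ := Measure_isProbability.Build _ _ _ (labelled_mass post) mass_setT.

End labelled_space.

Lemma nneseries_single {R : realType} (f : nat -> \bar R) i :
  (forall k, 0 <= f k) -> (forall k, k != i -> f k = 0) -> \sum_(k <oo) f k = f i.
Proof.
by move=> f0 fi; rewrite (nneseriesD1 (n := i))// eseries0 ?adde0// => k _ /andP[_ /fi].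
Qed.

Lemma probability_partition {R : realType} {d} {W : measurableType d}
    (P : probability W R) (C : nat -> set W) (B : set W) :
  (forall i, measurable (C i)) -> trivIset [set: nat] C ->
  P (\bigcup_i C i) = 1 -> measurable B ->
  P B = \sum_(i <oo) P (B `&` C i).
Proof.
move=> mC tC PC mB.
rewrite -(probability_full_setI mB (bigcup_measurable (fun i _ => mC i)) PC).
rewrite setI_bigcupr measure_bigcup//; last 2 first.
- by move=> i _; exact: measurableI.
- exact: trivIset_setIl.
by apply: eq_eseriesl => i; rewrite in_setT.
Qed.

Section realization.
Context {R : realType} {d d1 d2} {W : measurableType d}
  {T1 : measurableType d1} {T2 : measurableType d2} (P : probability W R).
Variables (X : {dRV P >-> T1}) (Y : {dRV P >-> T2}).
Hypotheses (mT1 : forall x : T1, measurable [set x])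
  (mT2 : forall y : T2, measurable [set y]).
Variables (D1 : nat -> set T1) (D2 : nat -> set T2).
Hypotheses (atX : atoms P X D1) (atY : atoms P Y D2).
Context {dV} {V : measurableType dV} (Q : probability V R).
Variables (g : nat -> nat -> V -> R) (gx gy : nat -> V -> R).
Let p := pmf2 X Y D1 D2.
Hypothesis post : posteriors Q p (pmfx X D1) (pmfy Y D2) g gx gy.

Let P' : probability (V * (nat * nat))%type R := labelled_mass post.

(** A representative of the atom. For an empty [D1 i] it is an arbitrary point, possibly in another
    atom, but then [p i j = 0] for all [j]. *)
Let s1 i : T1 := get (D1 i).
Let s2 j : T2 := get (D2 j).

Let X' (w : V * (nat * nat)) : T1 := s1 w.2.1.
Let Y' (w : V * (nat * nat)) : T2 := s2 w.2.2.
Let U' (w : V * (nat * nat)) : V := w.1.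

Let mX' : measurable_fun [set: V * (nat * nat)] X'.
Proof.
have ms1 : measurable_fun [set: nat] s1 by [].
apply: (measurableT_comp ms1); apply: (measurableT_comp measurable_fst).
exact: measurable_snd.
Qed.
Let mY' : measurable_fun [set: V * (nat * nat)] Y'.
Proof.
have ms2 : measurable_fun [set: nat] s2 by [].
apply: (measurableT_comp ms2); apply: (measurableT_comp measurable_snd).
exact: measurable_snd.
Qed.
Let mU' : measurable_fun [set: V * (nat * nat)] U'.
Proof. exact: measurable_fst. Qed.

Let cX' : countable (range X').
Proof.
apply: (@sub_countable _ _ _ (s1 @` [set: nat])); last exact: card_image_le.
by apply: subset_card_le => x [w _ <-]; exists w.2.1.
Qed.
Let cY' : countable (range Y').
Proof.
apply: (@sub_countable _ _ _ (s2 @` [set: nat])); last exact: card_image_le.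
by apply: subset_card_le => x [w _ <-]; exists w.2.2.
Qed.

HB.instance Definition _ := isMeasurableFun.Build _ _ _ _ X' mX'.
HB.instance Definition _ := MeasurableFun_isDiscrete.Build _ _ _ _ X' cX'.
HB.instance Definition _ := isMeasurableFun.Build _ _ _ _ Y' mY'.
HB.instance Definition _ := MeasurableFun_isDiscrete.Build _ _ _ _ Y' cY'.
HB.instance Definition _ := isMeasurableFun.Build _ _ _ _ U' mU'.

Let XR : {dRV P' >-> T1} := X'.
Let YR : {dRV P' >-> T2} := Y'.
Let UR : {RV P' >-> V} := U'.

Let s1P i x : D1 i x -> D1 i (s1 i). Proof. by move=> Dx; apply: (getI Dx). Qed.
Let s2P j y : D2 j y -> D2 j (s2 j). Proof. by move=> Dy; apply: (getI Dy). Qed.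

Let g0 i j v : (0 <= g i j v)%R. Proof. by case/andP: (post01 post i j v). Qed.
Let mg i j A : measurable_fun A (fun v => (g i j v)%:E).
Proof. by apply/measurable_EFinP; apply: measurable_funTS; exact: (post_m post). Qed.
Let int0 i j A : 0 <= \int[Q]_(v in A) (g i j v)%:E.
Proof. by apply: integral_ge0 => v _; rewrite lee_fin. Qed.

Let p_ge0 i j : (0 <= p i j)%R. Proof. by case/andP: (post_p01 post i j). Qed.

Let int_null i j A : measurable A -> p i j = 0%R -> \int[Q]_(v in A) (g i j v)%:E = 0.
Proof.
move=> mA pij; apply/eqP; rewrite eq_le int0 andbT.
rewrite -[leRHS]/(0%R%:E) -pij -(post_int post); apply: ge0_subset_integral => //.
by move=> v _; rewrite lee_fin.
Qed.

Let atom_live i j : p i j != 0%R -> D1 i (s1 i) /\ D2 j (s2 j).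
Proof.
move=> pij; have [[w [/= h1 h2]]|nw] :=
  pselect (exists w, (atom_x X D1 i `&` atom_y Y D2 j) w).
  by split; [exact: s1P h1|exact: s2P h2].
move: pij; rewrite /p /pmf2 (_ : _ `&` _ = set0) ?measure0 ?eqxx//.
by apply/seteqP; split => w // h; apply: nw; exists w.
Qed.

Let mass_section (A : set (V * (nat * nat))) : P' A =
  \sum_(i <oo) \sum_(j <oo) \int[Q]_(v in ysection A (i, j)) (g i j v)%:E.
Proof. by []. Qed.

(** Labels of positive mass have their representatives in their own atoms, and atoms are disjoint,
    so only the section at [(i, j)] contributes; labels of mass zero contribute nothing. *)
Let mass_atom i j A : measurable A ->
  P' (X' @^-1` D1 i `&` Y' @^-1` D2 j `&` U' @^-1` A) = \int[Q]_(v in A) (g i j v)%:E.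
Proof.
move=> mA; rewrite mass_section.
set S := _ `&` _.
have mS : measurable S.
  apply: measurableI; [apply: measurableI|].
  - by rewrite -[_ @^-1` _]setTI; apply: mX' => //; exact: (atom_m atX).
  - by rewrite -[_ @^-1` _]setTI; apply: mY' => //; exact: (atom_m atY).
  - by rewrite -[_ @^-1` _]setTI; exact: mU'.
have term k l : (k, l) != (i, j) -> \int[Q]_(v in ysection S (k, l)) (g k l v)%:E = 0.
  move=> kl; have [pkl|/atom_live[h1 h2]] := eqVneq (p k l) 0%R.
    by apply: int_null => //; exact: measurable_ysection.
  rewrite (_ : ysection _ _ = set0) ?integral_set0//.
  apply/seteqP; split => v //; rewrite /ysection/= inE => -[[/= h3 h4] _].
  move/eqP: kl; apply; congr (_, _).
    exact: (atom_disj atX h1 h3).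
  exact: (atom_disj atY h2 h4).
rewrite (nneseries_single (i := i)); last 2 first.
- by move=> k; apply: nneseries_ge0 => *; exact: int0.
- move=> k ki; rewrite eseries0// => l _ _; apply: term.
  by apply: contra_neq ki => -[].
rewrite (nneseries_single (i := j)); last 2 first.
- by move=> l; exact: int0.
- by move=> l lj; apply: term; apply: contra_neq lj => -[].
have [pij|/atom_live[h1 h2]] := eqVneq (p i j) 0%R.
  by rewrite !int_null//; exact: measurable_ysection.
congr integral; apply/seteqP; split => v; rewrite /ysection/= inE.
  by move=> -[].
by move=> Av; split.
Qed.

Let law A : measurable A -> P' (pair_rv XR YR @^-1` A) = P (pair_rv X Y @^-1` A).
Proof.
move=> mA; rewrite mass_section.
have mX B : measurable B -> measurable (X @^-1` B).
  by move=> mB; rewrite -[_ @^-1` _]setTI; exact: measurable_funPT.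
have mY B : measurable B -> measurable (Y @^-1` B).
  by move=> mB; rewrite -[_ @^-1` _]setTI; exact: measurable_funPT.
have mXYA : measurable (pair_rv X Y @^-1` A).
  rewrite -[_ @^-1` _]setTI.
  apply: (measurable_fun_pair (f := X) (g := Y)) => //; exact: measurable_funPT.
have mx i : measurable (atom_x X D1 i) by exact: measurable_atom_x.
have my j : measurable (atom_y Y D2 j) by exact: measurable_atom_y.
rewrite (probability_partition mx (triv_atom_x atX) (cover_atom_x atX) mXYA).
apply: eq_eseriesr => i _.
rewrite (probability_partition my (triv_atom_y atY) (cover_atom_y atY)); last first.
  exact: measurableI.
apply: eq_eseriesr => j _.
have [As|nAs] := pselect (A (s1 i, s2 j)).
  rewrite (_ : ysection _ _ = setT); last first.
    by apply/seteqP; split => v // _; rewrite /ysection /= inE.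
  rewrite (post_int post) /p /pmf2 fineK ?fin_num_measure//; last exact: measurableI.
  congr (P _); apply/seteqP; split => w /=; last by move=> [[]].
  move=> [h1 h2]; split => //; split => //; rewrite /pair_rv.
  by rewrite (atom_sub atX h1 (s1P h1)) (atom_sub atY h2 (s2P h2)).
rewrite (_ : ysection _ _ = set0) ?integral_set0; last first.
  by apply/seteqP; split => v //; rewrite /ysection /= inE.
rewrite (_ : _ `&` _ = set0) ?measure0//.
apply/seteqP; split => w //= [[Aw h1] h2]; apply: nAs.
by rewrite -(atom_sub atX h1 (s1P h1)) -(atom_sub atY h2 (s2P h2)).
Qed.

Definition realization : jointly_distributed P X Y :=
  @JointlyDistributed R d d1 d2 W T1 T2 P X Y _ _ P' XR YR law _ V UR.

Let dist : probability V R := distribution P' UR.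

(** The posteriors add up to 1 almost everywhere, so summing the labels out leaves [Q]. *)
Let distE A : measurable A -> dist A = Q A.
Proof.
move=> mA; apply: (@etrans _ _ (\int[Q]_(v in A) (cst 1 v))); last first.
  by rewrite integral_cst// mul1e.
transitivity (\sum_(i <oo) \sum_(j <oo) \int[Q]_(v in A) (g i j v)%:E).
  apply: eq_eseriesr => i _; apply: eq_eseriesr => j _; congr integral.
  by apply/seteqP; split => v; rewrite /ysection/= inE.
transitivity (\sum_(i <oo) \int[Q]_(v in A) (gx i v)%:E).
  apply: eq_eseriesr => i _; rewrite -integral_nneseries//; last first.
    by move=> j v _; rewrite lee_fin.
  apply: ge0_ae_eq_integral => //.
  - by apply: measurable_funTS; apply: measurable_nneseries_EFin => // j; exact: (post_m post).
  - by apply: measurable_funTS; apply/measurable_EFinP; exact: (post_mx post).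
  - by move=> v _; apply: nneseries_ge0 => j *; rewrite lee_fin.
  - by move=> v _; rewrite lee_fin; case/andP: (postx01 post i v).
  - by apply: filterS (post_row post i).
have gx0 i v : (0 <= gx i v)%R by case/andP: (postx01 post i v).
rewrite -integral_nneseries//; last 2 first.
- by move=> i; apply: measurable_funTS; apply/measurable_EFinP; exact: (post_mx post).
- by move=> i v _; rewrite lee_fin.
apply: ge0_ae_eq_integral => //.
- by apply: measurable_funTS; apply: measurable_nneseries_EFin => // i; exact: (post_mx post).
- by move=> v _; apply: nneseries_ge0 => i *; rewrite lee_fin.
- by apply: filterS (postx1 post).
Qed.

Let int_dist (f : V -> \bar R) A : measurable A ->
  \int[dist]_(v in A) f v = \int[Q]_(v in A) f v.
Proof. by move=> mA; apply: eq_measure_integral => B mB _; exact: distE. Qed.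

Let ae_dist (F : V -> Prop) : {ae Q, forall v, F v} -> {ae dist, forall v, F v}.
Proof. by move=> [N [mN N0 FN]]; exists N; split => //; rewrite -N0; exact: distE. Qed.

Lemma atoms_realization_x : atoms P' XR D1.
Proof.
apply: atoms_transfer atX => A mA.
rewrite (_ : XR @^-1` A = pair_rv XR YR @^-1` (A `*` setT)); last first.
  by apply/seteqP; split => w //= -[].
rewrite law; last exact: measurableX.
by congr (P _); apply/seteqP; split => w //= -[].
Qed.

Lemma atoms_realization_y : atoms P' YR D2.
Proof.
apply: atoms_transfer atY => A mA.
rewrite (_ : YR @^-1` A = pair_rv XR YR @^-1` (setT `*` A)); last first.
  by apply/seteqP; split => w //= -[].
rewrite law; last exact: measurableX.
by congr (P _); apply/seteqP; split => w //= -[].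
Qed.

Let gp2E i j : {ae dist, forall v, gp2 XR YR D1 D2 UR i j v = g i j v}.
Proof.
apply: cond_prob_unique.
- exact: (measurable_atom_xy atoms_realization_x atoms_realization_y).
- exact: (post_m post).
- exact: g0.
- move=> A mA; rewrite (int_dist (fun v => (g i j v)%:E))//; exact: mass_atom.
Qed.

(** Both sides are the row sums of the joint posteriors, which agree by [gp2E]. *)
Let gpxE i : {ae dist, forall v, gpx XR D1 UR i v = gx i v}.
Proof.
have := post_row (posteriors_RV atoms_realization_x atoms_realization_y UR) i.
apply: filterS3 (ae_foralln (gp2E i)) (ae_dist (post_row post i)) => v e1 e2 e3.
apply: EFin_inj; rewrite -e2 -e3; apply: eq_eseriesr => j _; congr EFin.
exact: e1.
Qed.

Let gpyE j : {ae dist, forall v, gpy YR D2 UR j v = gy j v}.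
Proof.
have := post_col (posteriors_RV atoms_realization_x atoms_realization_y UR) j.
apply: filterS3 (ae_foralln (gp2E ^~ j)) (ae_dist (post_col post j)) => v e1 e2 e3.
apply: EFin_inj; rewrite -e2 -e3; apply: eq_eseriesr => i _; congr EFin.
exact: e1.
Qed.

Let int_negxlnx (a b : V -> R) : measurable_fun [set: V] a ->
  (forall v, (0 <= a v <= 1)%R) -> measurable_fun [set: V] b ->
  (forall v, (0 <= b v <= 1)%R) -> {ae dist, forall v, a v = b v} ->
  \int[dist]_v negxlnx (a v) = \int[Q]_v negxlnx (b v).
Proof.
move=> ma a01 mb b01 ab; rewrite -(int_dist (fun v => negxlnx (b v)))//.
apply: ge0_ae_eq_integral => //.
- exact: measurable_negxlnx.
- exact: measurable_negxlnx.
- by move=> v _; exact: negxlnx_ge0.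
- by move=> v _; exact: negxlnx_ge0.
- by apply: filterS ab => v ->.
Qed.

Lemma realization_entropy :
  [/\ cond_entropy P' (pair_rv XR YR) UR = ent2 Q g,
      cond_entropy P' XR UR = ent1 Q gx &
      cond_entropy P' YR UR = ent1 Q gy].
Proof.
have post' := posteriors_RV atoms_realization_x atoms_realization_y UR.
rewrite (cond_entropy_ent2 mT1 mT2 atoms_realization_x atoms_realization_y).
rewrite (cond_entropy_ent1x mT1 atoms_realization_x).
rewrite (cond_entropy_ent1y mT2 atoms_realization_y).
split.
- apply: eq_eseriesr => i _; apply: eq_eseriesr => j _; apply: int_negxlnx.
  + exact: (post_m post').
  + exact: (post01 post').
  + exact: (post_m post).
  + exact: (post01 post).
  + exact: gp2E.
- apply: eq_eseriesr => i _; apply: int_negxlnx.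
  + exact: (post_mx post').
  + exact: (postx01 post').
  + exact: (post_mx post).
  + exact: (postx01 post).
  + exact: gpxE.
- apply: eq_eseriesr => i _; apply: int_negxlnx.
  + exact: (post_my post').
  + exact: (posty01 post').
  + exact: (post_my post).
  + exact: (posty01 post).
  + exact: gpyE.
Qed.

Lemma exists_realization : exists u : jointly_distributed P X Y,
  [/\ cond_entropy (jd_P u) (pair_rv (jd_X u) (jd_Y u)) (jd_U u) = ent2 Q g,
      cond_entropy (jd_P u) (jd_X u) (jd_U u) = ent1 Q gx &
      cond_entropy (jd_P u) (jd_Y u) (jd_U u) = ent1 Q gy].
Proof. by exists realization; exact: realization_entropy. Qed.

End realization.

(** * Limits along an ultrafilter *)

(** Compactness gives a cluster point, and a cluster point of an ultrafilter is a limit. *)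
Lemma ultra_cvg_in {T : topologicalType} {I : Type} (F : set_system I)
    (A : set T) (f : I -> T) : UltraFilter F -> compact A -> (forall i, A (f i)) ->
  exists2 p, A p & f i @[i --> F] --> p.
Proof.
move=> FU cA fA.
have [p [Ap clp]] : A `&` cluster (f @ F) !=set0.
  by apply: cA; rewrite /= /fmap/=; apply: filterE => i; exact: fA.
exists p => // B Bp; have [//|FnB] := in_ultra_setVsetC (f @^-1` B) FU.
by have [x [nBx Bx]] := clp (~` B) B FnB Bp.
Qed.

Lemma ultra_bounded_cvg {R : realType} {I : Type} (F : set_system I) (f : I -> R) (a b : R) :
  UltraFilter F -> (forall i, a <= f i <= b)%R ->
  exists2 l, (a <= l <= b)%R & f i @[i --> F] --> l.
Proof.
move=> FU fab.
have [|l] := ultra_cvg_in FU (@segment_compact R a b) (f := f).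
  by move=> i /=; rewrite in_itv/=; exact: fab.
by rewrite /= in_itv/= => lab cl; exists l.
Qed.

Lemma mkseq_rcons {T : Type} (f : nat -> T) m :
  mkseq f m.+1 = rcons (mkseq f m) (f m).
Proof. by rewrite /mkseq -addn1 iotaD map_cat cats1. Qed.

(** * Random bit sequences with prescribed word probabilities *)

Section limit_law.
Context {R : realType} (q : seq bool -> R).
Hypotheses (q0 : forall s, (0 <= q s)%R) (q1 : q [::] = 1%R)
  (qS : forall s, (q s = q (rcons s false) + q (rcons s true))%R).

(* Left end of the interval of length [q s] that codes the word [s]. *)
Definition word_left (s : seq bool) : R :=
  (\sum_(k < size s | nth false s k) q (rcons (take k s) false))%R.

(** To the left of this point lies the interval of the word extended by [false], to the right that
    of the word extended by [true]. *)
Definition word_cut s : R := (word_left s + q (rcons s false))%R.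

(** The first [m] bits coded by the point [w], read off by successive subdivision; the cut itself
    belongs to the right part, so the intervals are closed on the left. *)
Fixpoint word (m : nat) (w : R) : seq bool :=
  if m is m'.+1 then rcons (word m' w) (word_cut (word m' w) <= w)%R else [::].

Definition word_bit (m : nat) (w : R) : bool := (word_cut (word m w) <= w)%R.

Lemma word_mkseq m w : word m w = mkseq (fun k => word_bit k w) m.
Proof. by elim: m => //= m ih; rewrite mkseq_rcons -ih. Qed.

Lemma size_word m w : size (word m w) = m.
Proof. by rewrite word_mkseq size_mkseq. Qed.

Lemma word_left_rcons s b :
  word_left (rcons s b) = (word_left s + if b then q (rcons s false) else 0)%R.
Proof.
rewrite /word_left size_rcons big_mkcond big_ord_recr/= [in RHS]big_mkcond/=.
congr (_ + _)%R.
  apply: eq_bigr => k _; rewrite nth_rcons ltn_ord.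
  suff -> : take k (rcons s b) = take k s by [].
  by rewrite -cats1 takel_cat// ltnW.
have -> : take (size s) (rcons s b) = s by rewrite -cats1 take_size_cat.
by rewrite nth_rcons ltnn eqxx.
Qed.

Lemma word_itv m w : (0 <= w < 1)%R ->
  (word_left (word m w) <= w < word_left (word m w) + q (word m w))%R.
Proof.
move=> w01; elim: m => [|m] /=; first by rewrite /word_left big_ord0 add0r q1.
have := qS (word m w); set s := word m w => qs /andP[lw wl].
rewrite word_left_rcons /word_cut; case: ifPn => [h|].
  by rewrite h/= (lt_le_trans wl)// qs; lra.
by rewrite -ltNge => h; rewrite addr0 lw h.
Qed.

(** Together with [word_itv]: the points of [0, 1) with word [s] form exactly the half-open interval
    of [s], which is empty if [q s = 0]. *)
Lemma itv_word s w : (0 <= w < 1)%R ->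
  (word_left s <= w < word_left s + q s)%R -> word (size s) w = s.
Proof.
move=> w01; elim/last_ind: s => // s b ih; rewrite word_left_rcons size_rcons/=.
have := qS s; have := q0 (rcons s false); have := q0 (rcons s true).
move=> qt qf qs /andP[h1 h2].
have sw : word (size s) w = s by apply: ih; case: b h1 h2 => h1 h2; lra.
rewrite sw; congr rcons; rewrite /word_cut; case: b h1 h2 => h1 h2; first by lra.
by apply/negbTE; rewrite -ltNge; lra.
Qed.

Lemma word_itv01 s : (0 <= word_left s /\ word_left s + q s <= 1)%R.
Proof.
elim/last_ind: s => [|s b [ih1 ih2]]; first by rewrite /word_left big_ord0 q1 add0r.
rewrite word_left_rcons; have := qS s.
have := q0 (rcons s false); have := q0 (rcons s true).
by case: b; lra.
Qed.

Lemma measurable_word m s : measurable [set w | word m w = s].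
Proof.
elim: m s => [|m ih] s /=.
  have [->|s0] := eqVneq s [::].
    by rewrite (_ : [set _ | _] = setT)//; apply/seteqP; split.
  rewrite (_ : [set _ | _] = set0)//; apply/seteqP; split => // w /= es.
  by rewrite -es eqxx in s0.
case/lastP: s => [|s b].
  rewrite (_ : [set _ | _] = set0)//; apply/seteqP; split => // w /=.
  by case: (word m w).
rewrite (_ : [set _ | _] =
    [set w | word m w = s] `&` [set w | (word_cut s <= w)%R = b]).
  apply: measurableI => //; case: b.
    rewrite (_ : [set _ | _] = `[word_cut s, +oo[%classic)//.
    by apply/seteqP; split => w /=; rewrite in_itv/= andbT.
  rewrite (_ : [set _ | _] = `]-oo, word_cut s[%classic)//.
  apply/seteqP; split => w /=; rewrite in_itv/=.
    by move=> /negbT; rewrite -ltNge.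
  by move=> h; apply/negbTE; rewrite -ltNge.
apply/seteqP; split => w /=; first by move=> /rcons_inj[-> ->].
by move=> [-> ->].
Qed.

Lemma measurable_word_bit m : measurable [set w | word_bit m w].
Proof.
pose E (o : option (seq bool)) :=
  if o is Some s then [set w | word m.+1 w = rcons s true] else set0.
rewrite (_ : [set _ | _] = \bigcup_(n : nat) E (unpickle n)).
  apply: bigcup_measurable => n _; case: (unpickle n) => [s|].
    exact: measurable_word.
  exact: measurable0.
apply/seteqP; split => w.
  move=> h; exists (pickle (word m w : seq bool)) => //.
  by rewrite pickleK /E /=; congr rcons.
by move=> [n _]; case: (unpickle n) => [s|//] /rcons_inj[_].
Qed.

Let Q : probability (measurableTypeR R) R := uniform_prob (@ltr01 R).

Let Qlebesgue (A : set R) : measurable A -> A `<=` `[0%R, 1%R]%classic ->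
  Q A = lebesgue_measure A.
Proof.
move=> mA A01; rewrite /Q /= /uniform_prob.
rewrite (eq_integral (fun=> 1)) ?integral_cst ?mul1e//.
move=> x /set_mem /A01 /=; rewrite in_itv/= /uniform_pdf => ->.
by rewrite subr0 invr1.
Qed.

(** The uniform law gives [0, 1) mass 1, and inside it the event is an interval of length [q s]. *)
Lemma word_prob m s : size s = m -> Q [set w | word m w = s] = (q s)%:E.
Proof.
move=> sm; pose I01 := `[0%R, 1%R[%classic : set R.
have lamE (a b : R) : (a <= b)%R -> lebesgue_measure `[a, b[%classic = (b - a)%:E.
  move=> ab; rewrite lebesgue_measure_itv/= lte_fin -EFinB; case: ltP => // ba.
  by have -> : a = b; [apply: le_anti; rewrite ab ba|rewrite subrr].
have Q01 : Q I01 = 1.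
  rewrite Qlebesgue//; last by move=> x; rewrite /I01 /= !in_itv/= => h; lra.
    by rewrite lamE// subr0.
  exact: measurable_itv.
apply: (@etrans _ _ (Q ([set w | word m w = s] `&` I01))).
  by apply/esym; apply: probability_full_setI => //; [exact: measurable_word|exact: measurable_itv].
rewrite (_ : _ `&` _ = `[word_left s, (word_left s + q s)%R[%classic).
  have [l0 l1] := word_itv01 s.
  rewrite Qlebesgue//; last first.
    by move=> x /=; rewrite !in_itv/= => h; lra.
  by rewrite lamE ?lerDl//; congr EFin; ring.
have [l0 l1] := word_itv01 s.
apply/seteqP; split => w /=; rewrite !in_itv/=.
  by move=> [<- w01]; apply: word_itv.
move=> h; have w01 : (0 <= w < 1)%R by case/andP: h; lra.
by split => //; rewrite -sm; exact: itv_word.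
Qed.

End limit_law.

(** * Binary expansions of numbers in [0, 1] *)

Section dyadic_bits.
Context {R : realType}.

Definition pow2V (l : nat) : R := (2%:R ^- l)%R.

Lemma pow2V_gt0 l : (0 < pow2V l)%R.
Proof. by rewrite invr_gt0 exprn_gt0. Qed.

Lemma pow2VS l : pow2V l = (pow2V l.+1 + pow2V l.+1)%R.
Proof.
rewrite /pow2V exprS; have : (2%:R ^+ l != 0 :> R)%R by rewrite expf_neq0 ?pnatr_eq0.
by move=> h; field.
Qed.

(** What the greedy binary expansion of [x] leaves after [l] bits. *)
Fixpoint bit_rem (x : R) (l : nat) : R := if l is l'.+1 then
  (bit_rem x l' - if pow2V l'.+1 <= bit_rem x l' then pow2V l'.+1 else 0)%R else x.

Definition bit (x : R) (l : nat) : bool := (pow2V l.+1 <= bit_rem x l)%R.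

Definition bit_sum (b : nat -> bool) (L : nat) : R :=
  (\sum_(l < L) if b l then pow2V l.+1 else 0)%R.

(** The upper bound is attained at [x = 1], whose greedy expansion consists of ones only. *)
Lemma bit_rem_itv x l : (0 <= x <= 1)%R -> (0 <= bit_rem x l <= pow2V l)%R.
Proof.
move=> x01; elim: l => [|l]; first by rewrite /= /pow2V expr0 invr1.
rewrite [bit_rem x l.+1]/= (pow2VS l); case: ifPn => [h|]; last rewrite -ltNge => h; lra.
Qed.

Lemma bit_sumE x L : (bit_sum (bit x) L = x - bit_rem x L)%R.
Proof.
elim: L => [|L ih]; first by rewrite /bit_sum big_ord0 /= subrr.
rewrite /bit_sum big_ord_recr/= -/(bit_sum _ _) ih /bit.
by case: ifPn => _; ring.
Qed.

Lemma bit_sum_close x L : (0 <= x <= 1)%R -> (`|x - bit_sum (bit x) L| <= pow2V L)%R.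
Proof.
move=> x01; have /andP[h1 h2] := bit_rem_itv L x01.
by rewrite bit_sumE subKr ger0_norm.
Qed.

Definition undyadic (b : nat -> bool) : R := limn (bit_sum b).

Lemma bit_sum_incr b L n : (bit_sum b L <= bit_sum b (L + n) <=
  bit_sum b L + (pow2V L - pow2V (L + n)))%R.
Proof.
elim: n => [|n]; first by rewrite addn0; lra.
rewrite addnS /bit_sum big_ord_recr/= -/(bit_sum _ _) -/(bit_sum _ _).
have := pow2V_gt0 (L + n).+1; have := pow2VS (L + n).
by case: (b _); lra.
Qed.

Lemma bit_sum_cvg b : cvgn (bit_sum b).
Proof.
apply: nondecreasing_is_cvgn.
  by move=> m n /subnK <-; rewrite addnC; have /andP[] := bit_sum_incr b m (n - m).
exists 1%R => _ [n _ <-]; have := bit_sum_incr b 0 n; rewrite add0n.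
have -> : bit_sum b 0 = 0%R by rewrite /bit_sum big_ord0.
have -> : pow2V 0 = 1%R by rewrite /pow2V expr0 invr1.
by have := pow2V_gt0 n; lra.
Qed.

Lemma undyadic_itv b L : (bit_sum b L <= undyadic b <= bit_sum b L + pow2V L)%R.
Proof.
apply/andP; split.
  apply: limr_ge; first exact: bit_sum_cvg.
  exists L => // n /= /subnK <-; rewrite addnC.
  by have /andP[] := bit_sum_incr b L (n - L).
apply: limr_le; first exact: bit_sum_cvg.
exists L => // n /= /subnK <-; rewrite addnC.
have := pow2V_gt0 (L + (n - L)).
by have := bit_sum_incr b L (n - L); lra.
Qed.

Lemma undyadic_close b L : (`|undyadic b - bit_sum b L| <= pow2V L)%R.
Proof. by have := undyadic_itv b L; rewrite ler_norml; have := pow2V_gt0 L; lra. Qed.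

Lemma undyadic01 b : (0 <= undyadic b <= 1)%R.
Proof.
by have := undyadic_itv b 0; rewrite /bit_sum big_ord0 add0r /pow2V expr0 invr1.
Qed.

Context {d} {V : measurableType d}.

Lemma measurable_bit_rem (f : V -> R) l : measurable_fun [set: V] f ->
  measurable_fun [set: V] (fun v => bit_rem (f v) l).
Proof.
move=> mf; elim: l => [//|l ih] /=; apply: measurable_funB => //.
by apply: measurable_fun_ifT => //; apply: measurable_fun_ler.
Qed.

Lemma measurable_bit (f : V -> R) l : measurable_fun [set: V] f ->
  measurable [set v | bit (f v) l].
Proof.
move=> mf; rewrite -[X in measurable X]setTI.
have : measurable_fun [set: V] (fun v => bit (f v) l).
  by apply: measurable_fun_ler => //; exact: measurable_bit_rem.
by move/(_ measurableT [set true]); apply.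
Qed.

Lemma measurable_undyadic (b : nat -> V -> bool) :
  (forall l, measurable [set v | b l v]) ->
  measurable_fun [set: V] (fun v => undyadic (b ^~ v)).
Proof.
move=> mb; apply: (measurable_fun_cvg (h := fun L v => bit_sum (b ^~ v) L)).
  move=> L; apply: measurable_sum => l.
  apply: measurable_fun_ifT => //.
  apply: (measurable_fun_bool true).
  rewrite setTI (_ : _ @^-1` _ = [set v | b l v])//.
by move=> v _; exact: bit_sum_cvg.
Qed.

End dyadic_bits.

(** * Integrals of functions of finitely many bits *)

Lemma integral_close {R : realType} {d} {V : measurableType d} (Q : probability V R)
    (a b : V -> R) (e B : R) : measurable_fun [set: V] a -> measurable_fun [set: V] b ->
  (forall v, (0 <= a v)%R) -> (forall v, (0 <= b v)%R) -> (0 <= e)%R ->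
  (forall v, (`|a v - b v| <= e)%R) -> \int[Q]_v (b v)%:E = B%:E ->
  (`|fine (\int[Q]_v (a v)%:E) - B| <= e)%R.
Proof.
move=> ma mb a0 b0 e0 ab bB.
have plus (h : V -> R) : measurable_fun [set: V] h -> (forall v, (0 <= h v)%R) ->
    \int[Q]_v (h v + e)%:E = \int[Q]_v (h v)%:E + e%:E.
  move=> mh h0; rewrite -(integral_cst_probability Q e) -ge0_integralD//.
  - by move=> v _; rewrite lee_fin.
  - exact/measurable_EFinP.
have mE (h : V -> R) : measurable_fun [set: V] h ->
    measurable_fun [set: V] (fun v => (h v + e)%:E).
  by move=> mh; apply/measurable_EFinP; exact: measurable_funD.
have h1 : \int[Q]_v (a v)%:E <= (B + e)%:E.
  rewrite EFinD -bB -plus//; apply: ge0_le_integral => //.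
  - by move=> v _; rewrite lee_fin.
  - exact/measurable_EFinP.
  - exact: mE.
  - by move=> v _; rewrite lee_fin; have := ab v; rewrite ler_norml; lra.
have h2 : B%:E <= \int[Q]_v (a v)%:E + e%:E.
  rewrite -bB -plus//; apply: ge0_le_integral => //.
  - by move=> v _; rewrite lee_fin.
  - exact/measurable_EFinP.
  - exact: mE.
  - by move=> v _; rewrite lee_fin; have := ab v; rewrite ler_norml; lra.
have fi : \int[Q]_v (a v)%:E \is a fin_num.
  rewrite ge0_fin_numE; first exact: le_lt_trans h1 (ltry _).
  by apply: integral_ge0 => v _; rewrite lee_fin.
have [r rE] : exists r, \int[Q]_v (a v)%:E = r%:E.
  by exists (fine (\int[Q]_v (a v)%:E)); rewrite fineK.
move: h1 h2; rewrite rE -EFinD !lee_fin /= ler_norml => h1 h2.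
by apply/andP; split; lra.
Qed.

(** A function of an [m]-bit word is simple, which reduces its measurability and its integral to a
    finite sum. *)
Lemma word_fun_sum {R : realType} {V : Type} (m : nat) (w : V -> seq bool)
    (Phi : seq bool -> R) v : (forall v, size (w v) = m) ->
  Phi (w v) = (\sum_(s : m.-tuple bool) Phi s * \1_[set v | w v = s] v)%R.
Proof.
move=> sw; have st : size (w v) == m by rewrite sw.
rewrite (bigD1 (Tuple st))//= big1 ?addr0.
  by rewrite indicE mem_set// mulr1.
move=> s ns; rewrite indicE memNset ?mulr0//= => ws.
by move/eqP: ns; apply; exact/val_inj.
Qed.

Lemma measurable_word_fun {R : realType} {d} {V : measurableType d} (m : nat)
    (w : V -> seq bool) (Phi : seq bool -> R) : (forall v, size (w v) = m) ->
  (forall s, measurable [set v | w v = s]) ->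
  measurable_fun [set: V] (fun v => Phi (w v)).
Proof.
move=> sw mw; under eq_fun do rewrite (word_fun_sum _ _ sw).
by apply: measurable_sum => s; apply: measurable_funM.
Qed.

Lemma integral_word {R : realType} {d} {V : measurableType d} (Q : probability V R)
    (m : nat) (w : V -> seq bool) (Phi : seq bool -> R) :
  (forall v, size (w v) = m) -> (forall s, measurable [set v | w v = s]) ->
  (forall s, (0 <= Phi s)%R) ->
  \int[Q]_v (Phi (w v))%:E =
  (\sum_(s : m.-tuple bool) Phi s * fine (Q [set v | w v = s]))%R%:E.
Proof.
move=> sw mw Phi0.
under eq_integral do rewrite (word_fun_sum _ _ sw) -sumEFin.
rewrite ge0_integral_sum//; last 2 first.
- by move=> s; apply/measurable_EFinP; apply: measurable_funM.
- by move=> s v _; rewrite lee_fin mulr_ge0.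
rewrite -sumEFin; apply: eq_bigr => s _.
under eq_integral do rewrite EFinM.
rewrite ge0_integralZl ?lee_fin//.
  by rewrite integral_indic// setIT EFinM fineK// fin_num_measure.
exact/measurable_EFinP.
Qed.

Lemma measurable_mkseq {d} {V : measurableType d} (b : nat -> V -> bool) m s :
  (forall j, measurable [set v | b j v]) ->
  measurable [set v | mkseq (b ^~ v) m = s].
Proof.
move=> mb; elim: m s => [|m ih] s.
  have [->|s0] := eqVneq s [::].
    by rewrite (_ : [set _ | _] = setT)//; apply/seteqP; split.
  rewrite (_ : [set _ | _] = set0)//; apply/seteqP; split => // v /= es.
  by rewrite -es eqxx in s0.
rewrite (eq_set (Q := fun v => rcons (mkseq (b ^~ v) m) (b m v) = s)); last first.
  by move=> v; rewrite mkseq_rcons.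
case/lastP: s => [|s c].
  rewrite (_ : [set _ | _] = set0)//; apply/seteqP; split => // v /=.
  by case: (mkseq _ m).
rewrite (_ : [set _ | _] =
    [set v | mkseq (b ^~ v) m = s] `&` [set v | b m v = c]).
  apply: measurableI => //; case: c; first exact: mb.
  rewrite (_ : [set _ | _] = ~` [set v | b m v]); first exact: measurableC.
  by apply/seteqP; split => v /=; case: (b m v).
by apply/seteqP; split => v /= => [/rcons_inj[-> ->]|[-> ->]].
Qed.

Lemma bit_sum01 {R : realType} b L : (0 <= (bit_sum b L : R) <= 1)%R.
Proof.
have := bit_sum_incr (R := R) b 0 L; rewrite add0n.
have -> : bit_sum b 0 = 0%R :> R by rewrite /bit_sum big_ord0.
have -> : pow2V 0 = 1%R :> R by rewrite /pow2V expr0 invr1.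
by have := pow2V_gt0 (R := R) L; lra.
Qed.

(** * Limits of the laws of sequences of [0, 1]-valued functions *)

Definition cube {R : realType} (x : nat -> R) := forall k, (0 <= x k <= 1)%R.

(** Uniform continuity for the product topology; a single [M] bounds both the number of coordinates
    that matter and the precision, 2^-M, required of them. *)
Definition unif_cont_cube {R : realType} (G : (nat -> R) -> R) := forall e : R, (0 < e)%R ->
  exists M, forall x y, cube x -> cube y ->
  (forall k, (k < M)%N -> (`|x k - y k| <= pow2V M)%R) -> (`|G x - G y| <= e)%R.

Section ultralimit.
Context {R : realType} (F : set_system nat) {FU : UltraFilter F}.
Variables (d : nat -> measure_display) (V : forall n, measurableType (d n))
  (Q : forall n, probability (V n) R) (f : forall n, nat -> V n -> R).
Arguments f : clear implicits.
Hypotheses (mf : forall n k, measurable_fun [set: V n] (f n k))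
  (f01 : forall n v, cube (f n ^~ v)).

(** The array formed by bit [l] of coordinate [k] is laid out as one sequence by [pickle]; positions
    that code no pair carry [false]. *)
Definition code_bit n (j : nat) (v : V n) : bool :=
  if (unpickle j : option (nat * nat)) is Some kl then bit (f n kl.1 v) kl.2 else false.

Definition code_word n m (v : V n) := mkseq (code_bit (n := n) ^~ v) m.

Lemma measurable_code_word n m s : measurable [set v | code_word (n := n) m v = s].
Proof.
apply: measurable_mkseq => j; rewrite /code_bit.
case: (unpickle j : option (nat * nat)) => [[k l]|]; first exact: measurable_bit.
by rewrite (_ : [set _ | _] = set0)//; apply/seteqP; split.
Qed.

Definition word_mass n s : R := fine (Q n [set v | code_word (size s) v = s]).

Let word_mass01 s n : (0 <= word_mass n s <= 1)%R.
Proof.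
rewrite /word_mass fine_ge0//= -lee_fin fineK ?fin_num_measure//.
- exact/probability_le1/measurable_code_word.
- exact: measurable_code_word.
Qed.

Let lim_mass s : exists l : R, word_mass n s @[n --> F] --> l.
Proof. by have [l _ h] := ultra_bounded_cvg FU (word_mass01 s); exists l. Qed.

Definition word_lim s : R := sval (cid (lim_mass s)).

Lemma word_lim_cvg s : word_mass n s @[n --> F] --> word_lim s.
Proof. by rewrite /word_lim; case: cid. Qed.

Let FP : ProperFilter F. Proof. exact: ultra_proper. Qed.

Lemma word_lim_ge0 s : (0 <= word_lim s)%R.
Proof.
have [l /andP[l0 _] h] := ultra_bounded_cvg FU (word_mass01 s).
by rewrite (cvg_unique _ (@word_lim_cvg s) h).
Qed.

Lemma word_lim_nil : word_lim [::] = 1%R.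
Proof.
apply: (cvg_unique _ (@word_lim_cvg [::])) => //.
apply: cvg_near_cst; apply: nearW => n; rewrite /word_mass.
rewrite (_ : [set _ | _] = setT); last by apply/seteqP; split.
by rewrite probability_setT.
Qed.

Lemma word_lim_rcons s :
  (word_lim s = word_lim (rcons s false) + word_lim (rcons s true))%R.
Proof.
have massS n : word_mass n s = (word_mass n (rcons s false) + word_mass n (rcons s true))%R.
  have mc m t := @measurable_code_word n m t.
  rewrite /word_mass !size_rcons -fineD; [|exact: fin_num_measure..].
  congr fine; rewrite -measureU//.
    congr (Q n _); rewrite (eq_set (P := fun v => code_word _ v = rcons s false)
      (Q := fun v => rcons (code_word (size s) v) (code_bit (size s) v) = rcons s false)); last first.
      by move=> v; rewrite -mkseq_rcons.
    rewrite (eq_set (P := fun v => code_word _ v = rcons s true)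
      (Q := fun v => rcons (code_word (size s) v) (code_bit (size s) v) = rcons s true)); last first.
      by move=> v; rewrite -mkseq_rcons.
    apply/seteqP; split => v /=; last by move=> [|] /rcons_inj[].
    by move=> ->; case: (code_bit _ v); [right|left].
  by apply/seteqP; split => // v /= [-> /rcons_inj[]].
apply: (cvg_unique _ (@word_lim_cvg s)) => //.
rewrite (_ : (fun n => word_mass n s) =
  (fun n => word_mass n (rcons s false) + word_mass n (rcons s true))%R).
  by apply: cvgD; exact: word_lim_cvg.
by apply/funext => n; exact: massS.
Qed.

(* Under the uniform law on [0, 1], [lim_fun] has the limit along [F] of the laws of
   the sequences [f n] in [0, 1]^nat: these are coded as sequences of bits, and the
   bits of the limit have word probabilities [word_lim]. *)
Definition lim_fun (k : nat) (w : R) : R :=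
  undyadic (fun l => word_bit word_lim (pickle (k, l)) w).

Let limQ : probability (measurableTypeR R) R := uniform_prob (@ltr01 R).

Lemma lim_fun01 w : cube (lim_fun ^~ w).
Proof. by move=> k; exact: undyadic01. Qed.

Lemma measurable_lim_fun k : measurable_fun [set: measurableTypeR R] (lim_fun k).
Proof.
by apply: measurable_undyadic => l; exact: measurable_word_bit.
Qed.

(** Both integrals are finite sums over words, and the mass of each word converges by the choice of
    [word_lim]. *)
Lemma word_cvg m (Phi : seq bool -> R) : (forall s, (0 <= Phi s)%R) ->
  fine (\int[Q n]_v (Phi (code_word m v))%:E) @[n --> F] -->
  fine (\int[limQ]_w (Phi (word word_lim m w))%:E).
Proof.
move=> Phi0; rewrite (integral_word _ (m := m))//; last 2 first.
- by move=> w; exact: size_word.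
- by move=> s; exact: measurable_word.
rewrite /= (_ : (fun n => _) = fun n =>
    (\sum_(s : m.-tuple bool) Phi s * word_mass n s)%R); last first.
  apply/funext => n; rewrite (integral_word _ (m := m))//=.
  - by apply: eq_bigr => s _; rewrite /word_mass size_tuple.
  - by move=> v; exact: size_mkseq.
  - by move=> s; exact: measurable_code_word.
apply: cvg_big => [|s _]; first exact: add_continuous.
apply: cvgMl_tmp.
have := word_prob word_lim_ge0 word_lim_nil word_lim_rcons (size_tuple s).
by move=> /(congr1 fine) /= ->; exact: word_lim_cvg.
Qed.

(** Up to [e / 3], [G] is a function of [M] bits of [M] coordinates, hence of a finite word, to
    which [word_cvg] applies. *)
Lemma ultralimit_cvg (G : (nat -> R) -> R) : unif_cont_cube G ->
  (forall x, cube x -> (0 <= G x)%R) ->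
  (forall n, measurable_fun [set: V n] (fun v => G (f n ^~ v))) ->
  measurable_fun [set: measurableTypeR R] (fun w => G (lim_fun ^~ w)) ->
  fine (\int[Q n]_v (G (f n ^~ v))%:E) @[n --> F] -->
  fine (\int[limQ]_w (G (lim_fun ^~ w))%:E).
Proof.
move=> Gc G0 mG mGl; apply/cvgrPdist_le => e e0.
have e3 : (0 < e / 3%:R)%R by rewrite divr_gt0.
have [M HM] := Gc _ e3.
(* Long enough for the word to contain bit [l] of coordinate [k] for all [k, l < M]. *)
pose m := (\max_(k < M) \max_(l < M) pickle (k : nat, l : nat)).+1.
have ltm k l : (k < M)%N -> (l < M)%N -> (pickle (k, l) < m)%N.
  move=> kM lM; rewrite ltnS.
  apply: leq_trans (leq_bigmax (Ordinal kM)).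
  exact: (leq_bigmax (F := fun l : 'I_M => pickle (k, l : nat)) (Ordinal lM)).
(* Decodes a word into a point of the cube. Coordinates from [M] on change [G] by no more than the
   tolerated error and are set to 0. *)
pose z (s : seq bool) (k : nat) : R :=
  if (k < M)%N then bit_sum (fun l => nth false s (pickle (k, l))) M else 0%R.
have z01 s : cube (z s).
  by move=> k; rewrite /z; case: ifPn => _; [exact: bit_sum01|rewrite lexx ler01].
pose Phi s := G (z s).
have Phi0 s : (0 <= Phi s)%R by exact: G0.
have zE (b : nat -> bool) k : (k < M)%N ->
    z (mkseq b m) k = bit_sum (fun l => b (pickle (k, l))) M.
  move=> kM; rewrite /z kM; apply: eq_bigr => l _.
  by rewrite nth_mkseq// ltm.
have close n v : (`|G (f n ^~ v) - Phi (code_word m v)| <= e / 3%:R)%R.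
  apply: HM => [||k kM]; [exact: f01|exact: z01|rewrite zE// (_ : (fun l => _) = bit (f n k v))]; last first.
    by apply/funext => l; rewrite /code_bit pickleK.
  by apply: bit_sum_close; exact: f01.
have closel w : (`|G (lim_fun ^~ w) - Phi (word word_lim m w)| <= e / 3%:R)%R.
  apply: HM => //; first exact: lim_fun01.
  by move=> k kM; rewrite word_mkseq zE//; exact: undyadic_close.
have mPhi n : measurable_fun [set: V n] (fun v => Phi (code_word m v)).
  apply: measurable_word_fun => [v|t]; first exact: size_mkseq.
  exact: measurable_code_word.
have mPhil : measurable_fun [set: measurableTypeR R] (fun w => Phi (word word_lim m w)).
  apply: measurable_word_fun => [v|t]; first exact: size_word.
  exact: measurable_word.
have e30 := ltW e3.
have intPhi n : \int[Q n]_v (Phi (code_word m v))%:E =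
    (fine (\int[Q n]_v (Phi (code_word m v))%:E))%:E.
  rewrite (integral_word _ (m := m))//; first by move=> v; exact: size_mkseq.
  by move=> t; exact: measurable_code_word.
have intPhil : \int[limQ]_w (Phi (word word_lim m w))%:E =
    (fine (\int[limQ]_w (Phi (word word_lim m w))%:E))%:E.
  rewrite (integral_word _ (m := m))//; first by move=> v; exact: size_word.
  by move=> t; exact: measurable_word.
have /cvgrPdist_le /(_ _ e3) := @word_cvg m Phi Phi0; apply: filterS => n h.
have h1 := integral_close (mG n) (mPhi n) (fun v => G0 _ (@f01 n v))
  (fun v => Phi0 _) e30 (close n) (intPhi n).
have h2 := integral_close mGl mPhil (fun w => G0 _ (lim_fun01 w))
  (fun v => Phi0 _) e30 closel intPhil.
move: h h1 h2; set a := fine _; set b := fine _; set a' := fine _; set b' := fine _.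
by rewrite !ler_norml; lra.
Qed.

End ultralimit.

(** * A modulus of continuity for [- x ln x] *)

Section eta_modulus.
Context {R : realType}.
Implicit Types x y h t : R.

Definition eta x : R := (- (x * ln x))%R.

Lemma eta_ge0 x : (0 <= x <= 1)%R -> (0 <= eta x)%R.
Proof. by move=> x01; rewrite -lee_fin; exact: negxlnx_ge0. Qed.

Lemma eta_subadd x h : (0 <= x)%R -> (0 <= h)%R -> (eta (x + h) <= eta x + eta h)%R.
Proof.
rewrite le_eqVlt => /predU1P[<-|x0]; first by rewrite /eta mul0r oppr0 !add0r.
rewrite le_eqVlt => /predU1P[<-|h0]; first by rewrite /eta mul0r oppr0 !addr0.
have lx : (ln x <= ln (x + h))%R by rewrite ler_ln ?posrE ?addr_gt0// lerDl ltW.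
have lh : (ln h <= ln (x + h))%R by rewrite ler_ln ?posrE ?addr_gt0// lerDr ltW.
by rewrite /eta; nra.
Qed.

(** Gibbs' inequality for [x] against [x + h], followed by [ln (x + h) <= 0]. *)
Lemma eta_le_add x h : (0 <= x)%R -> (0 <= h)%R -> (x + h <= 1)%R ->
  (eta x <= eta (x + h) + h)%R.
Proof.
move=> x0 h0 xh1.
have xh : (0 < x -> 0 < x + h)%R by move=> x0'; exact: ltr_wpDr.
have := gibbs x0 (addr_ge0 x0 h0) xh; rewrite /eta.
have : (ln (x + h) <= 0)%R by exact: ln_le0.
by nra.
Qed.

(** With [s] the square root, [eta h = 2 * s * eta s], and Gibbs' inequality for [s] against 1 gives
    [eta s <= 1 - s]. *)
Lemma eta_le_sqrt h : (0 <= h <= 1)%R -> (eta h <= 2 * Num.sqrt h)%R.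
Proof.
move=> /andP[h0 h1]; set s := Num.sqrt h.
have s0 : (0 <= s)%R by exact: sqrtr_ge0.
have hE : h = (s * s)%R by rewrite -expr2 sqr_sqrtr.
have := gibbs s0 ler01 (fun=> ltr01); rewrite ln1 oppr0 mulr0 add0r => g.
move: s0; rewrite le_eqVlt => /predU1P[s0|s0].
  by rewrite hE -s0 /eta !mul0r oppr0 mulr0.
by rewrite /eta hE lnM ?posrE//; nra.
Qed.

(** From the smaller to the larger point, [eta] rises by at most [eta (x - y)] and falls by at most
    [x - y]. The distance is bounded by a square in order to absorb the square root. *)
Lemma eta_modulus x y t : (0 <= x <= 1)%R -> (0 <= y <= 1)%R -> (0 <= t <= 1)%R ->
  (`|x - y| <= t * t)%R -> (`|eta x - eta y| <= 2 * t)%R.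
Proof.
wlog yx : x y / (y <= x)%R.
  move=> W x01 y01 t01; have [yx|/ltW xy] := leP y x; first exact: W.
  by rewrite (distrC x) (distrC (eta x)); exact: W.
move=> x01 y01 /andP[t0 t1]; rewrite ger0_norm ?subr_ge0// => xyt.
have h0 : (0 <= x - y)%R by rewrite subr_ge0.
have h1 : (x - y <= 1)%R by lra.
have xE : x = (y + (x - y))%R by ring.
have y0 : (0 <= y)%R by lra.
have e1 : (eta x <= eta y + eta (x - y))%R by rewrite {1}xE; exact: eta_subadd.
have e2 : (eta y <= eta x + (x - y))%R by rewrite {1}xE; apply: eta_le_add => //; lra.
have e3 : (eta (x - y) <= 2 * Num.sqrt (x - y))%R by apply: eta_le_sqrt; rewrite h0 h1.
have e4 : (Num.sqrt (x - y) <= t)%R.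
  by rewrite -[leRHS]ger0_norm// -sqrtr_sqr ler_sqrt ?expr2// mulr_ge0.
have e5 : (x - y <= t)%R by apply: le_trans xyt _; rewrite ler_piMl.
by rewrite ler_norml; apply/andP; split; lra.
Qed.

End eta_modulus.

(** * Uniformly continuous functions on the cube *)

Section unif_cont_cube_theory.
Context {R : realType}.
Implicit Types G : (nat -> R) -> R.

Lemma pow2V_le m n : (m <= n)%N -> (pow2V n <= pow2V m :> R)%R.
Proof. by move=> mn; rewrite lef_pV2 ?posrE ?exprn_gt0// ler_eXn2l// ltr1n. Qed.

Lemma pow2V_small (e : R) : (0 < e)%R -> exists M, (pow2V M <= e)%R.
Proof.
move=> e0; pose M := Num.bound e^-1; exists M.
rewrite invf_ple ?posrE ?exprn_gt0//.
apply: (@le_trans _ _ M%:R%R); first by apply/ltW/archi_boundP; rewrite invr_ge0 ltW.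
by rewrite -natrX ler_nat; exact/ltnW/ltn_expl.
Qed.

Lemma unif_cont_mono G : unif_cont_cube G -> forall e : R, (0 < e)%R ->
  exists M, forall M', (M <= M')%N -> forall x y, cube x -> cube y ->
  (forall k, (k < M')%N -> (`|x k - y k| <= pow2V M')%R) -> (`|G x - G y| <= e)%R.
Proof.
move=> Gc e /Gc[M HM]; exists M => M' MM' x y cx cy h; apply: HM => // k kM.
by apply: le_trans (h _ (leq_trans kM MM')) _; exact: pow2V_le.
Qed.

Lemma unif_cont_coord k : unif_cont_cube (fun x : nat -> R => x k).
Proof.
move=> e /pow2V_small[M HM]; exists (maxn M k.+1) => x y _ _ h.
apply: (le_trans (h k _)); first by rewrite leq_max leqnn orbT.
by apply: le_trans HM; apply: pow2V_le; rewrite leq_maxl.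
Qed.

Lemma unif_cont_cst c : unif_cont_cube (fun=> c : R).
Proof. by move=> e e0; exists 0%N => x y _ _ _; rewrite subrr normr0 ltW. Qed.

Lemma unif_cont_eta k : unif_cont_cube (fun x : nat -> R => eta (x k)).
Proof.
move=> e e0; have /pow2V_small[M HM] : (0 < e / 2)%R by rewrite divr_gt0.
(* The precision 2^-(M+M) is the square that [eta_modulus] asks for; [k.+1] puts coordinate [k]
   among the controlled ones. *)
exists (maxn (M + M) k.+1) => x y cx cy h.
apply: (@le_trans _ _ (2 * pow2V M)%R); last by lra.
have p1 : (pow2V M <= 1 :> R)%R by have := pow2V_le (leq0n M); rewrite {2}/pow2V expr0 invr1.
apply: eta_modulus => //; first by rewrite (ltW (pow2V_gt0 M)).
apply: (le_trans (h k _)); first by rewrite leq_max leqnn orbT.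
apply: (@le_trans _ _ (pow2V (M + M))); first by apply: pow2V_le; rewrite leq_maxl.
by rewrite /pow2V exprD invfM.
Qed.

Lemma unif_cont_add G H : unif_cont_cube G -> unif_cont_cube H ->
  unif_cont_cube (fun x => G x + H x)%R.
Proof.
move=> Gc Hc e e0; have e2 : (0 < e / 2)%R by rewrite divr_gt0.
have [M HM] := unif_cont_mono Gc e2; have [N HN] := unif_cont_mono Hc e2.
exists (maxn M N) => x y cx cy h.
have := HM _ (leq_maxl M N) _ _ cx cy h; have := HN _ (leq_maxr M N) _ _ cx cy h.
by rewrite !ler_norml => /andP[? ?] /andP[? ?]; apply/andP; split; lra.
Qed.

Lemma unif_cont_opp G : unif_cont_cube G -> unif_cont_cube (fun x => - G x)%R.
Proof.
move=> Gc e /Gc[M HM]; exists M => x y cx cy /(HM _ _ cx cy).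
by rewrite -opprD normrN.
Qed.

Lemma unif_cont_max0 G : unif_cont_cube G -> unif_cont_cube (fun x => Num.max (G x) 0)%R.
Proof.
move=> Gc e /Gc[M HM]; exists M => x y cx cy /(HM _ _ cx cy).
rewrite !ler_norml => /andP[? ?].
by rewrite /Num.max; case: ltP => ?; case: ltP => ?; apply/andP; split; lra.
Qed.

Lemma unif_cont_sum (a : nat -> nat) N :
  unif_cont_cube (fun x : nat -> R => \sum_(j < N) x (a j))%R.
Proof.
elim: N => [|N ih].
  by under eq_fun do rewrite big_ord0; exact: unif_cont_cst.
under eq_fun do rewrite big_ord_recr/=.
by apply: unif_cont_add => //; exact: unif_cont_coord.
Qed.

End unif_cont_cube_theory.

(* Tannery's theorem along a filter. *)
Lemma nneseries_dominated_cvg {R : realType} {I : Type} (F : set_system I)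
    (a : I -> nat -> \bar R) (b l : nat -> \bar R) : Filter F ->
  (forall n i, 0 <= a n i <= b i) -> (forall i, 0 <= l i <= b i) ->
  \sum_(i <oo) b i < +oo ->
  (forall i, fine (a n i) @[n --> F] --> fine (l i)) ->
  fine (\sum_(i <oo) a n i) @[n --> F] --> fine (\sum_(i <oo) l i).
Proof.
move=> FF ab lb boo al.
have b0 i : 0 <= b i by have /andP[h1 h2] := lb i; exact: le_trans h1 h2.
have bfin i : b i \is a fin_num.
  by rewrite ge0_fin_numE//; apply: le_lt_trans boo; exact: nneseries_term_le.
have tail_fin (c : nat -> \bar R) N : (forall i, 0 <= c i <= b i) ->
    \sum_(N <= i <oo) c i <= \sum_(N <= i <oo) b i /\
    \sum_(i <oo) c i = (\sum_(i < N) fine (c i))%R%:E + \sum_(N <= i <oo) c i.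
  move=> cb; split; first by apply: lee_nneseries => i *; have /andP[] := cb i.
  rewrite (nneseries_split _ N); last by move=> k _; have /andP[] := cb k.
  rewrite add0n big_mkord -sumEFin; congr (_ + _); apply: eq_bigr => i _.
  have /andP[c0 cbi] := cb i; rewrite fineK// ge0_fin_numE//.
  by apply: le_lt_trans cbi _; rewrite -ge0_fin_numE.
apply/cvgrPdist_le => e e0.
have e3 : (0 < e / 3%:R)%R by rewrite divr_gt0.
have [N tN] : exists N, \sum_(N <= i <oo) b i <= (e / 3%:R)%:E.
  have := nneseries_tail_cvg boo (fun k _ => b0 k).
  move/fine_cvgP => [[N1 _ fN] /cvgrPdist_le /(_ _ e3)[N2 _ hN]].
  exists (maxn N1 N2); rewrite -[leLHS]fineK; last by apply: fN; exact: leq_maxl.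
  rewrite lee_fin; have := hN _ (leq_maxr N1 N2); rewrite /= sub0r normrN.
  by apply: le_trans; exact: ler_norm.
have part : \forall n \near F,
    (`|\sum_(i < N) fine (l i) - \sum_(i < N) fine (a n i)| <= e / 3%:R)%R.
  have : (\sum_(i < N) fine (a n i))%R @[n --> F] --> (\sum_(i < N) fine (l i))%R.
    by apply: cvg_big => [|i _]; [exact: add_continuous|exact: al].
  by move/cvgrPdist_le => /(_ _ e3).
have split (c : nat -> \bar R) : (forall i, 0 <= c i <= b i) ->
    exists r : R, (0 <= r <= e / 3%:R)%R /\
    fine (\sum_(i <oo) c i) = (\sum_(i < N) fine (c i) + r)%R.
  move=> cb; have [h1 ->] := tail_fin c N cb.
  have t0 : 0 <= \sum_(N <= i <oo) c i.
    by apply: nneseries_ge0 => i *; have /andP[] := cb i.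
  have tf : \sum_(N <= i <oo) c i \is a fin_num.
    by rewrite ge0_fin_numE//; apply: le_lt_trans (le_trans h1 tN) (ltry _).
  exists (fine (\sum_(N <= i <oo) c i)); rewrite fineD// fine_ge0//=; split => //.
  by rewrite -lee_fin fineK//; exact: le_trans h1 tN.
apply: filterS part => n; rewrite ler_norml => /andP[? ?].
have [r [/andP[? ?] ->]] := split l lb; have [r' [/andP[? ?] ->]] := split (a n) (ab n).
by rewrite ler_norml; apply/andP; split; lra.
Qed.

(** * Integrals, entropies and sums in the limit *)

Section limit_functions.
Context {R : realType} (F : set_system nat) {FU : UltraFilter F}.
Variables (d : nat -> measure_display) (V : forall n, measurableType (d n))
  (Q : forall n, probability (V n) R) (f : forall n, nat -> V n -> R).
Arguments f : clear implicits.
Hypotheses (mf : forall n k, measurable_fun [set: V n] (f n k))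
  (f01 : forall n v, cube (f n ^~ v)).

Let FP : ProperFilter F. Proof. exact: ultra_proper. Qed.

Let g : nat -> R -> R := lim_fun (FU := FU) Q mf.
Let limQ : probability (measurableTypeR R) R := uniform_prob (@ltr01 R).

Let aeF : Filter (almost_everywhere limQ).
Proof. exact: ae_filter_ringOfSetsType. Qed.
Let mg k : measurable_fun [set: measurableTypeR R] (g k).
Proof. exact: measurable_lim_fun. Qed.
Let g01 w : cube (g ^~ w). Proof. exact: lim_fun01. Qed.
Let g0 k w : (0 <= g k w)%R. Proof. by case/andP: (g01 w k). Qed.

Lemma lim_fun_integral k (c : R) : (forall n, \int[Q n]_v (f n k v)%:E = c%:E) ->
  \int[limQ]_w (g k w)%:E = c%:E.
Proof.
move=> fc; have := @ultralimit_cvg R F FU d V Q f mf f01 _ (unif_cont_coord (R := R) k).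
move=> /(_ (fun x cx => proj1 (elimT andP (cx k))) (fun n => @mf n k) (mg k)).
under eq_fun do rewrite fc /=.
move=> h; have fi : \int[limQ]_w (g k w)%:E \is a fin_num.
  rewrite ge0_fin_numE; last by apply: integral_ge0 => w _; rewrite lee_fin.
  apply: (@le_lt_trans _ _ (\int[limQ]_w 1%:E)); last first.
    by rewrite integral_cst_probability ltry.
  apply: ge0_le_integral => //.
  - by move=> w _; rewrite lee_fin.
  - exact/measurable_EFinP.
  - by move=> w _; rewrite lee_fin; case/andP: (g01 w k).
by rewrite -(fineK fi); congr EFin; apply: (cvg_unique _ h) => //; exact: cvg_cst.
Qed.

Lemma lim_fun_entropy k :
  fine (\int[Q n]_v negxlnx (f n k v)) @[n --> F] -->
  fine (\int[limQ]_w negxlnx (g k w)).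
Proof.
apply: (@ultralimit_cvg R F FU d V Q f mf f01 _ (unif_cont_eta (R := R) k)).
- by move=> x cx; exact: eta_ge0.
- by move=> n; exact/measurable_EFinP/measurable_negxlnx.
- exact/measurable_EFinP/measurable_negxlnx.
Qed.

Section sums.
Variables (a : nat -> nat) (c : (nat -> R) -> R).
Hypotheses (uc : unif_cont_cube c) (c0 : forall x, cube x -> (0 <= c x)%R)
  (mc : forall n, measurable_fun [set: V n] (fun v => c (f n ^~ v)))
  (mcg : measurable_fun [set: measurableTypeR R] (fun w => c (g ^~ w))).
Hypothesis sumf : forall n, {ae Q n, forall v,
  \sum_(j <oo) (f n (a j) v)%:E = (c (f n ^~ v))%:E}.

(** The amount by which a partial sum exceeds its intended total. Unlike the whole series it is
    continuous on the cube, so its vanishing passes to the limit. *)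
Let excess N (x : nat -> R) : R := Num.max ((\sum_(j < N) x (a j)) - c x)%R 0%R.

Let excess0 N x : (0 <= excess N x)%R.
Proof. by rewrite le_max lexx orbT. Qed.

Let mexcess N : measurable_fun [set: measurableTypeR R] (fun w => excess N (g ^~ w)).
Proof.
apply: measurable_maxr => //; apply: measurable_funB => //.
by apply: measurable_sum.
Qed.

(** Only partial sums pass to the limit; mass might escape to large indices, so at this stage just
    an inequality survives. *)
Lemma lim_fun_sum_le : {ae limQ, forall w,
  \sum_(j <oo) (g (a j) w)%:E <= (c (g ^~ w))%:E}.
Proof.
have ex N : {ae limQ, forall w, excess N (g ^~ w) = 0%R}.
  have ucN : unif_cont_cube (excess N).
    apply: unif_cont_max0; apply: unif_cont_add; first exact: unif_cont_sum.
    exact: unif_cont_opp.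
  have := @ultralimit_cvg R F FU d V Q f mf f01 _ ucN (fun x _ => excess0 N x) _ (mexcess N).
  have fN0 n : \int[Q n]_v (excess N (f n ^~ v))%:E = 0.
    rewrite -[RHS](integral_cst_probability (Q n) 0%R).
    have mfN : measurable_fun [set: V n] (fun v => (excess N (f n ^~ v))%:E).
      apply/measurable_EFinP; apply: measurable_maxr => //; apply: measurable_funB => //.
      by apply: measurable_sum => j; exact: mf.
    apply: ge0_ae_eq_integral => //.
    - by move=> v _; rewrite lee_fin.
    - apply: filterS (sumf n) => v sv _; congr EFin; apply/max_idPr.
      rewrite subr_le0 -lee_fin -sv -sumEFin -(big_mkord xpredT (fun j => (f n (a j) v)%:E)).
      apply: nneseries_lim_ge => j _.
      by rewrite lee_fin; case/andP: (f01 v (a j)).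
  under eq_fun do rewrite fN0 /=.
  have mfN n : measurable_fun [set: V n] (fun v => excess N (f n ^~ v)).
    apply: measurable_maxr => //; apply: measurable_funB => //.
    by apply: measurable_sum => j; exact: mf.
  move=> /(_ mfN) h; have I0 : 0 <= \int[limQ]_w (excess N (g ^~ w))%:E.
    by apply: integral_ge0 => w _; rewrite lee_fin.
  have fi : \int[limQ]_w (excess N (g ^~ w))%:E \is a fin_num.
    rewrite ge0_fin_numE//.
    apply: (@le_lt_trans _ _ (\int[limQ]_w (N%:R)%:E)); last first.
      by rewrite integral_cst_probability ltry.
    apply: ge0_le_integral => //.
    - by move=> w _; rewrite lee_fin.
    - exact/measurable_EFinP.
    - move=> w _; rewrite lee_fin /excess ge_max ler0n andbT.
      have := c0 (g01 w); have : (\sum_(j < N) g (a j) w <= N%:R)%R; last by lra.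
      apply: (@le_trans _ _ (\sum_(j < N) 1)%R); last by rewrite sumr_const card_ord.
      by apply: ler_sum => j _; case/andP: (g01 w (a j)).
  have z : \int[limQ]_w (excess N (g ^~ w))%:E = 0.
    rewrite -(fineK fi); congr EFin; apply: (cvg_unique _ h) => //; exact: cvg_cst.
  have : ae_eq limQ setT (cst 0) (fun w => (excess N (g ^~ w))%:E).
    apply: ge0_le_integral_eq_ae => //.
    - exact/measurable_EFinP.
    - by move=> w _; rewrite lee_fin.
    - by apply: aeW => w _; rewrite lee_fin.
    - by rewrite integral0 z.
    - by rewrite integral0 ltry.
  by apply: filterS => w /(_ I)[].
have : {ae limQ, forall w, forall N, excess N (g ^~ w) = 0%R} by exact: ae_foralln.
apply: (@filterS _ _ aeF) => w hw; apply: lime_le.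
  by apply: is_cvg_nneseries => j _ _; rewrite lee_fin.
apply: nearW => N; rewrite /= big_mkord sumEFin lee_fin.
by have := hw N; move/max_idPr; rewrite subr_le0.
Qed.

(** No mass escapes: both sides of [lim_fun_sum_le] have the integral [s], because the integral of
    each coordinate is preserved. *)
Lemma lim_fun_sum (r : nat -> R) (s : R) :
  (forall n j, \int[Q n]_v (f n (a j) v)%:E = (r j)%:E) ->
  \int[limQ]_w (c (g ^~ w))%:E = s%:E ->
  \sum_(j <oo) (r j)%:E = s%:E ->
  {ae limQ, forall w, \sum_(j <oo) (g (a j) w)%:E = (c (g ^~ w))%:E}.
Proof.
move=> fr cs rs.
have sE : \int[limQ]_w (\sum_(j <oo) (g (a j) w)%:E) = s%:E.
  rewrite integral_nneseries//; last 2 first.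
  - by move=> j; exact/measurable_EFinP.
  - by move=> j w _; rewrite lee_fin.
  by rewrite -rs; apply: eq_eseriesr => j _; exact: lim_fun_integral.
have : ae_eq limQ setT (fun w => \sum_(j <oo) (g (a j) w)%:E) (fun w => (c (g ^~ w))%:E).
  apply: ge0_le_integral_eq_ae => //.
  - by apply: measurable_nneseries_EFin.
  - exact/measurable_EFinP.
  - by move=> w _; apply: nneseries_ge0 => j *; rewrite lee_fin.
  - by move=> w _; rewrite lee_fin c0.
  - by apply: (@filterS _ _ aeF _ _ _ lim_fun_sum_le).
  - by rewrite sE cs.
  - by rewrite sE ltry.
by apply: (@filterS _ _ aeF) => w; apply.
Qed.

End sums.
End limit_functions.

(** * Limits of posteriors and of their entropies *)

Section posteriors_ultralimit.
Context {R : realType} (F : set_system nat) {FU : UltraFilter F}.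
Variables (p : nat -> nat -> R) (px py : nat -> R).
Variables (d : nat -> measure_display) (V : forall n, measurableType (d n))
  (Q : forall n, probability (V n) R) (g : forall n, nat -> nat -> V n -> R)
  (gx gy : forall n, nat -> V n -> R).
Arguments g : clear implicits.
Arguments gx : clear implicits.
Arguments gy : clear implicits.
Hypothesis post : forall n, posteriors (Q n) p px py (g n) (gx n) (gy n).
Hypothesis H2oo : H2 p < +oo.

(* All posteriors at once, as a single sequence of functions. *)
Let idx : countType := ((nat * nat) + nat + nat)%type.
Let f (n : nat) (k : nat) : V n -> R :=
  match (unpickle k : option idx) with
  | Some (inl (inl ij)) => g n ij.1 ij.2
  | Some (inl (inr i)) => gx n i
  | Some (inr j) => gy n j
  | None => fun=> 0%R
  end.
Arguments f : clear implicits.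
Let kxy (i j : nat) : nat := pickle (inl (inl (i, j)) : idx).
Let kx (i : nat) : nat := pickle (inl (inr i) : idx).
Let ky (j : nat) : nat := pickle (inr j : idx).

Let fxy n i j : f n (kxy i j) = g n i j. Proof. by rewrite /f pickleK. Qed.
Let fx n i : f n (kx i) = gx n i. Proof. by rewrite /f pickleK. Qed.
Let fy n i : f n (ky i) = gy n i. Proof. by rewrite /f pickleK. Qed.

Let mf n k : measurable_fun [set: V n] (f n k).
Proof.
rewrite /f; case: (unpickle k : option idx) => [[[[i j]|i]|j]|].
- exact: (post_m (post n)).
- exact: (post_mx (post n)).
- exact: (post_my (post n)).
- exact: measurable_cst.
Qed.

Let f01 n (v : V n) : cube (fun k => f n k v).
Proof.
move=> k; rewrite /f; case: (unpickle k : option idx) => [[[[i j]|i]|j]|].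
- exact: (post01 (post n)).
- exact: (postx01 (post n)).
- exact: (posty01 (post n)).
- by rewrite lexx ler01.
Qed.

Let l : nat -> R -> R := lim_fun (FU := FU) Q mf.
Let limQ : probability (measurableTypeR R) R := uniform_prob (@ltr01 R).
Let aeF : Filter (almost_everywhere limQ).
Proof. exact: ae_filter_ringOfSetsType. Qed.

Let ml k : measurable_fun [set: measurableTypeR R] (l k).
Proof. exact: measurable_lim_fun. Qed.
Let l01 k w : (0 <= l k w <= 1)%R. Proof. exact: lim_fun01. Qed.

Let int_xy i j : \int[limQ]_w (l (kxy i j) w)%:E = (p i j)%:E.
Proof. by apply: lim_fun_integral => [n v|n]; [exact: f01|rewrite fxy; exact: post_int]. Qed.
Let int_x i : \int[limQ]_w (l (kx i) w)%:E = (px i)%:E.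
Proof. by apply: lim_fun_integral => [n v|n]; [exact: f01|rewrite fx; exact: postx_int]. Qed.
Let int_y i : \int[limQ]_w (l (ky i) w)%:E = (py i)%:E.
Proof. by apply: lim_fun_integral => [n v|n]; [exact: f01|rewrite fy; exact: posty_int]. Qed.

Let sum_coord (a : nat -> nat) k (r : nat -> R) (s : R) :
  (forall n, {ae Q n, forall v, \sum_(j <oo) (f n (a j) v)%:E = (f n k v)%:E}) ->
  (forall n j, \int[Q n]_v (f n (a j) v)%:E = (r j)%:E) ->
  \int[limQ]_w (l k w)%:E = s%:E -> \sum_(j <oo) (r j)%:E = s%:E ->
  {ae limQ, forall w, \sum_(j <oo) (l (a j) w)%:E = (l k w)%:E}.
Proof.
move=> sf fr ls rs.
apply: (@lim_fun_sum R F FU d V Q f mf f01 a (fun x => x k) _ _ _ _ sf r s) => //.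
- exact: unif_cont_coord.
- by move=> x /(_ k)/andP[].
Qed.

Let sum_one (a : nat -> nat) (r : nat -> R) :
  (forall n, {ae Q n, forall v, \sum_(j <oo) (f n (a j) v)%:E = 1}) ->
  (forall n j, \int[Q n]_v (f n (a j) v)%:E = (r j)%:E) ->
  \sum_(j <oo) (r j)%:E = 1 ->
  {ae limQ, forall w, \sum_(j <oo) (l (a j) w)%:E = 1}.
Proof.
move=> sf fr rs.
apply: (@lim_fun_sum R F FU d V Q f mf f01 a (fun=> 1%R) _ _ _ _ sf r 1%R) => //.
- exact: unif_cont_cst.
- exact: integral_cst_probability.
Qed.

Lemma posteriors_limit : posteriors limQ p px py
  (fun i j => l (kxy i j)) (fun i => l (kx i)) (fun j => l (ky j)).
Proof.
have px1 := post_px1 (post 0%N); have py1 := post_px1 (posteriors_swap (post 0%N)).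
have pxE := post_px (post 0%N); have pyE := post_px (posteriors_swap (post 0%N)).
split.
- by move=> i j; exact: ml.
- by move=> i; exact: ml.
- by move=> j; exact: ml.
- by move=> i j w; exact: l01.
- by move=> i w; exact: l01.
- by move=> j w; exact: l01.
- move=> i; apply: (sum_coord (a := kxy i) _ _ (int_x i) (pxE i)).
    by move=> n; rewrite fx; under eq_near do under eq_eseriesr do rewrite fxy;
      exact: (post_row (post n)).
  by move=> n j; rewrite fxy; exact: (post_int (post n)).
- move=> j; apply: (sum_coord (a := kxy ^~ j) _ _ (int_y j) (pyE j)).
    by move=> n; rewrite fy; under eq_near do under eq_eseriesr do rewrite fxy;
      exact: (post_col (post n)).
  by move=> n i; rewrite fxy; exact: (post_int (post n)).
- apply: (sum_one (a := kx) _ _ px1).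
    by move=> n; under eq_near do under eq_eseriesr do rewrite fx; exact: (postx1 (post n)).
  by move=> n j; rewrite fx; exact: (postx_int (post n)).
- apply: (sum_one (a := ky) _ _ py1).
    by move=> n; under eq_near do under eq_eseriesr do rewrite fy; exact: (posty1 (post n)).
  by move=> n j; rewrite fy; exact: (posty_int (post n)).
- exact: int_xy.
- exact: int_x.
- exact: int_y.
Qed.

Let FP : ProperFilter F. Proof. exact: ultra_proper. Qed.

Let H1x : H1 px < +oo. Proof. exact: le_lt_trans (H1_le_H2 (post 0%N)) H2oo. Qed.
Let H1y : H1 py < +oo.
Proof.
apply: le_lt_trans (H1_le_H2 (posteriors_swap (post 0%N))) _.
rewrite /H2 nneseries_interchange// => i j; apply: negxlnx_ge0.
exact: (post_p01 (post 0%N)).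
Qed.

(** Each term converges by continuity of [eta] and is dominated by [negxlnx (px i)] through Jensen's
    inequality. *)
Lemma ent1x_limit :
  fine (ent1 (Q n) (gx n)) @[n --> F] --> fine (ent1 limQ (fun i => l (kx i))).
Proof.
apply: (nneseries_dominated_cvg (b := fun i => negxlnx (px i))) => //.
- move=> n i; rewrite int_negxlnx_ge0/=; last exact: (postx01 (post n)).
  by have [] := integral_negxlnx_le (post_mx (post n) i) (postx01 (post n) i) (postx_int (post n) i).
- move=> i; rewrite int_negxlnx_ge0//=.
  by have [] := integral_negxlnx_le (ml (kx i)) (l01 (kx i)) (int_x i).
- move=> i; under eq_fun do rewrite -fx; apply: lim_fun_entropy => n v; exact: f01.
Qed.

Lemma ent1y_limit :
  fine (ent1 (Q n) (gy n)) @[n --> F] --> fine (ent1 limQ (fun i => l (ky i))).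
Proof.
apply: (nneseries_dominated_cvg (b := fun i => negxlnx (py i))) => //.
- move=> n i; rewrite int_negxlnx_ge0/=; last exact: (posty01 (post n)).
  by have [] := integral_negxlnx_le (post_my (post n) i) (posty01 (post n) i) (posty_int (post n) i).
- move=> i; rewrite int_negxlnx_ge0//=.
  by have [] := integral_negxlnx_le (ml (ky i)) (l01 (ky i)) (int_y i).
- move=> i; under eq_fun do rewrite -fy; apply: lim_fun_entropy => n v; exact: f01.
Qed.

(** Tannery's theorem is used twice, inside each row and then over the rows. *)
Lemma ent2_limit :
  fine (ent2 (Q n) (g n)) @[n --> F] --> fine (ent2 limQ (fun i j => l (kxy i j))).
Proof.
have p0 i j : 0 <= negxlnx (p i j) by exact/negxlnx_ge0/(post_p01 (post 0%N)).
have bf n i j : 0 <= \int[Q n]_v negxlnx (g n i j v) <= negxlnx (p i j).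
  rewrite int_negxlnx_ge0/=; last exact: (post01 (post n)).
  by have [] := integral_negxlnx_le (post_m (post n) i j) (post01 (post n) i j) (post_int (post n) i j).
have bl i j : 0 <= \int[limQ]_w negxlnx (l (kxy i j) w) <= negxlnx (p i j).
  rewrite int_negxlnx_ge0//=.
  by have [] := integral_negxlnx_le (ml (kxy i j)) (l01 (kxy i j)) (int_xy i j).
apply: (nneseries_dominated_cvg (b := fun i => \sum_(j <oo) negxlnx (p i j))) => //.
- move=> n i; apply/andP; split; first by apply: nneseries_ge0 => j *; case/andP: (bf n i j).
  by apply: lee_nneseries => j *; case/andP: (bf n i j).
- move=> i; apply/andP; split; first by apply: nneseries_ge0 => j *; case/andP: (bl i j).
  by apply: lee_nneseries => j *; case/andP: (bl i j).
move=> i; apply: (nneseries_dominated_cvg (b := fun j => negxlnx (p i j))) => //.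
  apply: le_lt_trans H2oo.
  apply: (nneseries_term_le (f := fun i => \sum_(j <oo) negxlnx (p i j)) i) => k.
  exact: nneseries_ge0.
move=> j; under eq_fun do rewrite -fxy; apply: lim_fun_entropy => n v; exact: f01.
Qed.

End posteriors_ultralimit.

(** These are the posteriors of a variable independent of (X, Y). They turn conditional inequalities
    into unconditional ones and yield a U without information. *)
Lemma posteriors_cst {R : realType} {d d'} {V : measurableType d}
    {V' : measurableType d'} (Q : probability V R) (Q' : probability V' R)
    p px py g gx gy : posteriors Q' p px py g gx gy ->
  posteriors Q p px py (fun i j => cst (p i j)) (fun i => cst (px i)) (fun j => cst (py j)).
Proof.
move=> post; have post' := posteriors_swap post; split => //.
- by move=> i j v; exact: (post_p01 post).
- by move=> i v; exact: (post_px01 post).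
- by move=> j v; exact: (post_px01 post').
- by move=> i; apply: aeW => v; exact: (post_px post).
- by move=> j; apply: aeW => v; exact: (post_px post').
- by apply: aeW => v; exact: (post_px1 post).
- by apply: aeW => v; exact: (post_px1 post').
- by move=> i j; exact: integral_cst_probability.
- by move=> i; exact: integral_cst_probability.
- by move=> j; exact: integral_cst_probability.
Qed.

(** * Entropy inequalities and their equality cases for random variables *)

Section chain_rules.
Context {R : realType} {d d1 d2} {W : measurableType d}
  {T1 : measurableType d1} {T2 : measurableType d2} (P : probability W R).
Variables (X : {dRV P >-> T1}) (Y : {dRV P >-> T2}).
Hypotheses (mT1 : forall x : T1, measurable [set x])
  (mT2 : forall y : T2, measurable [set y]).

(** Subadditivity of entropy, obtained from its conditional version with constant posteriors. *)
Lemma joint_entropy_lty : entropy P X < +oo -> entropy P Y < +oo ->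
  entropy P (pair_rv X Y) < +oo.
Proof.
have [D1 atX] := exists_atoms X mT1; have [D2 atY] := exists_atoms Y mT2.
rewrite (entropy_H1x mT1 atX) (entropy_H1y mT2 atY) (entropy_H2 mT1 mT2 atX atY) => HX HY.
have post := posteriors_RV atX atY X.
have triv := posteriors_cst P post.
apply: le_lt_trans (lte_add_pinfty HX HY).
have e1 (q : nat -> R) : ent1 P (fun i => cst (q i)) = H1 q.
  apply: eq_eseriesr => i _.
  exact: (integral_cst_probability P (- (q i * ln (q i)))).
have e2 : ent2 P (fun i j => cst (pmf2 X Y D1 D2 i j)) = H2 (pmf2 X Y D1 D2).
  apply: eq_eseriesr => i _; apply: eq_eseriesr => j _.
  exact: (integral_cst_probability P (- (pmf2 X Y D1 D2 i j * ln (pmf2 X Y D1 D2 i j)))).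
by have := ent2_subadditive triv; rewrite e2 !e1.
Qed.

Section given.
Context {dV} {V : measurableType dV} (U : {RV P >-> V}).
Hypotheses (HX : entropy P X < +oo) (HY : entropy P Y < +oo).

(** After the bounds of conditional by unconditional entropy come the nonnegativity of I(X;Y | U),
    of I(Y;U | X) and of I(X;U | Y), with all terms moved to the side where they are added. *)
Lemma cond_entropy_facts :
  [/\ 0 <= cond_entropy P (pair_rv X Y) U <= entropy P (pair_rv X Y),
      0 <= cond_entropy P X U <= entropy P X,
      0 <= cond_entropy P Y U <= entropy P Y,
      cond_entropy P (pair_rv X Y) U <= cond_entropy P X U + cond_entropy P Y U &
      entropy P X + cond_entropy P (pair_rv X Y) U <=
        entropy P (pair_rv X Y) + cond_entropy P X U /\
      entropy P Y + cond_entropy P (pair_rv X Y) U <=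
        entropy P (pair_rv X Y) + cond_entropy P Y U].
Proof.
have := joint_entropy_lty HX HY; move: HX HY.
have [D1 atX] := exists_atoms X mT1; have [D2 atY] := exists_atoms Y mT2.
rewrite (entropy_H1x mT1 atX) (entropy_H1y mT2 atY) (entropy_H2 mT1 mT2 atX atY).
rewrite (cond_entropy_ent2 mT1 mT2 atX atY) (cond_entropy_ent1x mT1 atX).
rewrite (cond_entropy_ent1y mT2 atY) => H1oo H1yoo H2oo.
have post := posteriors_RV atX atY U.
have post' := posteriors_swap post.
have ent2_swap : ent2 (distribution P U) (fun j i => gp2 X Y D1 D2 U i j) =
    ent2 (distribution P U) (gp2 X Y D1 D2 U).
  apply: (@nneseries_interchange _ (fun j i => \int[distribution P U]_v
    negxlnx (gp2 X Y D1 D2 U i j v)) xpredT xpredT) => i j.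
  by apply: int_negxlnx_ge0; exact: (post01 post).
have H2_swap : H2 (fun j i => pmf2 X Y D1 D2 i j) = H2 (pmf2 X Y D1 D2).
  apply: (@nneseries_interchange _ (fun j i => negxlnx (pmf2 X Y D1 D2 i j))
    xpredT xpredT) => i j.
  exact/negxlnx_ge0/(post_p01 post).
split.
- rewrite (ent2_le post) andbT; apply: nneseries_ge0 => i *; apply: nneseries_ge0 => j *.
  by apply: int_negxlnx_ge0; exact: (post01 post).
- rewrite (ent1_le post) andbT; apply: nneseries_ge0 => i *.
  by apply: int_negxlnx_ge0; exact: (postx01 post).
- rewrite (ent1_le post') andbT; apply: nneseries_ge0 => i *.
  by apply: int_negxlnx_ge0; exact: (posty01 post).
- exact: (ent2_subadditive post).
split; first exact: (ent_cond_le post).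
by rewrite -ent2_swap -H2_swap; apply: (ent_cond_le post'); rewrite H2_swap.
Qed.

Lemma markov_XUY_entropy : markov_chain P X U Y <->
  cond_entropy P (pair_rv X Y) U = cond_entropy P X U + cond_entropy P Y U.
Proof.
have := joint_entropy_lty HX HY.
have [D1 atX] := exists_atoms X mT1; have [D2 atY] := exists_atoms Y mT2.
rewrite (entropy_H2 mT1 mT2 atX atY) => H2oo.
rewrite (cond_entropy_ent2 mT1 mT2 atX atY) (cond_entropy_ent1x mT1 atX).
rewrite (cond_entropy_ent1y mT2 atY) (markov_XUY atX atY U).
have post := posteriors_RV atX atY U.
by rewrite (ent2_eq_additive post)// (le_lt_trans (ent2_le post)).
Qed.

Lemma markov_YXU_entropy : markov_chain P Y X U <->
  entropy P X + cond_entropy P (pair_rv X Y) U =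
  entropy P (pair_rv X Y) + cond_entropy P X U.
Proof.
have := joint_entropy_lty HX HY.
have [D1 atX] := exists_atoms X mT1; have [D2 atY] := exists_atoms Y mT2.
rewrite (entropy_H2 mT1 mT2 atX atY) (entropy_H1x mT1 atX) => H2oo.
rewrite (cond_entropy_ent2 mT1 mT2 atX atY) (cond_entropy_ent1x mT1 atX).
rewrite (markov_YXU atX atY U).
have post := posteriors_RV atX atY U.
by rewrite (ent_cond_eq post).
Qed.

End given.
End chain_rules.

(** * Exchanging the two variables, and conditioning on one of them *)

Section symmetric_chain_rules.
Context {R : realType} {d d1 d2} {W : measurableType d}
  {T1 : measurableType d1} {T2 : measurableType d2} (P : probability W R).
Variables (X : {dRV P >-> T1}) (Y : {dRV P >-> T2}).
Hypotheses (mT1 : forall x : T1, measurable [set x])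
  (mT2 : forall y : T2, measurable [set y]).

Lemma entropy_swap : entropy P (pair_rv Y X) = entropy P (pair_rv X Y).
Proof.
have [D1 atX] := exists_atoms X mT1; have [D2 atY] := exists_atoms Y mT2.
rewrite (entropy_H2 mT1 mT2 atX atY) (entropy_H2 mT2 mT1 atY atX).
apply: (etrans (@nneseries_interchange _ (fun j i => negxlnx (pmf2 Y X D2 D1 j i))
    xpredT xpredT _)).
  move=> j i; exact/negxlnx_ge0/(post_p01 (posteriors_RV atY atX X)).
by apply: eq_eseriesr => i _; apply: eq_eseriesr => j _; rewrite /pmf2 setIC.
Qed.

Lemma cond_entropy_swap {dV} {V : measurableType dV} (U : {RV P >-> V}) :
  cond_entropy P (pair_rv Y X) U = cond_entropy P (pair_rv X Y) U.
Proof.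
have [D1 atX] := exists_atoms X mT1; have [D2 atY] := exists_atoms Y mT2.
rewrite (cond_entropy_ent2 mT1 mT2 atX atY) (cond_entropy_ent2 mT2 mT1 atY atX).
apply: (etrans (@nneseries_interchange _ (fun j i => \int[distribution P U]_v
    negxlnx (gp2 Y X D2 D1 U j i v)) xpredT xpredT _)).
  by move=> j i; apply: int_negxlnx_ge0; exact: (post01 (posteriors_RV atY atX U)).
apply: eq_eseriesr => i _; apply: eq_eseriesr => j _.
by apply: eq_integral => v _; rewrite /gp2 setIC.
Qed.

Hypotheses (HX : entropy P X < +oo) (HY : entropy P Y < +oo).

Lemma markov_XYU_entropy {dV} {V : measurableType dV} (U : {RV P >-> V}) :
  markov_chain P X Y U <->
  entropy P Y + cond_entropy P (pair_rv X Y) U =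
  entropy P (pair_rv X Y) + cond_entropy P Y U.
Proof.
by rewrite -entropy_swap -cond_entropy_swap; exact: (markov_YXU_entropy mT2 mT1).
Qed.

(* Conditioning on [Y] itself: both Markov chains degenerate. *)
Lemma cond_entropy_RV : entropy P Y + cond_entropy P X Y = entropy P (pair_rv X Y).
Proof.
have mk : markov_chain P X (Y : {RV P >-> T2}) Y.
  move=> E F mE mF; have mXE : measurable (X @^-1` E).
    by rewrite -[_ @^-1` _]setTI; exact: measurable_funPT.
  have mY B : measurable B -> measurable (Y @^-1` B).
    by move=> mB; rewrite -[_ @^-1` _]setTI; exact: measurable_funPT.
  have [mc c01 cE] := @cond_probP _ _ _ P _ _ (Y : {RV P >-> T2}) _ mXE.
  have prod : {ae distribution P Y, forall y, cond_prob P (X @^-1` E `&` Y @^-1` F) Y y =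
      (cond_prob P (X @^-1` E) Y y * \1_F y)%R}.
    apply: (@cond_prob_unique _ _ _ P _ _ (Y : {RV P >-> T2})).
    - by apply: measurableI => //; exact: mY.
    - exact: measurable_funM.
    - by move=> y; rewrite mulr_ge0//; case/andP: (c01 y).
    move=> A mA; rewrite -setIA -preimage_setI cE; last exact: measurableI.
    rewrite setIC integral_mkcondr; apply: eq_integral => y _.
    rewrite patchE indicE; case: ifPn => yF; first by rewrite mulr1.
    by rewrite mulr0.
  have ind := @cond_prob_preimage _ _ _ P _ _ (Y : {RV P >-> T2}) _ mF.
  by apply: filterS2 prod ind => y -> ->.
have c0 : cond_entropy P Y (Y : {RV P >-> T2}) = 0.
  have [D2 atY] := exists_atoms Y mT2; rewrite (cond_entropy_ent1y mT2 atY).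
  rewrite /ent1 eseries0// => j _ _.
  rewrite -[RHS](integral_cst_probability (distribution P Y) 0%R).
  have mAy := measurable_atom_y atY j.
  have [mc c01 _] := @cond_probP _ _ _ P _ _ (Y : {RV P >-> T2}) _ mAy.
  apply: ge0_ae_eq_integral => //.
  - exact: measurable_negxlnx.
  - by move=> y _; exact/negxlnx_ge0/c01.
  have := @cond_prob_preimage _ _ _ P _ _ (Y : {RV P >-> T2}) _ (atom_m atY j).
  apply: filterS => y; rewrite /gpy => -> _; rewrite indicE.
  by case: (_ \in _); [exact: negxlnx1|exact: negxlnx0].
have := (markov_XYU_entropy (Y : {RV P >-> T2})).1 mk.
have := (markov_XUY_entropy mT1 mT2 (Y : {RV P >-> T2}) HX HY).1 mk.
by rewrite c0 !adde0 => ->.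
Qed.

End symmetric_chain_rules.

(** * Real-valued entropies of the variables jointly distributed with (X, Y) *)

Section jointly_distributed_entropy.
Context {R : realType} {d d1 d2} {W : measurableType d}
  {T1 : measurableType d1} {T2 : measurableType d2} (P : probability W R).
Variables (X : {dRV P >-> T1}) (Y : {dRV P >-> T2}).

Definition jd_entXY (u : jointly_distributed P X Y) : R :=
  fine (cond_entropy (jd_P u) (pair_rv (jd_X u) (jd_Y u)) (jd_U u)).
Definition jd_entX (u : jointly_distributed P X Y) : R :=
  fine (cond_entropy (jd_P u) (jd_X u) (jd_U u)).
Definition jd_entY (u : jointly_distributed P X Y) : R :=
  fine (cond_entropy (jd_P u) (jd_Y u) (jd_U u)).

Lemma jd_lawX (u : jointly_distributed P X Y) A : measurable A ->
  jd_P u (jd_X u @^-1` A) = P (X @^-1` A).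
Proof.
move=> mA; have := jd_law u (measurableX mA (@measurableT _ T2)).
rewrite (_ : _ @^-1` _ = jd_X u @^-1` A); last first.
  by apply/seteqP; split => w //= -[].
by move=> ->; congr (P _); apply/seteqP; split => w //= -[].
Qed.

Lemma jd_lawY (u : jointly_distributed P X Y) A : measurable A ->
  jd_P u (jd_Y u @^-1` A) = P (Y @^-1` A).
Proof.
move=> mA; have := jd_law u (measurableX (@measurableT _ T1) mA).
rewrite (_ : _ @^-1` _ = jd_Y u @^-1` A); last first.
  by apply/seteqP; split => w //= -[].
by move=> ->; congr (P _); apply/seteqP; split => w //= -[].
Qed.

Hypotheses (mT1 : forall x : T1, measurable [set x])
  (mT2 : forall y : T2, measurable [set y]).

Section fixed_atoms.
Variables (D1 : nat -> set T1) (D2 : nat -> set T2).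
Hypotheses (atX : atoms P X D1) (atY : atoms P Y D2).

Lemma jd_atomsX (u : jointly_distributed P X Y) : atoms (jd_P u) (jd_X u) D1.
Proof. by apply: atoms_transfer atX => A; exact: jd_lawX. Qed.

Lemma jd_atomsY (u : jointly_distributed P X Y) : atoms (jd_P u) (jd_Y u) D2.
Proof. by apply: atoms_transfer atY => A; exact: jd_lawY. Qed.

(** Enumerated by the same atoms, all copies have the same masses, so a whole sequence of variables
    U gives [posteriors] over a single [p]. *)
Lemma jd_pmf2 (u : jointly_distributed P X Y) :
  pmf2 (jd_X u) (jd_Y u) D1 D2 = pmf2 X Y D1 D2.
Proof.
apply/funext => i; apply/funext => j; rewrite /pmf2; congr fine.
have := jd_law u (measurableX (atom_m atX i) (atom_m atY j)).
rewrite (_ : _ @^-1` _ = atom_x (jd_X u) D1 i `&` atom_y (jd_Y u) D2 j)//.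
Qed.

Lemma jd_pmfx (u : jointly_distributed P X Y) : pmfx (jd_X u) D1 = pmfx X D1.
Proof.
apply/funext => i; rewrite /pmfx; congr fine; exact: (jd_lawX u (atom_m atX i)).
Qed.

Lemma jd_pmfy (u : jointly_distributed P X Y) : pmfy (jd_Y u) D2 = pmfy Y D2.
Proof.
apply/funext => i; rewrite /pmfy; congr fine; exact: (jd_lawY u (atom_m atY i)).
Qed.

End fixed_atoms.

Lemma jd_entropyX (u : jointly_distributed P X Y) :
  entropy (jd_P u) (jd_X u) = entropy P X.
Proof.
have [D1 atX] := exists_atoms X mT1.
by rewrite (entropy_H1x mT1 atX) (entropy_H1x mT1 (jd_atomsX atX u)) jd_pmfx.
Qed.

Lemma jd_entropyY (u : jointly_distributed P X Y) :
  entropy (jd_P u) (jd_Y u) = entropy P Y.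
Proof.
have [D2 atY] := exists_atoms Y mT2.
by rewrite (entropy_H1y mT2 atY) (entropy_H1y mT2 (jd_atomsY atY u)) jd_pmfy.
Qed.

Lemma jd_entropyXY (u : jointly_distributed P X Y) :
  entropy (jd_P u) (pair_rv (jd_X u) (jd_Y u)) = HXY P X Y.
Proof.
have [D1 atX] := exists_atoms X mT1; have [D2 atY] := exists_atoms Y mT2.
rewrite /HXY (entropy_H2 mT1 mT2 atX atY).
by rewrite (entropy_H2 mT1 mT2 (jd_atomsX atX u) (jd_atomsY atY u)) jd_pmf2.
Qed.

Hypotheses (HX : entropy P X < +oo) (HY : entropy P Y < +oo).

Lemma entropies_fin : [/\ 0 <= entropy P X, 0 <= entropy P Y & 0 <= HXY P X Y] /\
  [/\ entropy P X \is a fin_num, entropy P Y \is a fin_num & HXY P X Y \is a fin_num].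
Proof.
(* Conditioning on [X] is an arbitrary choice here; nonnegativity follows from 0 <= H(. | X) <=
   H(.). *)
have [a b c _ _] := cond_entropy_facts mT1 mT2 X HX HY.
have le2 (x y : \bar R) : 0 <= x <= y -> 0 <= y by move=> /andP[]; exact: le_trans.
move/le2: a; move/le2: b; move/le2: c => HY0 HX0 HXY0; split => //.
by split; rewrite ge0_fin_numE//; exact: joint_entropy_lty.
Qed.

Let hx := fine (entropy P X).
Let hy := fine (entropy P Y).
Let hxy := fine (HXY P X Y).

Lemma jd_cond_entropy (u : jointly_distributed P X Y) :
  [/\ cond_entropy (jd_P u) (pair_rv (jd_X u) (jd_Y u)) (jd_U u) = (jd_entXY u)%:E,
      cond_entropy (jd_P u) (jd_X u) (jd_U u) = (jd_entX u)%:E &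
      cond_entropy (jd_P u) (jd_Y u) (jd_U u) = (jd_entY u)%:E].
Proof.
have [_ [fX fY fXY]] := entropies_fin.
have HX' : entropy (jd_P u) (jd_X u) < +oo by rewrite jd_entropyX.
have HY' : entropy (jd_P u) (jd_Y u) < +oo by rewrite jd_entropyY.
have := cond_entropy_facts mT1 mT2 (jd_U u) HX' HY'.
rewrite jd_entropyX jd_entropyY jd_entropyXY => -[/andP[a0 a1] /andP[b0 b1] /andP[c0 c1] _ _].
by split; rewrite fineK// ge0_fin_numE//;
  [apply: le_lt_trans a1 _|apply: le_lt_trans b1 _|apply: le_lt_trans c1 _];
  rewrite ltey_eq ?fXY ?fX ?fY.
Qed.

Lemma jd_infoE (u : jointly_distributed P X Y) : jd_info u = (hxy - jd_entXY u)%:E.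
Proof.
have [a _ _] := jd_cond_entropy u; have [_ [_ _ f]] := entropies_fin.
by rewrite /jd_info /mutual_info jd_entropyXY a -(fineK f).
Qed.

Lemma jd_entropy_bounds (u : jointly_distributed P X Y) :
  [/\ (0 <= jd_entXY u <= hxy)%R, (0 <= jd_entX u <= hx)%R, (0 <= jd_entY u <= hy)%R,
      (jd_entXY u <= jd_entX u + jd_entY u)%R &
      (hx + jd_entXY u <= hxy + jd_entX u)%R /\
      (hy + jd_entXY u <= hxy + jd_entY u)%R].
Proof.
have [_ [fX fY fXY]] := entropies_fin.
have HX' : entropy (jd_P u) (jd_X u) < +oo by rewrite jd_entropyX.
have HY' : entropy (jd_P u) (jd_Y u) < +oo by rewrite jd_entropyY.
have := cond_entropy_facts mT1 mT2 (jd_U u) HX' HY'.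
rewrite jd_entropyX jd_entropyY jd_entropyXY.
have [-> -> ->] := jd_cond_entropy u.
by rewrite -(fineK fX) -(fineK fY) -(fineK fXY) -!EFinD !lee_fin.
Qed.

Lemma jd_markov_XUY (u : jointly_distributed P X Y) :
  markov_chain (jd_P u) (jd_X u) (jd_U u) (jd_Y u) <->
  jd_entXY u = (jd_entX u + jd_entY u)%R.
Proof.
have HX' : entropy (jd_P u) (jd_X u) < +oo by rewrite jd_entropyX.
have HY' : entropy (jd_P u) (jd_Y u) < +oo by rewrite jd_entropyY.
rewrite (markov_XUY_entropy mT1 mT2 (jd_U u) HX' HY').
have [-> -> ->] := jd_cond_entropy u; rewrite -EFinD.
by split => [[]|->].
Qed.

Lemma jd_markov_YXU (u : jointly_distributed P X Y) :
  markov_chain (jd_P u) (jd_Y u) (jd_X u) (jd_U u) <->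
  (hx + jd_entXY u = hxy + jd_entX u)%R.
Proof.
have [_ [fX fY fXY]] := entropies_fin.
have HX' : entropy (jd_P u) (jd_X u) < +oo by rewrite jd_entropyX.
have HY' : entropy (jd_P u) (jd_Y u) < +oo by rewrite jd_entropyY.
rewrite (markov_YXU_entropy mT1 mT2 (jd_U u) HX' HY') jd_entropyX jd_entropyXY.
have [-> -> _] := jd_cond_entropy u.
rewrite -(fineK fX) -(fineK fXY) -!EFinD.
by split => [[]|->].
Qed.

Lemma jd_markov_XYU (u : jointly_distributed P X Y) :
  markov_chain (jd_P u) (jd_X u) (jd_Y u) (jd_U u) <->
  (hy + jd_entXY u = hxy + jd_entY u)%R.
Proof.
have [_ [fX fY fXY]] := entropies_fin.
have HX' : entropy (jd_P u) (jd_X u) < +oo by rewrite jd_entropyX.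
have HY' : entropy (jd_P u) (jd_Y u) < +oo by rewrite jd_entropyY.
rewrite (markov_XYU_entropy mT1 mT2 HX' HY' (jd_U u)) jd_entropyY jd_entropyXY.
have [-> _ ->] := jd_cond_entropy u.
rewrite -(fineK fY) -(fineK fXY) -!EFinD.
by split => [[]|->].
Qed.

(** [IXY] is H(X) - H(X | Y) by definition; the chain rule [cond_entropy_RV] makes it symmetric. *)
Lemma IXYE : IXY P X Y = (hx + hy - hxy)%:E.
Proof.
have [_ [fX fY fXY]] := entropies_fin.
rewrite /IXY /mutual_info; have := cond_entropy_RV mT1 mT2 HX HY.
rewrite -/(HXY P X Y) -(fineK fXY) -(fineK fX) -(fineK fY).
case: (cond_entropy P X Y) => [r| |]//=; rewrite -EFinD => -[h].
by rewrite -EFinB; congr EFin; rewrite /hx /hy /hxy -h; ring.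
Qed.

(** U is the identity of the sample space: it determines every event, so that all posteriors are
    indicators. *)
Lemma exists_jd_full : exists u : jointly_distributed P X Y,
  [/\ jd_entXY u = 0%R, jd_entX u = 0%R & jd_entY u = 0%R].
Proof.
pose U : {RV P >-> W} := HB.pack (@idfun W)
  (isMeasurableFun.Build _ _ _ _ (@idfun W) (@measurable_id _ _ setT)).
pose u : jointly_distributed P X Y :=
  @JointlyDistributed _ _ _ _ _ _ _ P X Y _ W P X Y (fun A _ => erefl) _ W U.
exists u.
have z E : measurable E -> \int[distribution P U]_v negxlnx (cond_prob P E U v) = 0.
  move=> mE; rewrite -[RHS](integral_cst_probability (distribution P U) 0%R).
  have [mc c01 _] := cond_probP U mE.
  apply: ge0_ae_eq_integral => //.
  - exact: measurable_negxlnx.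
  - by move=> y _; exact/negxlnx_ge0/c01.
  apply: filterS (cond_prob_preimage U mE) => v; rewrite preimage_id => -> _.
  by rewrite indicE; case: (_ \in _); [exact: negxlnx1|exact: negxlnx0].
have [D1 atX] := exists_atoms X mT1; have [D2 atY] := exists_atoms Y mT2.
rewrite /jd_entXY /jd_entX /jd_entY /=.
rewrite (cond_entropy_ent2 mT1 mT2 atX atY) (cond_entropy_ent1x mT1 atX).
rewrite (cond_entropy_ent1y mT2 atY) /ent2 /ent1.
split; rewrite eseries0//.
- move=> i _ _; rewrite eseries0// => j _ _; apply: z.
  exact: (measurable_atom_xy atX atY).
- by move=> i _ _; apply: z; exact: (measurable_atom_x atX).
- by move=> i _ _; apply: z; exact: (measurable_atom_y atY).
Qed.

(** Constant posteriors, that is, a U independent of the pair, play the role of a constant U. *)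
Lemma exists_jd_trivial :
  exists u : jointly_distributed P X Y,
  [/\ jd_entXY u = hxy, jd_entX u = hx & jd_entY u = hy].
Proof.
have [D1 atX] := exists_atoms X mT1; have [D2 atY] := exists_atoms Y mT2.
have triv := posteriors_cst P (posteriors_RV atX atY X).
have [u [ua ub uc]] := exists_realization mT1 mT2 atX atY triv; exists u.
have e (c : R) : \int[P]_v negxlnx (cst c v) = negxlnx c.
  exact: (integral_cst_probability P (- (c * ln c))).
rewrite /jd_entXY /jd_entX /jd_entY ua ub uc /hxy /hx /hy /HXY.
rewrite (entropy_H2 mT1 mT2 atX atY) (entropy_H1x mT1 atX) (entropy_H1y mT2 atY).
split; congr fine.
- by apply: eq_eseriesr => i _; apply: eq_eseriesr => j _; exact: e.
- by apply: eq_eseriesr => i _; exact: e.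
- by apply: eq_eseriesr => i _; exact: e.
Qed.

(** The posteriors of the [u n] have a limit along an ultrafilter, realized by [v]. No subsequence
    is extracted, hence a conclusion at arbitrarily large indices. *)
Lemma jd_compact (u : nat -> jointly_distributed P X Y) :
  exists v : jointly_distributed P X Y,
  forall (e : R) (N : nat), (0 < e)%R -> exists2 n, (N <= n)%N &
  [/\ (`|jd_entXY v - jd_entXY (u n)| <= e)%R, (`|jd_entX v - jd_entX (u n)| <= e)%R &
      (`|jd_entY v - jd_entY (u n)| <= e)%R].
Proof.
have [D1 atX] := exists_atoms X mT1; have [D2 atY] := exists_atoms Y mT2.
(* The ultrafilter contains all eventual sets, which is what allows the index to be taken beyond
   [N]. *)
have [F [FU ooF]] := ultraFilterLemma (@eventually_filter).
have FP : ProperFilter F by exact: ultra_proper.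
pose Q n : probability (jd_V (u n)) R := distribution (jd_P (u n)) (jd_U (u n)).
have post n : posteriors (Q n) (pmf2 X Y D1 D2) (pmfx X D1) (pmfy Y D2)
    (gp2 (jd_X (u n)) (jd_Y (u n)) D1 D2 (jd_U (u n)))
    (gpx (jd_X (u n)) D1 (jd_U (u n))) (gpy (jd_Y (u n)) D2 (jd_U (u n))).
  rewrite -(jd_pmf2 atX atY (u n)) -(jd_pmfx atX (u n)) -(jd_pmfy atY (u n)).
  exact: (posteriors_RV (jd_atomsX atX (u n)) (jd_atomsY atY (u n)) (jd_U (u n))).
have H2oo : H2 (pmf2 X Y D1 D2) < +oo.
  rewrite -(entropy_H2 mT1 mT2 atX atY); exact: joint_entropy_lty.
have [v [va vb vc]] := exists_realization mT1 mT2 atX atY (posteriors_limit (FU := FU) post).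
exists v => e N e0.
have ca := ent2_limit (FU := FU) (post := post) H2oo.
have cb := ent1x_limit (FU := FU) (post := post) H2oo.
have cc := ent1y_limit (FU := FU) (post := post) H2oo.
move/cvgrPdist_le : ca => /(_ _ e0) ca.
move/cvgrPdist_le : cb => /(_ _ e0) cb.
move/cvgrPdist_le : cc => /(_ _ e0) cc.
have geN : F [set n | (N <= n)%N] by apply: ooF; exists N.
have [n [[[Nn an] bn] cn]] := filter_ex (filterI (filterI (filterI geN ca) cb) cc).
exists n => //; rewrite /jd_entXY /jd_entX /jd_entY va vb vc.
rewrite (cond_entropy_ent2 mT1 mT2 (jd_atomsX atX (u n)) (jd_atomsY atY (u n))).
rewrite (cond_entropy_ent1x mT1 (jd_atomsX atX (u n))).
rewrite (cond_entropy_ent1y mT2 (jd_atomsY atY (u n))).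
by split; [exact: an|exact: bn|exact: cn].
Qed.

End jointly_distributed_entropy.

(** * Convexity of the region and its half-spaces *)

Section gray_wyner_geometry.
Context {R : realType} {d d1 d2} {W : measurableType d}
  {T1 : measurableType d1} {T2 : measurableType d2} (P : probability W R).
Variables (X : {dRV P >-> T1}) (Y : {dRV P >-> T2}).
Let G := gray_wyner P X Y.

Lemma gray_wyner_convex (x1 x2 x3 y1 y2 y3 t : R) : (0 <= t <= 1)%R ->
  G (x1, x2, x3) -> G (y1, y2, y3) ->
  G (t * x1 + (1 - t) * y1, t * x2 + (1 - t) * y2, t * x3 + (1 - t) * y3)%R.
Proof.
move=> t01 Gx Gy D DP; have [[_ cD] _] := DP.
have Dx := mem_set (Gx D DP); have Dy := mem_set (Gy D DP).
by have := cD _ _ (Itv01 (proj1 (elimT andP t01)) (proj2 (elimT andP t01))) Dx Dy; rewrite inE.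
Qed.

(** A half-space is closed and convex, so it contains the hull as soon as it contains the rate
    triples. All lower bounds on the region are obtained in this way. *)
Lemma gray_wyner_halfspace (a b c m : R) :
  (forall x1 x2 x3 : R, rate_triples P X Y (x1, x2, x3) ->
    (m <= a * x1 + b * x2 + c * x3)%R) ->
  forall x1 x2 x3 : R, G (x1, x2, x3) -> (m <= a * x1 + b * x2 + c * x3)%R.
Proof.
move=> h; pose L (r : R^o * R^o * R^o) : R^o := (a * r.1.1 + b * r.1.2 + c * r.2)%R.
suff GL : G `<=` [set r | (m <= L r)%R] by move=> x1 x2 x3; exact: GL.
apply: smallest_sub => [|[[x1 x2] x3]]; last exact: h.
split.
  apply: (@preimage_closed _ _ L [set x | (m <= x)%R]); last exact: closed_ge.
  move=> r _; rewrite /L; apply: cvgD; [apply: cvgD|]; apply: cvgMl_tmp.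
  - exact: (cvg_comp _ _ cvg_fst cvg_fst).
  - exact: (cvg_comp _ _ cvg_fst cvg_snd).
  - exact: cvg_snd.
apply/convex_setW => x y; rewrite !inE => hx hy k k0 k1.
have {}hx : (m <= L x)%R by [].
have {}hy : (m <= L y)%R by [].
apply/mem_set.
change (m <= a * (k%:num * x.1.1 + (1 - k%:num) * y.1.1) +
    b * (k%:num * x.1.2 + (1 - k%:num) * y.1.2) +
    c * (k%:num * x.2 + (1 - k%:num) * y.2))%R.
rewrite [leRHS](_ : _ = (k%:num * L x + (1 - k%:num) * L y)%R); last by rewrite /L; ring.
by nra.
Qed.

End gray_wyner_geometry.

(** * Right derivatives of extended-valued functions *)

Section right_derivative.
Context {R : realType} (f : R -> \bar R) (x L : R).
Hypothesis L0 : (0 < L)%R.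

Let near_itv (F : R -> Prop) : (forall h, (0 < h < L)%R -> F h) ->
  \forall h \near 0%R^'+, F h.
Proof.
move=> h; near=> e; apply: h; apply/andP; split; near: e.
  exact: nbhs_right_gt.
exact: nbhs_right_lt.
Unshelve. all: by end_near. Qed.

(** If [f x] is infinite then so is every difference quotient, also when [f (x + h)] is infinite, as
    opposite infinities add up to -oo in [\bar R]. *)
Lemma right_derivative_fin (l : R) : is_right_derivative f x l -> f x \is a fin_num.
Proof.
move=> /fine_cvgP[+ _] => fin; have [h [hfin h0]] := filter_ex (filterI fin
  (near_itv (F := fun h => (0 < h)%R) (fun h hL => proj1 (elimT andP hL)))).
apply: contraTT hfin; case: (f x) => [//| |] _; case: (f (x + h)) => [r| |] //=;
  by rewrite /= ?gt0_muleNy ?gt0_mulye ?gt0_mulNye// lte_fin invr_gt0.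
Qed.

Lemma right_derivative_le (y c l : R) : f x = y%:E ->
  (forall h, (0 < h < L)%R -> f (x + h)%R <= (y + c * h)%:E) ->
  is_right_derivative f x l -> (l <= c)%R.
Proof.
move=> fx fh; move=> /cvge_to_le h; rewrite -lee_fin; apply: h.
apply: near_itv => h hL; have := fh h hL; rewrite fx.
have h0 : (0 < h)%R by case/andP: hL.
rewrite -lee_pdivlMr ?invr_gt0//.
by rewrite leeBlDr// -EFinM -EFinD invrK addrC => /le_trans; apply; rewrite lee_fin addrC.
Qed.

Lemma right_derivative_ge (y c l : R) : f x = y%:E ->
  (forall h, (0 < h < L)%R -> (y + c * h)%:E <= f (x + h)%R) ->
  is_right_derivative f x l -> (c <= l)%R.
Proof.
move=> fx fh; move=> /cvge_to_ge h; rewrite -lee_fin; apply: h.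
apply: near_itv => h hL; have := fh h hL; rewrite fx.
have h0 : (0 < h)%R by case/andP: hL.
rewrite -lee_pdivrMr ?invr_gt0//.
by rewrite leeBrDr// -EFinM -EFinD invrK addrC.
Qed.

Lemma right_derivative_affine (y c : R) : f x = y%:E ->
  (forall h, (0 < h < L)%R -> f (x + h)%R = (y + c * h)%:E) ->
  is_right_derivative f x c.
Proof.
move=> fx fh; apply: cvg_near_cst; apply: near_itv => h hL.
rewrite fh// fx -EFinB -EFinM; congr EFin; rewrite addrC addKr mulfK//.
by case/andP: hL => h0 _; rewrite gt_eqF.
Qed.

End right_derivative.

(** * Real inequalities behind the penalization *)

Section arithmetic.
Context {R : realFieldType}.
Implicit Types k z h a b g x : R.
Local Open Scope ring_scope.

(** In the lemmas on triples with a [g], [h] stands for H(X,Y) and [g], [a], [b] for H(X,Y | U), H(X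
    | U), H(Y | U), so that [h - g] is I(X,Y;U); [k] is the penalty. *)
Lemma sum_arith h a b g x1 x2 x3 :
  h - g <= x1 -> a <= x2 -> b <= x3 -> g <= a + b -> h <= x1 + x2 + x3.
Proof. by lra. Qed.

Lemma marginal_arith h1 h a g x1 x2 :
  h - g <= x1 -> a <= x2 -> h1 + g <= h + a -> h1 <= x1 + x2.
Proof. by lra. Qed.

Lemma wyner_arith k z h a b g x1 x2 x3 : 0 <= k ->
  h - g <= x1 -> a <= x2 -> b <= x3 -> z <= k * (a + b - g) + (h - g) ->
  z + k * h <= (k + 1) * x1 + k * x2 + k * x3.
Proof.
move=> k0 h1 h2 h3; have := ler_wpM2l k0 h1; have := ler_wpM2l k0 h2.
by have := ler_wpM2l k0 h3; lra.
Qed.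

Lemma gacs_korner_arith k z hx hy h a b g x1 x2 x3 : 0 <= 2 * k - 1 -> 0 <= k ->
  h - g <= x1 -> a <= x2 -> b <= x3 ->
  z <= k * (2 * (h - g) + a + b - hx - hy) - (h - g) ->
  z + k * (hx + hy) <= (2 * k - 1) * x1 + k * x2 + k * x3.
Proof.
move=> k1 k0 h1 h2 h3; have := ler_wpM2l k1 h1; have := ler_wpM2l k0 h2.
by have := ler_wpM2l k0 h3; lra.
Qed.

(* The error [V * V], [V = k^-1], is still small once multiplied by the penalty [k]. *)
Lemma wyner_contra k V c h r0 r1 r2 : 0 < k -> 0 < V -> k * V = 1 -> V <= 1 ->
  c + 3 * V + k * h <= (k + 1) * r0 + k * r1 + k * r2 ->
  r0 + r1 + r2 <= h + V * V -> r0 <= c + V * V -> False.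
Proof.
move=> k0 V0 kV V1 half s0 rc.
have VV : V * V <= V by rewrite ler_piMl// ltW.
have := ler_wpM2l (ltW k0) s0; rewrite [leRHS]mulrDr (mulrA k V) kV mul1r.
by clear -VV V0 half rc; lra.
Qed.

Lemma gacs_korner_contra k V c h r0 r1 r2 : 0 < k -> 0 < V -> k * V = 1 -> V <= 1 ->
  - c + 3 * V + k * h <= (2 * k - 1) * r0 + k * r1 + k * r2 ->
  2 * r0 + r1 + r2 <= h + V * V -> c - V * V <= r0 -> False.
Proof.
move=> k0 V0 kV V1 half s0 rc.
have VV : V * V <= V by rewrite ler_piMl// ltW.
have := ler_wpM2l (ltW k0) s0; rewrite [leRHS]mulrDr (mulrA k V) kV mul1r.
by clear -VV V0 half rc; lra.
Qed.

Lemma wyner_approx p q e c h g g' : 0 <= p -> p + (h - g') <= c + q -> `|g - g'| <= e ->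
  h - g - c <= q + 1 * e.
Proof. by rewrite ler_norml => ? ? /andP[? ?]; lra. Qed.

Lemma gacs_korner_approx p q e c h g g' : 0 <= p ->
  p - (h - g') <= - c + q -> `|g - g'| <= e -> c - (h - g) <= q + 1 * e.
Proof. by rewrite ler_norml => ? ? /andP[? ?]; lra. Qed.

Lemma wyner_slack p c h g V : V <= 1 ->
  p + (h - g) <= c + 3 * V -> g <= h -> p <= `|c| + 3.
Proof. by have := ler_norm c; lra. Qed.

Lemma gacs_korner_slack p c h g V : V <= 1 ->
  p - (h - g) <= - c + 3 * V -> 0 <= g -> p <= h + `|c| + 3.
Proof. by have := ler_norm (- c); rewrite normrN; lra. Qed.

Lemma sum_approx q e a a' b b' g g' : a' + b' - g' <= q ->
  `|g - g'| <= e -> `|a - a'| <= e -> `|b - b'| <= e -> a + b - g <= q + 3 * e.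
Proof. by rewrite !ler_norml => ? /andP[? ?] /andP[? ?] /andP[? ?]; lra. Qed.

Lemma double_approx q e h k l a a' b b' g g' : 2 * (h - g') + a' + b' - k - l <= q ->
  `|g - g'| <= e -> `|a - a'| <= e -> `|b - b'| <= e ->
  2 * (h - g) + a + b - k - l <= q + 4 * e.
Proof. by rewrite !ler_norml => ? /andP[? ?] /andP[? ?] /andP[? ?]; lra. Qed.

End arithmetic.

(** * Points of the two faces are attained by a single U *)

Section faces.
Context {R : realType} {d d1 d2} {W : measurableType d}
  {T1 : measurableType d1} {T2 : measurableType d2} (P : probability W R).
Variables (X : {dRV P >-> T1}) (Y : {dRV P >-> T2}).
Hypotheses (mT1 : forall x : T1, measurable [set x])
  (mT2 : forall y : T2, measurable [set y]).
Hypotheses (HX : entropy P X < +oo) (HY : entropy P Y < +oo).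

Let hx := fine (entropy P X).
Let hy := fine (entropy P Y).
Let hxy := fine (HXY P X Y).
Let G := gray_wyner P X Y.

Let bounds u := jd_entropy_bounds mT1 mT2 HX HY u.

Lemma rate_triplesE (x1 x2 x3 : R) :
  rate_triples P X Y (x1, x2, x3) <-> exists u : jointly_distributed P X Y,
  [/\ (hxy - jd_entXY u <= x1)%R, (jd_entX u <= x2)%R & (jd_entY u <= x3)%R].
Proof.
split=> -[u]; have [_ eX eY] := jd_cond_entropy mT1 mT2 HX HY u => -[h1 h2 h3]; exists u.
  by move: h1 h2 h3; rewrite (jd_infoE mT1 mT2 HX HY) eX eY !lee_fin.
by rewrite (jd_infoE mT1 mT2 HX HY) eX eY !lee_fin.
Qed.

Lemma gray_wyner_jd (u : jointly_distributed P X Y) :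
  G (hxy - jd_entXY u, jd_entX u, jd_entY u)%R.
Proof. by apply: sub_gen_smallest; apply/rate_triplesE; exists u. Qed.

Lemma gray_wyner_full : G (hxy, 0, 0)%R.
Proof.
have [u [a b c]] := exists_jd_full X Y mT1 mT2.
by have := gray_wyner_jd u; rewrite a b c subr0.
Qed.

Lemma gray_wyner_trivial : G (0, hx, hy)%R.
Proof.
have [u [a b c]] := exists_jd_trivial X Y mT1 mT2.
by have := gray_wyner_jd u; rewrite a b c subrr.
Qed.

Lemma gray_wyner_sum (r0 r1 r2 : R) : G (r0, r1, r2) -> (hxy <= r0 + r1 + r2)%R.
Proof.
move=> Gr; have := gray_wyner_halfspace (a := 1) (b := 1) (c := 1) (m := hxy) _ Gr.
rewrite !mul1r; apply=> x1 x2 x3 /rate_triplesE[u [h1 h2 h3]]; rewrite !mul1r.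
by have [_ _ _ h4 _] := bounds u; exact: sum_arith h1 h2 h3 h4.
Qed.

Lemma gray_wyner_X (r0 r1 r2 : R) : G (r0, r1, r2) -> (hx <= r0 + r1)%R.
Proof.
move=> Gr; have := gray_wyner_halfspace (a := 1) (b := 1) (c := 0) (m := hx) _ Gr.
rewrite !mul1r mul0r addr0; apply=> x1 x2 x3 /rate_triplesE[u [h1 h2 _]].
rewrite !mul1r mul0r addr0.
by have [_ _ _ _ [h4 _]] := bounds u; exact: marginal_arith h1 h2 h4.
Qed.

Lemma gray_wyner_Y (r0 r1 r2 : R) : G (r0, r1, r2) -> (hy <= r0 + r2)%R.
Proof.
move=> Gr; have := gray_wyner_halfspace (a := 1) (b := 0) (c := 1) (m := hy) _ Gr.
rewrite !mul1r mul0r addr0; apply=> x1 x2 x3 /rate_triplesE[u [h1 _ h3]].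
rewrite !mul1r mul0r addr0.
by have [_ _ _ _ [_ h4]] := bounds u; exact: marginal_arith h1 h3 h4.
Qed.

Let K n : R := n.+1%:R.
Let K1 n : (1 <= K n)%R. Proof. by rewrite ler1n. Qed.

Let KV n : [/\ (0 < K n)%R, (0 < (K n)^-1)%R, (K n * (K n)^-1 = 1)%R & ((K n)^-1 <= 1)%R].
Proof.
have k0 : (0 < K n)%R by rewrite ltr0n.
by split; rewrite ?invr_gt0// ?divff ?gt_eqF// invf_le1.
Qed.

(** With [e = x / (2 * (D + 1))] and [N] large, both errors together would stay below a positive
    [x]. *)
Let vanish (x C D : R) : (0 <= C)%R -> (0 <= D)%R ->
  (forall (e : R) N, (0 < e)%R ->
    exists2 n, (N <= n)%N & (x <= C / K n + D * e)%R) -> (x <= 0)%R.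
Proof.
move=> C0 D0 h; rewrite leNgt; apply/negP => x0.
have [N hN] : exists N, (C < K N * (x / 2))%R.
  exists (Num.bound (C / (x / 2))); rewrite -ltr_pdivrMr ?divr_gt0//.
  apply: lt_le_trans (archi_boundP _) _; first by rewrite divr_ge0// divr_ge0// ltW.
  by rewrite ler_nat.
have D1 : (0 < 2 * (D + 1))%R by rewrite mulr_gt0// ltr_wpDl.
have [|n Nn hn] := h (x / (2 * (D + 1)))%R N; first by rewrite divr_gt0.
have Kn0 : (0 < K n)%R by rewrite ltr0n.
have KNn : (K N <= K n)%R by rewrite ler_nat.
have e1 : (C / K n < x / 2)%R.
  rewrite ltr_pdivrMr// mulrC; apply: lt_le_trans hN _.
  by rewrite ler_wpM2r// divr_ge0// ltW.
have e2 : (D * (x / (2 * (D + 1))) <= x / 2)%R.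
  rewrite mulrA ler_pdivrMr//; nra.
by move: hn; rewrite leNgt => /negP; apply; rewrite [ltRHS]splitr ltr_leD.
Qed.

(* Minimizing [K * (r0 + r1 + r2 - hxy) + r0] over the region amounts to
   minimizing [K * I(X;Y|U) + I(X,Y;U)] over U; K tends to infinity. *)
Lemma wyner_face (c : R) :
  (forall e : R, (0 < e)%R -> exists r0 r1 r2 : R, [/\ G (r0, r1, r2),
    (r0 + r1 + r2 <= hxy + e)%R & (r0 <= c + e)%R]) ->
  exists u : jointly_distributed P X Y,
    (jd_entXY u = jd_entX u + jd_entY u)%R /\ (hxy - jd_entXY u <= c)%R.
Proof.
move=> face.
(* Otherwise the opposite inequality would hold for every U, hence on the whole region as a
   half-space. But a point within K^-2 of the face exceeds [c] by at most K * K^-2 + K^-2 <= 2 / K,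
   which is less than 3 / K. *)
have /choice[u uP] n : exists u : jointly_distributed P X Y,
    (K n * (jd_entX u + jd_entY u - jd_entXY u) + (hxy - jd_entXY u) <= c + 3 / K n)%R.
  apply: contrapT => nu; have k1 := K1 n; have [k0 kV kK kV1] := KV n.
  have e0 : (0 < (K n)^-1 * (K n)^-1)%R by rewrite mulr_gt0.
  have [r0 [r1 [r2 [Gr s0 rc]]]] := face _ e0.
  have half (x1 x2 x3 : R) : rate_triples P X Y (x1, x2, x3) ->
    (c + 3 / K n + K n * hxy <=
      (K n + 1) * x1 + K n * x2 + K n * x3)%R.
    move=> /rate_triplesE[u [h1 h2 h3]].
    have hu : (c + 3 / K n <
        K n * (jd_entX u + jd_entY u - jd_entXY u) + (hxy - jd_entXY u))%R.
      by rewrite ltNge; apply/negP => h; apply: nu; exists u.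
    exact: wyner_arith (ltW k0) h1 h2 h3 (ltW hu).
  exact: wyner_contra k0 kV kK kV1 (gray_wyner_halfspace half Gr) s0 rc.
have [v vP] := jd_compact mT1 mT2 HX HY u; exists v.
have Ile : (hxy - jd_entXY v - c <= 0)%R.
  apply: (vanish (C := 3) (D := 1)) => // e N e0.
  have [n Nn [ha _ _]] := vP e N e0; exists n => //.
  have [_ _ _ s0 _] := bounds (u n); have [k0 _ _ _] := KV n.
  apply: wyner_approx (uP n) ha; by rewrite mulr_ge0 ?(ltW k0)// subr_ge0.
(* The penalized value is bounded, so I(X;Y | U) is of order 1 / K along the sequence; [D = 3]
   counts the three entropies that are approximated. *)
have sle : (jd_entX v + jd_entY v - jd_entXY v <= 0)%R.
  apply: (vanish (C := (`|c| + 3)%R) (D := 3)) => //.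
  move=> e N e0; have [n Nn [ha hb hc]] := vP e N e0; exists n => //.
  have [/andP[_ a1] _ _ _ _] := bounds (u n); have [k0 kV kK kV1] := KV n.
  apply: sum_approx ha hb hc; rewrite ler_pdivlMr// mulrC.
  exact: wyner_slack kV1 (uP n) a1.
split; last by lra.
by have [_ _ _ s0 _] := bounds v; lra.
Qed.

(** The penalized quantity, [s u] below, is I(Y;U | X) + I(X;U | Y), and K * s - I(X,Y;U) is
    minimized. The coefficient 2 * K - 1 of the first rate has to be nonnegative, since a rate
    triple only bounds the information from above. *)
Lemma gacs_korner_face (c : R) :
  (forall e : R, (0 < e)%R -> exists r0 r1 r2 : R, [/\ G (r0, r1, r2),
    (2 * r0 + r1 + r2 <= hx + hy + e)%R & (c - e <= r0)%R]) ->
  exists u : jointly_distributed P X Y,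
    [/\ (hx + jd_entXY u = hxy + jd_entX u)%R, (hy + jd_entXY u = hxy + jd_entY u)%R &
      (c <= hxy - jd_entXY u)%R].
Proof.
move=> face.
pose s (u : jointly_distributed P X Y) :=
  (2 * (hxy - jd_entXY u) + jd_entX u + jd_entY u - hx - hy)%R.
have s0 u : (0 <= s u)%R.
  by have [_ _ _ _ [h1 h2]] := bounds u; rewrite /s; rewrite -/hx -/hy -/hxy in h1 h2; lra.
have /choice[u uP] n : exists u : jointly_distributed P X Y,
    (K n * s u - (hxy - jd_entXY u) <= - c + 3 / K n)%R.
  apply: contrapT => nu; have k1 := K1 n; have [k0 kV kK kV1] := KV n.
  have e0 : (0 < (K n)^-1 * (K n)^-1)%R by rewrite mulr_gt0.
  have [r0 [r1 [r2 [Gr sr rc]]]] := face _ e0.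
  have half (x1 x2 x3 : R) : rate_triples P X Y (x1, x2, x3) ->
    (- c + 3 / K n + K n * (hx + hy) <=
      (2 * K n - 1) * x1 + K n * x2 + K n * x3)%R.
    move=> /rate_triplesE[u [h1 h2 h3]].
    have hu : (- c + 3 / K n < K n * s u - (hxy - jd_entXY u))%R.
      by rewrite ltNge; apply/negP => h; apply: nu; exists u.
    rewrite /s in hu.
    have k2 : (0 <= 2 * K n - 1)%R by lra.
    exact: gacs_korner_arith k2 (ltW k0) h1 h2 h3 (ltW hu).
  exact: gacs_korner_contra k0 kV kK kV1 (gray_wyner_halfspace half Gr) sr rc.
have [v vP] := jd_compact mT1 mT2 HX HY u; exists v.
have Ile : (c - (hxy - jd_entXY v) <= 0)%R.
  apply: (vanish (C := 3) (D := 1)) => // e N e0.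
  have [n Nn [ha _ _]] := vP e N e0; exists n => //; have [k0 _ _ _] := KV n.
  by apply: gacs_korner_approx (uP n) ha; rewrite mulr_ge0 ?(ltW k0).
have sle : (s v <= 0)%R.
  (* Four errors: the joint conditional entropy enters [s] twice. *)
  apply: (vanish (C := (hxy + `|c| + 3)%R) (D := 4)) => //.
    have [/andP[a0 a1] _ _ _ _] := bounds v.
    by rewrite addr_ge0// addr_ge0// (le_trans a0 a1).
  move=> e N e0; have [n Nn [ha hb hc]] := vP e N e0; exists n => //.
  have [/andP[a0 _] _ _ _ _] := bounds (u n); have [k0 kV kK kV1] := KV n.
  apply: double_approx ha hb hc; rewrite ler_pdivlMr// mulrC.
  exact: gacs_korner_slack kV1 (uP n) a0.
have [_ _ _ _ [h1 h2]] := bounds v; rewrite -/hx -/hy -/hxy in h1 h2.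
by rewrite /s in sle; split; lra.
Qed.

End faces.

(** * Extreme slopes of the functions C and K *)

Section slopes.
Context {R : realType} {d d1 d2} {W : measurableType d}
  {T1 : measurableType d1} {T2 : measurableType d2} (P : probability W R).
Variables (X : {dRV P >-> T1}) (Y : {dRV P >-> T2}).
Hypotheses (mT1 : forall x : T1, measurable [set x])
  (mT2 : forall y : T2, measurable [set y]).
Hypotheses (HX : entropy P X < +oo) (HY : entropy P Y < +oo).

Let hx := fine (entropy P X).
Let hy := fine (entropy P Y).
Let hxy := fine (HXY P X Y).
Let I := (hx + hy - hxy)%R.
Let G := gray_wyner P X Y.

Lemma C_fun_le (r0 r1 r2 r' : R) : G (r0, r1, r2) ->
  (r0 + r1 + r2 = hxy + r')%R -> C_fun P X Y r' <= r0%:E.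
Proof.
have [_ [_ _ fXY]] := entropies_fin mT1 mT2 HX HY.
move=> Gr e; apply: ereal_inf_lbound; exists r0 => //; exists r1, r2; split=> //.
by rewrite e -(fineK fXY).
Qed.

(** The infimum is not known to be attained, so points of the region are only taken strictly below a
    bound. *)
Lemma C_fun_has (r' b : R) : C_fun P X Y r' < b%:E ->
  exists r0 r1 r2 : R, [/\ G (r0, r1, r2), (r0 + r1 + r2 = hxy + r')%R & (r0 < b)%R].
Proof.
have [_ [_ _ fXY]] := entropies_fin mT1 mT2 HX HY.
move=> /ereal_inf_lt[_ [r0 [r1 [r2 [Gr e]]] <-] h]; exists r0, r1, r2.
by move: e h; rewrite -(fineK fXY) lte_fin => -[].
Qed.

Lemma C_fun_ge (r' : R) : (I - r')%:E <= C_fun P X Y r'.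
Proof.
have [_ [_ _ fXY]] := entropies_fin mT1 mT2 HX HY.
apply: le_ereal_inf_tmp => _ [r0 [r1 [r2 [Gr]]] + <-].
rewrite -(fineK fXY) -/hxy lee_fin => -[e].
have := gray_wyner_X mT1 mT2 HX HY Gr; have := gray_wyner_Y mT1 mT2 HX HY Gr.
by rewrite -/hx -/hy /I; clear -e; lra.
Qed.

(* Chord to the point (0, H(X), H(Y)) of the region, which lies over R' = I(X;Y). *)
Lemma C_fun_chord (r' x h : R) : C_fun P X Y r' = x%:E -> (0 < h < I - r')%R ->
  C_fun P X Y (r' + h) <= (x + - (x / (I - r')) * h)%:E.
Proof.
move=> Cx /andP[h0 hL].
have L0 : (0 < I - r')%R by exact: lt_trans hL.
pose t := (h / (I - r'))%R.
have t1 : (t < 1)%R by rewrite ltr_pdivrMr ?mul1r.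
have t0 : (0 <= t)%R by rewrite divr_ge0// ltW.
have s0 : (0 < 1 - t)%R by rewrite subr_gt0.
have -> : (x + - (x / (I - r')) * h = x * (1 - t))%R by rewrite /t; ring.
(* Dividing by [1 - t] leaves C(R') alone on the right, where an error [e] can be added. *)
rewrite EFinM -lee_pdivrMr// -Cx; apply/lee_addgt0Pr => e e0.
have [|r0 [r1 [r2 [Gr s r0e]]]] := @C_fun_has r' (x + e).
  by rewrite Cx lte_fin ltrDl.
rewrite Cx -EFinD (le_trans _ (_ : r0%:E <= _)) ?lee_fin ?(ltW r0e)//.
rewrite lee_pdivrMr// -EFinM.
have t01 : (0 <= t <= 1)%R by rewrite t0 ltW.
have := gray_wyner_convex t01 (gray_wyner_trivial mT1 mT2 HX HY) Gr.
rewrite mulr0 add0r mulrC => /C_fun_le; apply.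
have -> : h = (t * (I - r'))%R by rewrite divfK ?gt_eqF.
have -> : r0 = (hxy + r' - r1 - r2)%R by rewrite -s; ring.
by rewrite /I -/hx -/hy; ring.
Qed.

(** The chord has slope - C(R') / (I(X;Y) - R'), and a right derivative -1 is at most this slope, so
    C(R') <= I(X;Y) - R'; the lower bound [C_fun_ge] does the rest. *)
Lemma C_slopeN1_eq (r' : R) : C_slopeN1 P X Y r' ->
  (r' < I)%R /\ C_fun P X Y r' = (I - r')%:E.
Proof.
rewrite /C_slopeN1/= (IXYE mT1 mT2 HX HY) lte_fin => -[r0 rI D].
have L0 : (0 < I - r')%R by rewrite subr_gt0.
split=> //; apply/le_anti; rewrite C_fun_ge andbT.
have := right_derivative_fin L0 D => /fineK/esym Cx.
have := right_derivative_le L0 Cx (fun h => C_fun_chord Cx (h := h)) D.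
by rewrite lerN2 ler_pdivrMr// mul1r -lee_fin -Cx.
Qed.

(** Such a point lies on the lower bound I(X;Y) - R', with which its chord then coincides, so C is
    affine of slope -1 from there on. Positivity of [i] keeps the abscissa away from the excluded
    end I(X;Y). *)
Lemma C_slopeN1_intro (i b c : R) : G (i, b, c) -> (0 < i <= I)%R ->
  (i + b + c = hxy + (I - i))%R ->
  C_slopeN1 P X Y (I - i)%R /\ C_fun P X Y (I - i)%R = i%:E.
Proof.
move=> Gi /andP[i0 iI] s.
have iE : (I - (I - i) = i)%R by ring.
have Ci : C_fun P X Y (I - i)%R = i%:E.
  apply/le_anti; rewrite (C_fun_le Gi s) /=.
  by have := C_fun_ge (I - i); rewrite iE.
split=> //; split; first by rewrite subr_ge0.
  by rewrite (IXYE mT1 mT2 HX HY) lte_fin -/hx -/hy -/hxy -/I gtrBl.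
apply: (right_derivative_affine i0 Ci) => h /andP[h0 hi]; apply/le_anti.
have -> : (i + -1 * h = I - (I - i + h))%R by ring.
rewrite C_fun_ge andbT.
have := C_fun_chord (h := h) Ci; rewrite iE h0 hi => /(_ isT) /le_trans; apply.
by rewrite lee_fin divff ?gt_eqF// le_eqVlt; apply/orP; left; apply/eqP; ring.
Qed.

Lemma K_fun_ge (r0 r1 r2 r'' : R) : G (r0, r1, r2) ->
  (2 * r0 + r1 + r2 = hx + hy + r'')%R -> r0%:E <= K_fun P X Y r''.
Proof.
have [_ [fX fY _]] := entropies_fin mT1 mT2 HX HY.
move=> Gr e; apply: ereal_sup_ubound; exists r0 => //; exists r1, r2; split=> //.
by rewrite e -(fineK fX) -(fineK fY).
Qed.

Lemma K_fun_has (r'' b : R) : b%:E < K_fun P X Y r'' ->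
  exists r0 r1 r2 : R,
  [/\ G (r0, r1, r2), (2 * r0 + r1 + r2 = hx + hy + r'')%R & (b < r0)%R].
Proof.
have [_ [fX fY _]] := entropies_fin mT1 mT2 HX HY.
move=> /ereal_sup_gt[_ [r0 [r1 [r2 [Gr e]]] <-] h]; exists r0, r1, r2.
by move: e h; rewrite -(fineK fX) -(fineK fY) lte_fin => -[].
Qed.

Lemma K_fun_le (r'' : R) : K_fun P X Y r'' <= (I + r'')%:E.
Proof.
have [_ [fX fY _]] := entropies_fin mT1 mT2 HX HY.
apply: ge_ereal_sup => _ [r0 [r1 [r2 [Gr]]] + <-].
rewrite -(fineK fX) -(fineK fY) -/hx -/hy lee_fin => -[e].
have := gray_wyner_sum mT1 mT2 HX HY Gr.
by rewrite -/hxy /I; clear -e; lra.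
Qed.

(* Chord to the point (H(X,Y), 0, 0) of the region, which lies over
   R'' = H(X,Y) - I(X;Y). *)
Lemma K_fun_chord (r'' x h : R) : K_fun P X Y r'' = x%:E ->
  (0 < h < hxy - I - r'')%R ->
  (x + ((hxy - x) / (hxy - I - r'')) * h)%:E <= K_fun P X Y (r'' + h).
Proof.
move=> Kx /andP[h0 hL].
have L0 : (0 < hxy - I - r'')%R by exact: lt_trans hL.
pose t := (h / (hxy - I - r''))%R.
have t1 : (t < 1)%R by rewrite ltr_pdivrMr ?mul1r.
have t0 : (0 <= t)%R by rewrite divr_ge0// ltW.
have s0 : (0 < 1 - t)%R by rewrite subr_gt0.
have -> : (x + (hxy - x) / (hxy - I - r'') * h = t * hxy + (1 - t) * x)%R.
  by rewrite /t; ring.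
apply/lee_addgt0Pr => e e0.
have [|r0 [r1 [r2 [Gr s r0e]]]] := @K_fun_has r'' (x - e).
  by rewrite Kx lte_fin ltrBlDr ltrDl.
have t01 : (0 <= t <= 1)%R by rewrite t0 ltW.
have := gray_wyner_convex t01 (gray_wyner_full mT1 mT2 HX HY) Gr.
move=> /(K_fun_ge (r'' := (r'' + h)%R)) Kle.
rewrite -leeBlDr//; apply: le_trans (Kle _).
  by rewrite lee_fin -/hxy; clear -t0 t1 e0 r0e; nra.
have -> : h = (t * (hxy - I - r''))%R by rewrite divfK ?gt_eqF.
have -> : r1 = (hx + hy + r'' - 2 * r0 - r2)%R by rewrite -s; ring.
by rewrite /I -/hxy; ring.
Qed.

Lemma K_slope1_eq (r'' : R) : K_slope1 P X Y r'' ->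
  (I + r'' < hxy)%R /\ K_fun P X Y r'' = (I + r'')%:E.
Proof.
have [_ [_ _ fXY]] := entropies_fin mT1 mT2 HX HY.
rewrite /K_slope1/= (IXYE mT1 mT2 HX HY) -(fineK fXY) -EFinB lte_fin.
rewrite -/hx -/hy -/hxy -/I => -[r0 rI D].
have L0 : (0 < hxy - I - r'')%R by rewrite subr_gt0.
split; first by rewrite -ltrBrDl.
apply/le_anti; rewrite K_fun_le /=.
have := right_derivative_fin L0 D => /fineK/esym Kx.
have := right_derivative_ge L0 Kx (fun h => K_fun_chord Kx (h := h)) D.
by rewrite ler_pdivrMr// mul1r -addrA lerD2l -opprD lerN2 Kx lee_fin.
Qed.

(** The chord now coincides with the upper bound I(X;Y) + R''; [i < hxy] keeps the abscissa away
    from the excluded end H(X,Y) - I(X;Y). *)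
Lemma K_slope1_intro (i b c : R) : G (i, b, c) -> (I <= i < hxy)%R ->
  (2 * i + b + c = hx + hy + (i - I))%R ->
  K_slope1 P X Y (i - I)%R /\ K_fun P X Y (i - I)%R = i%:E.
Proof.
move=> Gi /andP[Ii iH] s.
have [_ [_ _ fXY]] := entropies_fin mT1 mT2 HX HY.
have iE : (I + (i - I) = i)%R by ring.
have Ki : K_fun P X Y (i - I)%R = i%:E.
  apply/le_anti; rewrite (K_fun_ge Gi s) andbT.
  by have := K_fun_le (i - I); rewrite iE.
have L0 : (0 < hxy - i)%R by rewrite subr_gt0.
have LE : (hxy - I - (i - I) = hxy - i)%R by ring.
split=> //; split; first by rewrite subr_ge0.
  rewrite (IXYE mT1 mT2 HX HY) -(fineK fXY) -EFinB lte_fin -/hx -/hy -/hxy -/I.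
  by rewrite ltrD2r.
apply: (right_derivative_affine L0 Ki) => h /andP[h0 hi]; apply/le_anti.
have -> : (i + 1 * h = I + (i - I + h))%R by ring.
rewrite K_fun_le /=.
have := K_fun_chord (h := h) Ki; rewrite LE h0 hi => /(_ isT) /(le_trans _); apply.
by rewrite lee_fin divff ?gt_eqF// le_eqVlt; apply/orP; left; apply/eqP; ring.
Qed.

(** When R0 approaches C(R') = I(X;Y) - R' along R0 + R1 + R2 = H(X,Y) + R', the sum 2 R0 + R1 + R2
    approaches H(X) + H(Y), which is the input of [gacs_korner_face]. *)
Lemma C_slopeN1_gacs_korner (r' : R) : C_slopeN1 P X Y r' ->
  C_fun P X Y r' <= gacs_korner P X Y.
Proof.
move=> /C_slopeN1_eq[rI Cr].
have [e e0|u [mX mY iu]] := @gacs_korner_face _ _ _ _ _ _ _ P X Y mT1 mT2 HX HY (I - r').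
  have [|r0 [r1 [r2 [Gr s r0e]]]] := @C_fun_has r' (I - r' + e).
    by rewrite Cr lte_fin ltrDl.
  exists r0, r1, r2; split=> //.
    by move: s r0e; rewrite -/hx -/hy /I; lra.
  have := C_fun_le Gr s; rewrite Cr lee_fin => h.
  by rewrite lerBlDr (le_trans h)// lerDl ltW.
rewrite Cr (le_trans _ (_ : jd_info u <= _))//.
  by rewrite (jd_infoE mT1 mT2 HX HY) lee_fin.
apply: ereal_sup_ubound; exists u; split=> //.
  exact/(jd_markov_YXU mT1 mT2 HX HY).
exact/(jd_markov_XYU mT1 mT2 HX HY).
Qed.

(** A U satisfying both chains gives a point over R' = I(X;Y) - I(X,Y;U). Zero information would
    land on the excluded end of the domain, hence the strict inequality. *)
Lemma gacs_korner_C_slopeN1 (u : jointly_distributed P X Y) :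
  markov_chain (jd_P u) (jd_Y u) (jd_X u) (jd_U u) ->
  markov_chain (jd_P u) (jd_X u) (jd_Y u) (jd_U u) -> 0 < jd_info u ->
  exists2 r', C_slopeN1 P X Y r' & C_fun P X Y r' = jd_info u.
Proof.
move=> /(jd_markov_YXU mT1 mT2 HX HY) mX /(jd_markov_XYU mT1 mT2 HX HY) mY.
rewrite (jd_infoE mT1 mT2 HX HY) lte_fin => i0.
have [_ _ _ s0 _] := jd_entropy_bounds mT1 mT2 HX HY u.
have [] := C_slopeN1_intro (gray_wyner_jd mT1 mT2 HX HY u).
- by rewrite i0 /=; move: mX mY s0; rewrite -/hx -/hy -/hxy /I; lra.
- by move: mX mY; rewrite -/hx -/hy -/hxy /I; lra.
- by move=> S e; exists (I - (hxy - jd_entXY u))%R.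
Qed.

(** When R0 approaches K(R'') = I(X;Y) + R'', the constraint makes R0 + R1 + R2 approach H(X,Y),
    which is the input of [wyner_face]. *)
Lemma K_slope1_wyner (r'' : R) : K_slope1 P X Y r'' ->
  wyner P X Y <= K_fun P X Y r''.
Proof.
move=> /K_slope1_eq[rI Kr].
have [e e0|u [m iu]] := @wyner_face _ _ _ _ _ _ _ P X Y mT1 mT2 HX HY (I + r'').
  have [|r0 [r1 [r2 [Gr s r0e]]]] := @K_fun_has r'' (I + r'' - e).
    by rewrite Kr lte_fin ltrBlDr ltrDl.
  exists r0, r1, r2; split=> //.
    by move: s r0e; rewrite -/hxy /I; lra.
  have := K_fun_ge Gr s; rewrite Kr lee_fin => h.
  by rewrite (le_trans h)// lerDl ltW.
rewrite Kr (le_trans (_ : _ <= jd_info u))//; last first.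
  by rewrite (jd_infoE mT1 mT2 HX HY) lee_fin.
by apply: ereal_inf_lbound; exists u; split=> //; exact/(jd_markov_XUY mT1 mT2 HX HY).
Qed.

(** The point of U lies over R'' = I(X,Y;U) - I(X;Y), which is inside the domain exactly when the
    information is below H(X,Y). *)
Lemma wyner_K_slope1 (u : jointly_distributed P X Y) :
  markov_chain (jd_P u) (jd_X u) (jd_U u) (jd_Y u) -> jd_info u < HXY P X Y ->
  exists2 r'', K_slope1 P X Y r'' & K_fun P X Y r'' = jd_info u.
Proof.
have [_ [_ _ fXY]] := entropies_fin mT1 mT2 HX HY.
move=> /(jd_markov_XUY mT1 mT2 HX HY) m.
rewrite (jd_infoE mT1 mT2 HX HY) -(fineK fXY) lte_fin => iH.
have [_ _ _ _ [bX bY]] := jd_entropy_bounds mT1 mT2 HX HY u.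
have [] := K_slope1_intro (gray_wyner_jd mT1 mT2 HX HY u).
- by rewrite iH andbT; move: m bX bY; rewrite -/hx -/hy -/hxy /I; lra.
- by move: m; rewrite -/hx -/hy -/hxy /I; lra.
- by move=> S e; exists (hxy - jd_entXY u - I)%R.
Qed.

End slopes.

Theorem theorem5 (R : realType) (d d1 d2 : measure_display)
    (W : measurableType d) (T1 : measurableType d1) (T2 : measurableType d2)
    (mT1 : forall x : T1, measurable [set x])
    (mT2 : forall y : T2, measurable [set y])
    (P : probability W R) (X : {dRV P >-> T1}) (Y : {dRV P >-> T2})
    (HX : entropy P X < +oo) (HY : entropy P Y < +oo) :
  [/\ C_slopeN1 P X Y !=set0 ->
        gacs_korner P X Y =
          ereal_sup [set C_fun P X Y r' | r' in C_slopeN1 P X Y],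
      ~ (exists r' : R, C_slopeN1 P X Y r') -> gacs_korner P X Y = 0,
      K_slope1 P X Y !=set0 ->
        wyner P X Y =
          ereal_inf [set K_fun P X Y r'' | r'' in K_slope1 P X Y] &
      ~ (exists r'' : R, K_slope1 P X Y r'') -> wyner P X Y = HXY P X Y].
Proof.
have [_ [_ _ fXY]] := entropies_fin mT1 mT2 HX HY.
split.
- move=> [r Cr]; apply/le_anti/andP; split; last first.
    by apply: ge_ereal_sup => _ [r' Cr' <-]; exact: C_slopeN1_gacs_korner.
  apply: ge_ereal_sup => _ [u [mX mY ->]].
  (* A U without information has no R' of its own; the given slope point covers it, as C is positive
     there. *)
  have [i0|i0] := leP (jd_info u) 0.
    have [rI e] := C_slopeN1_eq mT1 mT2 HX HY Cr.
    apply: (le_trans i0); apply: le_trans (ereal_sup_ubound _); last by exists r.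
    by rewrite e lee_fin subr_ge0 ltW.
  have [r' Cr' <-] := gacs_korner_C_slopeN1 mT1 mT2 HX HY mX mY i0.
  by apply: ereal_sup_ubound; exists r'.
- move=> nC; apply/le_anti/andP; split.
    apply: ge_ereal_sup => _ [u [mX mY ->]]; rewrite leNgt; apply/negP => i0.
    have [r' Cr' _] := gacs_korner_C_slopeN1 mT1 mT2 HX HY mX mY i0.
    by apply: nC; exists r'.
  (* A U independent of the pair satisfies both chains and shows that the supremum is at least 0. *)
  have [u [a b c]] := exists_jd_trivial X Y mT1 mT2.
  apply: ereal_sup_ubound; exists u; split.
  + by apply/(jd_markov_YXU mT1 mT2 HX HY); rewrite a b addrC.
  + by apply/(jd_markov_XYU mT1 mT2 HX HY); rewrite a c addrC.
  + by rewrite (jd_infoE mT1 mT2 HX HY) a subrr.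
- move=> [r Kr]; apply/le_anti/andP; split.
    by apply: le_ereal_inf_tmp => _ [r' Kr' <-]; exact: K_slope1_wyner.
  apply: le_ereal_inf_tmp => _ [u [m ->]].
  (* A U with full information has no R'' of its own; the given slope point covers it, as K is below
     H(X,Y) there. *)
  have [iH|iH] := leP (HXY P X Y) (jd_info u).
    have [rI e] := K_slope1_eq mT1 mT2 HX HY Kr.
    apply: le_trans iH; apply: le_trans (ereal_inf_lbound _) _; first by exists r.
    by rewrite e -(fineK fXY) lee_fin ltW.
  have [r' Kr' <-] := wyner_K_slope1 mT1 mT2 HX HY m iH.
  by apply: ereal_inf_lbound; exists r'.
- move=> nK; apply/le_anti/andP; split; last first.
    apply: le_ereal_inf_tmp => _ [u [m ->]]; rewrite leNgt; apply/negP => iH.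
    have [r' Kr' _] := wyner_K_slope1 mT1 mT2 HX HY m iH.
    by apply: nK; exists r'.
  (* A U that determines the pair satisfies the chain and shows that the infimum is at most
     H(X,Y). *)
  have [u [a b c]] := exists_jd_full X Y mT1 mT2.
  apply: ereal_inf_lbound; exists u; split.
    by apply/(jd_markov_XUY mT1 mT2 HX HY); rewrite a b c addr0.
  by rewrite (jd_infoE mT1 mT2 HX HY) a subr0 fineK.
Qed.
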